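(* Let $\Gamma$ be in the class $\mathcal C$, acting by isometries on the corresponding space $X$, and consider its boundary representations $\pi_x$, $x\in X$, associated with the $\Gamma$-invariant quasi-conformal density $\mu=(\mu_x)_{x\in X}$ of dimension $\alpha=\alpha(\Gamma)$. Then for each $x\in X$ there exists a polynomial $Q$ of degree $3$ such that for all unit vectors $\xi\in L^2(\partial X,\mu_x)$ and all integers $n$, $$\sum_{\gamma\in\Gamma_n(x)}|\langle\pi_x(\gamma)\mathbf 1_{\partial X},\xi\rangle|^2\le Q(n),$$ where $\Gamma_n(x)=\{\gamma\in\Gamma: d(x,\gamma x)\le n\}$.
   Context: **Class $\mathcal C$.** All groups $\Gamma$ are nonelementary discrete groups of isometries of a $\delta$-hyperbolic space $X$ with $\alpha(\Gamma)<\infty$. The class $\mathcal C$ consists of: (i) convex cocompact groups of isometries of a (proper) CAT(-1) space $X$; (ii) nonuniform lattices in noncompact semisimple Lie groups of rank one, acting by isometries on their rank one symmetric space $X$ of noncompact type, with $d$ a left-invariant Riemannian metric; (iii) hyperbolic groups $\Gamma$ acting by isometries on $X=(\Gamma,d_S)$, $d_S$ the word metric of a finite symmetric generating set $S$. **Notation.** $\alpha(\Gamma)=\inf\{s>0:\sum_\gamma e^{-sd(\gamma x,x)}<\infty\}$; $\partial X$ is the Gromov boundary, $\overline X=X\cup\partial X$; $\Lambda_\Gamma=\overline{\Gamma x}\cap\partial X$; $GH(\Lambda_\Gamma)$ is the union of all geodesics of $X$ with both endpoints in $\Lambda_\Gamma$, $CH(\Lambda_\Gamma)$ the smallest subset containing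 $GH(\Lambda_\Gamma)$ and all geodesic segments between its points; $\Gamma$ is convex cocompact if it acts cocompactly on $CH(\Lambda_\Gamma)$. The Gromov product is $(y,z)_x=\frac12(d(x,y)+d(x,z)-d(y,z))$, extended to $\overline X$ by $(v,w)_x=\sup\liminf_{i,j}(a_i,b_j)_x$ over sequences $a_i\to v$, $b_j\to w$; $\beta_v(x,y)=2(v,y)_x-d(x,y)$. **Density.** A $\Gamma$-invariant quasi-conformal density of dimension $\alpha$ is a map $x\in X\mapsto\mu_x$ into positive finite measures on $\overline X$ such that for some $C_q>0$ and all $x,y\in X$, $\mu_x,\mu_y$ are equivalent with $C_q^{-1}e^{\alpha\beta_v(x,y)}\le\frac{d\mu_y}{d\mu_x}(v)\le C_qe^{\alpha\beta_v(x,y)}$ a.e., and $\gamma_*\mu_x=\mu_{\gamma x}$ for $\gamma\in\Gamma$. For $\Gamma\in\mathcal C$ there is such a density of dimension $\alpha(\Gamma)$ satisfying the following Harish-Chandra estimates, and $\mu$ denotes it: with $\varphi_x(y)=\int_{\partial X}\big(\frac{d\mu_y}{d\mu_x}(v)\big)^{1/2}d\mu_x(v)$, there are $R>0$ and polynomials $Q_1,Q_2$ of degree one with positive coefficients with $Q_1(d(x,y))e^{-\frac\alpha2d(x,y)}\le\varphi_x(y)\le Q_2(d(x,y))e^{-\frac\alpha2d(x,y)}$ for all $y\in GH(\Lambda_\Gamma)$ with $d(x,y)$ at least $R$. **Boundary representation.** $\pi_x:\Gamma\to\mathcal U(L^2(\partial X,\mu_x))$, $(\pi_x(\gamma)\xi)(v)=\big(\frac{d\mu_{\gamma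 x}}{d\mu_x}(v)\big)^{1/2}\xi(\gamma^{-1}v)$. $\mathbf 1_{\partial X}$ is the characteristic function of $\partial X$.
   Formalization: ''All integers n'' is read as all integers n ≥ 0: a real polynomial of degree 3 is negative at infinitely many integers, so it cannot bound the nonnegative sums for every integer n; for n < 0 the set Γ_n(x) is empty. *)

(* Defs.v *)
From HB Require Import structures.
From mathcomp Require Import all_boot all_order all_algebra.
From mathcomp Require Import all_classical all_reals all_analysis.
From mathcomp Require Import complex.

Set Implicit Arguments.
Unset Strict Implicit.
Unset Printing Implicit Defensive.

Import Order.TTheory GRing.Theory Num.Theory.
Import numFieldNormedType.Exports.
Import ComplexField.Normc.

Local Open Scope classical_set_scope.
Local Open Scope complex_scope.
Local Open Scope ring_scope.

(* The library puts the Borel sigma-algebra on pointed types only, hence the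
   nonempty spaces below are pointed; the chosen point is only used as a base
   point in notions that do not depend on it. *)
#[short(type="pmetricType")]
HB.structure Definition PMetric (K : numDomainType) :=
  { M of Metric K M & Pointed M }.

Section Metric.
Context {R : realType}.

Record isom_action (Gamma : groupType) (X : pmetricType R) := IsomAction {
  act :> Gamma -> X -> X;
  act1 : forall x, act 1%g x = x;
  actM : forall g h x, act (g * h)%g x = act g (act h x);
  act_isom : forall g x y, mdist (act g x) (act g y) = mdist x y }.

Context {X : pmetricType R}.

Definition gromov_product (x y z : X) : R :=
  (mdist x y + mdist x z - mdist y z) / 2.

Definition hyperbolic_space : Prop :=
  exists2 delta : R, 0 <= delta & forall w x y z : X,
    Num.min (gromov_product w x y) (gromov_product w y z) - delta
      <= gromov_product w x z.

Definition proper_space : Prop :=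
  forall (x : X) (r : R), compact [set y : X | mdist x y <= r].

(* Parameter set of geodesics: the word metric of a group only has geodesics
   parametrised by integers. *)
Variant time := RealTime | IntegerTime.
Definition times (T : time) : set R :=
  if T is RealTime then setT else [set k%:~R | k in [set: int]].

Definition isometric_on (I : set R) (c : R -> X) : Prop :=
  forall s t, I s -> I t -> mdist (c s) (c t) = `|s - t|.

Definition geodesic_segment (x y : X) (c : R -> X) : Prop :=
  [/\ isometric_on `[0, mdist x y] c, c 0 = x & c (mdist x y) = y].

Definition geodesic_line (T : time) (c : R -> X) : Prop :=
  isometric_on (times T) c.

Definition diverge_together (a b : nat -> X) : Prop :=
  forall (x : X) (M : R), exists n0, forall i j, (n0 <= i)%N -> (n0 <= j)%N ->
    M <= gromov_product x (a i) (b j).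

(* A boundary point is an equivalence class of sequences converging to
   infinity. *)
Definition boundary_class (A : set (nat -> X)) : Prop :=
  exists2 a, diverge_together a a
    & A = [set b | diverge_together b b /\ diverge_together a b].

Definition boundary := {A : set (nat -> X) | boundary_class A}.

Inductive bordification := Inner of X | Bdry of boundary.

HB.instance Definition _ := gen_eqMixin bordification.
HB.instance Definition _ := gen_choiceMixin bordification.
HB.instance Definition _ := isPointed.Build bordification (Inner point).

Definition tends_to (a : nat -> X) (v : bordification) : Prop :=
  match v with
  | Inner y => a @ \oo --> y
  | Bdry w => sval w a
  end.

Definition liminf2 (u : nat -> nat -> R) : \bar R :=
  ereal_sup [set ereal_inf [set (u i j)%:E | i in [set i | (n <= i)%N]
                                         & j in [set j | (n <= j)%N]] | n in [set: nat]].

Definition ext_gromov_product (x : X) (v w : bordification) : \bar R :=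
  ereal_sup [set l | exists a b, [/\ tends_to a v, tends_to b w
    & l = liminf2 (fun i j => gromov_product x (a i) (b j))]].

(* finite, since the second argument of the Gromov product is in X *)
Definition busemann (v : bordification) (x y : X) : R :=
  2 * fine (ext_gromov_product x v (Inner y)) - mdist x y.

Definition bordification_open (U : set bordification) : Prop :=
  open [set y | U (Inner y)] /\
  forall v, U (Bdry v) -> forall x, exists r : R,
    [set w | (r%:E < ext_gromov_product x (Bdry v) w)%E] `<=` U.

Fact bordification_openT : bordification_open setT.
Proof. by split; [exact: openT|move=> v _ x; exists 0]. Qed.

Fact bordification_openI : setI_closed bordification_open.
Proof.
move=> U V [oU bU] [oV bV]; split; first exact: (openI oU oV).
move=> v [Uv Vv] x; have [r rU] := bU _ Uv x; have [s sV] := bV _ Vv x.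
exists (Num.max r s) => w /=; rewrite EFin_max gt_max => /andP[rw sw].
by split; [exact: rU|exact: sV].
Qed.

Fact bordification_open_bigU (I : Type) (f : I -> set bordification) :
  (forall i, bordification_open (f i)) -> bordification_open (\bigcup_i f i).
Proof.
move=> of_; split.
  rewrite (_ : [set _ | _] = \bigcup_i [set y | f i (Inner y)])//.
  by apply: bigcup_open => i _; case: (of_ i).
move=> v [i _ fiv] x; have [r rf] := (of_ i).2 _ fiv x.
by exists r => w /rf fw; exists i.
Qed.

HB.instance Definition _ := isOpenTopological.Build bordification
  bordification_openT bordification_openI bordification_open_bigU.

Definition borel_bordification : Type :=
  g_sigma_algebraType (@open bordification).
HB.instance Definition _ := Measurable.on borel_bordification.

Definition bdry : set borel_bordification := range Bdry.

Section Action.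
Context {Gamma : groupType} (rho : isom_action Gamma X).

Fact diverge_act g a b :
  diverge_together a b -> diverge_together (rho g \o a) (rho g \o b).
Proof.
move=> ab x M; have [n0 n0P] := ab (rho g^-1%g x) M.
exists n0 => i j ni nj; apply: (le_trans (n0P i j ni nj)) => /=.
have isoE y : mdist x (rho g y) = mdist (rho g^-1%g x) y.
  by rewrite -[RHS](act_isom rho g) -actM mulgV act1.
by rewrite /gromov_product !isoE act_isom.
Qed.

Fact boundary_class_act g A : boundary_class A ->
  boundary_class [set rho g \o a | a in A].
Proof.
move=> [a aa ->]; exists (rho g \o a); first exact: diverge_act.
apply/seteqP; split => [_ [b [bb ab] <-]|b [bb ab]] /=.
  by split; exact: diverge_act.
have gK c : rho g^-1%g \o (rho g \o c) = c.
  by apply/funext => n /=; rewrite -actM mulVg act1.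
exists (rho g^-1%g \o b).
  split; first exact: diverge_act.
  by have := diverge_act g^-1%g ab; rewrite gK.
by apply/funext => n /=; rewrite -actM mulgV act1.
Qed.

Definition bact (g : Gamma) (v : borel_bordification) : borel_bordification :=
  match v with
  | Inner y => Inner (rho g y)
  | Bdry w => Bdry (exist _ _ (boundary_class_act g (svalP w)))
  end.

Definition discrete_action : Prop :=
  forall (x : X) (r : R), finite_set [set g | mdist x (rho g x) <= r].

Definition orbit_ball (x : X) (n : nat) : set Gamma :=
  [set g | mdist x (rho g x) <= n%:R].

Definition limit_set : set boundary :=
  [set v | closure [set Inner (rho g point) | g in [set: Gamma]] (Bdry v)].

Definition nonelementary : Prop :=
  exists u v w, [/\ limit_set u, limit_set v & limit_set w] /\
    [/\ u <> v, v <> w & u <> w].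

Definition critical_exponent : \bar R :=
  ereal_inf [set s%:E | s in [set s : R | 0 < s /\
    (\esum_(g in [set: Gamma]) (expR (- s * mdist (rho g point) point))%:E
       < +oo)%E]].

Definition geodesic_hull (T : time) : set X :=
  [set y | exists c v w, [/\ geodesic_line T c, limit_set v /\ limit_set w,
     sval v (fun n : nat => c n%:R), sval w (fun n : nat => c (- n%:R))
   & exists2 t, times T t & y = c t]].

Definition convex_hull : set X :=
  \bigcap_(C in [set C : set X | geodesic_hull RealTime `<=` C /\
     forall x y c, C x -> C y -> geodesic_segment x y c ->
       forall t, t \in `[0, mdist x y] -> C (c t)]) C.

(* upper half-plane model of the hyperbolic plane *)
Definition half_plane : set (R * R) := [set u | 0 < u.2].
Definition acosh (t : R) : R := ln (t + Num.sqrt (t ^+ 2 - 1)).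
Definition half_plane_dist (u v : R * R) : R :=
  acosh (1 + ((u.1 - v.1) ^+ 2 + (u.2 - v.2) ^+ 2) / (2 * u.2 * v.2)).

Definition geodesic_space : Prop :=
  forall x y : X, exists c, geodesic_segment x y c.

(* Comparison for two points on the two sides issued from x of a geodesic
   triangle x, y, z; [bx], [by_], [bz], [bp], [bq] are comparison points in
   the hyperbolic plane. *)
Definition cat_minus_one : Prop :=
  geodesic_space /\
  forall (x y z : X) (c1 c2 : R -> X) (s t : R) (bx by_ bz bp bq : R * R),
    geodesic_segment x y c1 -> geodesic_segment x z c2 ->
    s \in `[0, mdist x y] -> t \in `[0, mdist x z] ->
    half_plane bx -> half_plane by_ -> half_plane bz ->
    half_plane bp -> half_plane bq ->
    half_plane_dist bx by_ = mdist x y ->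
    half_plane_dist by_ bz = mdist y z ->
    half_plane_dist bx bz = mdist x z ->
    half_plane_dist bx bp = s -> half_plane_dist bp by_ = mdist x y - s ->
    half_plane_dist bx bq = t -> half_plane_dist bq bz = mdist x z - t ->
    mdist (c1 s) (c2 t) <= half_plane_dist bp bq.

Definition convex_cocompact : Prop :=
  exists C : set X, [/\ compact C, C `<=` convex_hull
    & convex_hull `<=` \bigcup_g [set rho g y | y in C]].

Definition class_convex_cocompact : Prop :=
  [/\ proper_space, cat_minus_one, injective (rho : Gamma -> X -> X)
    & convex_cocompact].

Definition word_product (w : seq Gamma) : Gamma :=
  foldr (fun s t => s * t)%g 1%g w.

Definition word_in (S : set Gamma) : set (seq Gamma) :=
  [set w : seq Gamma | forall s, s \in w -> S s].

Definition word_dist (S : set Gamma) (g h : Gamma) : R :=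
  inf [set (size w)%:R | w in
    [set w | word_in S w /\ word_product w = (g^-1 * h)%g]].

(* X is, up to the bijection f, the set Gamma with the word metric of S and
   the action by left translations; hyperbolicity of Gamma is then the one of
   X. *)
Definition class_hyperbolic_group : Prop :=
  hyperbolic_space /\
  exists (S : set Gamma) (f : Gamma -> X),
    [/\ finite_set S, forall s, S s -> S s^-1%g,
        forall g, exists2 w, word_in S w & word_product w = g,
        bijective f &
     (forall g h, mdist (f g) (f h) = word_dist S g h) /\
     (forall g h, rho g (f h) = f (g * h)%g)].

End Action.
End Metric.

Arguments bordification {R} X.
Arguments boundary {R} X.
Arguments borel_bordification {R} X.
Arguments hyperbolic_space {R} X.
Arguments proper_space {R} X.
Arguments cat_minus_one {R} X.
Arguments bdry {R X}.

HB.mixin Record Group_isTopological G & PointedTopological G & Group G := {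
  mulg_continuous : continuous (fun z : G * G => (z.1 * z.2)%g);
  invg_continuous : continuous (fun z : G => (z^-1)%g)
}.

#[short(type="topGroupType")]
HB.structure Definition TopGroup :=
  { G of PointedTopological G & Group G & Group_isTopological G }.

Section LinearLieGroups.
Context {R : realType} {N : nat}.
Local Notation M := 'M[R]_N.

Definition linear_group (L : set M) : Prop :=
  [/\ L `<=` [set A | A \in unitmx], L 1%:M,
      forall A B, L A -> L B -> L (A *m B)
    & forall A, L A -> L (invmx A)].

Definition closed_linear_group (L : set M) : Prop :=
  linear_group L /\ closure L `&` [set A | A \in unitmx] `<=` L.

Definition bracket (A B : M) : M := A *m B - B *m A.

(* Lie algebra of a closed linear group: its tangent space at the identity *)
Definition is_lie_algebra_of (L : set M) (g : {vspace M}) : Prop :=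
  forall A, A \in g <->
    exists c : R -> M, [/\ forall t, L (c t), c 0 = 1%:M
      & is_derive (0 : R) (1 : R) c A].

Definition commutative_subspace (a : {vspace M}) : Prop :=
  forall A B, A \in a -> B \in a -> bracket A B = 0.

Definition ideal_of (g i : {vspace M}) : Prop :=
  (i <= g)%VS /\ forall A B, A \in g -> B \in i -> bracket A B \in i.

Definition semisimple (g : {vspace M}) : Prop :=
  forall i, ideal_of g i -> commutative_subspace i -> i = 0%VS.

(* trace of ad A \o ad B on g *)
Definition killing_form (g : {vspace M}) (A B : M) : R :=
  \sum_(i < \dim g)
    coord (vbasis g) i (bracket A (bracket B (vbasis g)`_i)).

Definition cartan_decomposition (g k p : {vspace M}) : Prop :=
  [/\ (k + p)%VS = g, (k :&: p)%VS = 0%VS,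
   [/\ forall A B, A \in k -> B \in k -> bracket A B \in k,
       forall A B, A \in k -> B \in p -> bracket A B \in p
     & forall A B, A \in p -> B \in p -> bracket A B \in k],
   forall A, A \in k -> A != 0 -> killing_form g A A < 0
 & forall A, A \in p -> A != 0 -> 0 < killing_form g A A].

Definition real_rank (p : {vspace M}) (r : nat) : Prop :=
  (exists a, [/\ (a <= p)%VS, commutative_subspace a & \dim a = r]) /\
  forall a, (a <= p)%VS -> commutative_subspace a -> (\dim a <= r)%N.

Definition maximal_compact (L K : set M) : Prop :=
  [/\ linear_group K, compact K, K `<=` L &
   forall K', linear_group K' -> compact K' -> K' `<=` L -> K `<=` K' ->
     K' = K].

(* A left-invariant Riemannian metric on L / K, as a K-invariant inner product
   on g / k, that is a semi-definite form on g with null space k (values off g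
   are irrelevant). *)
Definition invariant_metric (K : set M) (g k : {vspace M}) (q : M -> M -> R) :
    Prop :=
  [/\ forall a A B C, q (a *: A + B) C = a * q A C + q B C,
      forall A B, q A B = q B A,
      forall A, A \in g -> 0 <= q A A,
      forall A, A \in g -> (q A A = 0 <-> A \in k)
    & forall h A B, K h -> A \in g -> B \in g ->
        q (h *m A *m invmx h) (h *m B *m invmx h) = q A B].

Definition C1_path (L : set M) (c : R -> M) : Prop :=
  [/\ forall t, L (c t), forall t, derivable c t 1 & continuous (derive1 c)].

(* Length of the image in L / K of the path c. *)
Definition path_length (q : M -> M -> R) (c : R -> M) : R :=
  \int[lebesgue_measure]_(t in `[0, 1])
    Num.sqrt (q (invmx (c t) *m derive1 c t) (invmx (c t) *m derive1 c t)).

(* X is the connected manifold L / K, with projection pr, and the Riemannian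
   distance of q; every C1 path in L / K lifts to L. *)
Definition homogeneous_riemannian (L K : set M) (q : M -> M -> R)
    (X : pmetricType R) (pr : M -> X) : Prop :=
  let paths g h := [set c | C1_path L c /\ pr (c 0) = pr g /\ pr (c 1) = pr h] in
  [/\ pr @` L = setT,
      forall g h, L g -> L h -> (pr g = pr h <-> K (invmx g *m h)),
      forall g h, L g -> L h -> paths g h !=set0
    & forall g h, L g -> L h ->
        mdist (pr g) (pr h) = inf [set path_length q c | c in paths g h]].

(* Semisimple Lie groups (with finite center) need not be linear; but G is a
   finite extension of its image by the adjoint representation, which is a
   closed linear group with the same Lie algebra and the same symmetric
   space. *)
Definition finite_extension (G : topGroupType) (L : set M) (Ad : G -> M) :
    Prop :=
  [/\ hausdorff_space G,
      closed_linear_group L,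
      range Ad = L /\ (forall g h, Ad (g * h)%g = Ad g *m Ad h),
      continuous Ad /\ (forall U : set G, open U ->
        exists2 V : set M, open V & Ad @` U = L `&` V)
    & finite_set [set g | Ad g = 1%:M]].

End LinearLieGroups.

Section Lattices.
Context {R : realType} {G : topGroupType} {Gamma : groupType}.

Definition borel_group : Type := g_sigma_algebraType (@open G).
HB.instance Definition _ := Measurable.on borel_group.

Definition haar_measure (m : {measure set borel_group -> \bar R}) : Prop :=
  [/\ forall g (A : set borel_group), measurable A ->
        m [set (g * h : G)%g | h in (A : set G)] = m A,
      forall A : set G, compact A -> measurable (A : set borel_group) ->
        (m A < +oo)%E
    & forall U : set G, open U -> U !=set0 -> (0 < m U)%E].

Definition discrete_subgroup (iota : Gamma -> G) : Prop :=
  [/\ injective iota, forall g h, iota (g * h)%g = (iota g * iota h)%g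
    & exists2 U, nbhs (1%g : G) U & forall g, U (iota g) -> g = 1%g].

Definition translates (iota : Gamma -> G) (A : set G) : set G :=
  [set (h * iota g)%g | h in A & g in [set: Gamma]].

Definition nonuniform_lattice (iota : Gamma -> G) : Prop :=
  [/\ discrete_subgroup iota,
      exists2 m : {measure set borel_group -> \bar R}, haar_measure m &
        exists F : set borel_group, [/\ measurable F, (m F < +oo)%E
          & translates iota F = setT]
    & ~ exists2 C : set G, compact C & translates iota C = setT].

End Lattices.

Section ClassC.
Context {R : realType} {X : pmetricType R} {Gamma : groupType}.
Variable rho : isom_action Gamma X.

Definition class_rank_one_lattice : Prop :=
  exists (N : nat) (G : topGroupType) (Ad : G -> 'M[R]_N)
    (L K : set 'M[R]_N) (g k p : {vspace 'M[R]_N})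
    (q : 'M[R]_N -> 'M[R]_N -> R) (pr : 'M[R]_N -> X) (iota : Gamma -> G),
    [/\ [/\ finite_extension L Ad, ~ compact [set: G],
            is_lie_algebra_of L g & semisimple g],
        [/\ maximal_compact L K, is_lie_algebra_of K k,
            cartan_decomposition g k p & real_rank p 1],
        invariant_metric K g k q /\ homogeneous_riemannian L K q pr,
        nonuniform_lattice (R := R) iota
      & forall a h, L h -> rho a (pr h) = pr (Ad (iota a) *m h)].

Definition class_C (T : time) : Prop :=
  match T with
  | RealTime => class_convex_cocompact rho \/ class_rank_one_lattice
  | IntegerTime => class_hyperbolic_group rho
  end.

Definition density := X -> {finite_measure set (borel_bordification X) -> \bar R}.
Implicit Type mu : density.

(* the Radon-Nikodym derivative d mu_y / d mu_x *)
Definition rn_derivative mu (x y : X) (v : borel_bordification X) : R :=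
  fine (Radon_Nikodym (charge_of_finite_measure (mu y)) (mu x) v).

Definition quasi_conformal_density (alpha : R) mu : Prop :=
  [/\ forall x y, mu y `<< mu x,
      exists2 C : R, 0 < C & forall x y, {ae mu x, forall v,
        C^-1 * expR (alpha * busemann v x y) <= rn_derivative mu x y v
          <= C * expR (alpha * busemann v x y)}
    & forall (g : Gamma) x (A : set (borel_bordification X)), measurable A ->
        pushforward (mu x) (bact rho g) A = mu (rho g x) A].

Definition spherical_function mu (x y : X) : R :=
  \int[mu x]_(v in bdry) Num.sqrt (rn_derivative mu x y v).

Definition positive_degree_one (Q : {poly R}) : Prop :=
  size Q = 2%N /\ forall i, (i < 2)%N -> 0 < Q`_i.

Definition harish_chandra (T : time) (alpha : R) mu : Prop :=
  forall x, exists (r : R) (Q1 Q2 : {poly R}),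
    [/\ 0 < r, positive_degree_one Q1, positive_degree_one Q2 &
     forall y, geodesic_hull rho T y -> r <= mdist x y ->
       Q1.[mdist x y] * expR (- (alpha / 2) * mdist x y)
         <= spherical_function mu x y
         <= Q2.[mdist x y] * expR (- (alpha / 2) * mdist x y)].

(* Vectors of L^2(boundary, mu x) are represented by complex functions on the
   bordification, of which only the restriction to the boundary matters. *)
Definition L2_inner mu (x : X) (xi eta : borel_bordification X -> R[i]) : R[i] :=
  (\int[mu x]_(v in bdry) complex.Re (xi v * (eta v)^*)) +i*
  (\int[mu x]_(v in bdry) complex.Im (xi v * (eta v)^*)).

Definition L2_unit_vector mu (x : X) (xi : borel_bordification X -> R[i]) : Prop :=
  [/\ measurable_fun bdry (@complex.Re R \o xi),
      measurable_fun bdry (@complex.Im R \o xi)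
    & (\int[mu x]_(v in bdry) (normc (xi v) ^+ 2)%:E = 1)%E].

Definition boundary_rep mu (x : X) (g : Gamma)
    (xi : borel_bordification X -> R[i]) : borel_bordification X -> R[i] :=
  fun v => (Num.sqrt (rn_derivative mu x (rho g x) v))%:C
             * xi (bact rho g^-1%g v).

Definition one_bdry : borel_bordification X -> R[i] :=
  fun v => if v \in bdry then 1 else 0.

End ClassC.

(* Main.v *)
(* Write h_g for the square root of the density of mu_(g x) with respect to mu_x,
   and let C_m be the set of the g with m <= d(x, g x) <= m + 1. Testing the
   family (h_g) against xi as in Schur's lemma bounds the sum over C_m by
   (sup_g phi_x(g x)) * ess sup_v (sum_g h_g(v)). The first factor is
   O((1 + m) e^(-alpha m/2)) by the upper Harish-Chandra estimate. The second
   one is O((1 + m) e^(alpha m/2)): by hyperbolicity it is enough to sum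
   e^(alpha (g x, g0 x)_x) over C_m for a fixed g0 in C_m, and a shadow argument
   compares this sum with e^(3 alpha m/2) phi_x(g0 x). The required lower bound
   on the mass of the shadows follows from the lower Harish-Chandra estimate at
   two far points of a geodesic line of the hull. So the sum over C_m is
   O((1 + m)^2), and summing over m <= n gives a cubic bound.
   The hull contains a geodesic line because X is proper and almost geodesic.
   This is immediate except for lattices, where X = L / K comes with the infimum
   of the lengths of paths in L: closed balls are compact because a form
   invariant under K controls the growth of paths, and small displacements are
   realized by exponentials by the closed subgroup theorem. *)

Require Import Defs.
From HB Require Import structures.
From mathcomp Require Import all_boot all_order all_algebra.
From mathcomp Require Import all_classical all_reals all_analysis.
From mathcomp Require Import measurable_realfun.
From mathcomp Require Import complex ring lra.

Set Implicit Arguments.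
Unset Strict Implicit.
Unset Printing Implicit Defensive.

Import Order.TTheory GRing.Theory Num.Theory.
Import numFieldNormedType.Exports.
Import ComplexField.Normc.

Local Open Scope classical_set_scope.
Local Open Scope complex_scope.
Local Open Scope ring_scope.

(** * Gromov products with boundary points *)

(** The Harish-Chandra estimates are assumed at points of the hull only, so they say nothing until
    points of the hull are known; this is the obstacle behind the geodesic line and all the geometry
    of L / K. The orbit of x need not meet the hull. But the hull is invariant, so the upper
    estimate holds along the orbit of a point of the line, and phi_x changes by a bounded factor
    over a bounded distance. The mass of the shadows comes from the linear factor of the lower
    estimate. At a point z, phi_x(z) is at least of order d(x, z) e^(-alpha d(x, z)/2), whereas the
    boundary points whose product with z is bounded contribute only O(e^(-alpha d(x, z)/2)). For a
    given y, one end of the line is seen from x away from y; there the boundary points close to y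
    contribute too little, and the rest must carry mass. The same factor forces alpha > 0, which is
    needed to convert bounds on densities into bounds on Gromov products. *)

Section GromovProduct.
Context {R : realType} {X : pmetricType R}.
Implicit Types x y z w : X.

Lemma gromov_productC x y z : gromov_product x y z = gromov_product x z y.
Proof. by rewrite /gromov_product (metric_sym y z) (addrC (mdist x y)). Qed.

Lemma gromov_product_ge0 x y z : 0 <= gromov_product x y z.
Proof.
have := metric_triangle y x z; rewrite (metric_sym y x) /gromov_product; lra.
Qed.

Lemma gromov_product_le x y z : gromov_product x y z <= mdist x z.
Proof.
have := metric_triangle x z y; rewrite (metric_sym z y) /gromov_product; lra.
Qed.

Lemma gromov_product_lip x y z z' :
  `|gromov_product x y z - gromov_product x y z'| <= mdist z z'.
Proof.
have := metric_triangle x z' z; have := metric_triangle x z z'.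
have := metric_triangle y z' z; have := metric_triangle y z z'.
by rewrite (metric_sym z' z) ler_norml /gromov_product => ? ? ? ?; apply/andP; split; lra.
Qed.

Lemma gromov_product_base_lip x x' y z :
  `|gromov_product x y z - gromov_product x' y z| <= mdist x x'.
Proof.
have := metric_triangle x x' z; have := metric_triangle x' x z.
have := metric_triangle x x' y; have := metric_triangle x' x y.
by rewrite (metric_sym x' x) ler_norml /gromov_product => ? ? ? ?; apply/andP; split; lra.
Qed.

Lemma gromov_product_swap x y z :
  gromov_product x z y + gromov_product y z x = mdist x y.
Proof.
by rewrite /gromov_product (metric_sym y x) (metric_sym z y) (metric_sym z x); lra.
Qed.

Lemma gromov_product_act (Gamma : groupType) (rho : isom_action Gamma X) g x y z :
  gromov_product (rho g x) (rho g y) (rho g z) = gromov_product x y z.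
Proof. by rewrite /gromov_product !act_isom. Qed.

Lemma diverge_together_sym (a b : nat -> X) :
  diverge_together a b -> diverge_together b a.
Proof.
move=> ab x M; have [n0 n0P] := ab x M.
by exists n0 => i j ni nj; rewrite gromov_productC; exact: n0P.
Qed.

Lemma diverge_together_base (a b : nat -> X) x :
  (forall M : R, exists n0, forall i j, (n0 <= i)%N -> (n0 <= j)%N ->
     M <= gromov_product x (a i) (b j)) -> diverge_together a b.
Proof.
move=> ab x' M; have [n0 n0P] := ab (M + mdist x x').
exists n0 => i j ni nj; have := n0P _ _ ni nj.
have := gromov_product_base_lip x x' (a i) (b j); rewrite ler_norml; lra.
Qed.

Context (delta : R).
Hypothesis hyp : forall w x y z : X,
  Num.min (gromov_product w x y) (gromov_product w y z) - delta
    <= gromov_product w x z.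

Lemma gromov_product_hyp w x y z (t : R) :
  t <= gromov_product w x y -> t <= gromov_product w y z ->
  t - delta <= gromov_product w x z.
Proof.
by move=> tx ty; apply: le_trans (hyp w x y z); rewrite lerD2r le_min tx.
Qed.

Lemma hyperbolic_delta_ge0 : 0 <= delta.
Proof.
have := hyp point point point point; rewrite minxx /gromov_product mdistxx; lra.
Qed.

Lemma diverge_together_trans (a b c : nat -> X) :
  diverge_together a b -> diverge_together b c -> diverge_together a c.
Proof.
move=> ab bc x M.
have [n1 n1P] := ab x (M + delta); have [n2 n2P] := bc x (M + delta).
exists (maxn n1 n2) => i k; rewrite !geq_max => /andP[i1 i2] /andP[k1 k2].
rewrite -[M](addrK delta); apply: (@gromov_product_hyp _ _ (b (maxn n1 n2))).
  by apply: n1P => //; exact: leq_maxl.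
by apply: n2P => //; exact: leq_maxr.
Qed.

Lemma boundary_diverge (w : boundary X) a b :
  sval w a -> sval w b -> diverge_together a b.
Proof.
case: w => A /= [c cc ->] /= [aa ca] [bb cb].
exact: diverge_together_trans (diverge_together_sym ca) cb.
Qed.

Lemma boundary_mem (w : boundary X) a b : sval w a ->
  diverge_together b b -> diverge_together a b -> sval w b.
Proof.
case: w => A /= [c cc ->] /= [aa ca] bb ab; split=> //.
exact: diverge_together_trans ca ab.
Qed.

Lemma boundary_eq (v w : boundary X) a b : sval v a -> sval w b ->
  diverge_together a b -> v = w.
Proof.
move=> va wb ab; have : sval v = sval w.
  apply/seteqP; split => c mc.
    have ac := boundary_diverge va mc.
    apply: (boundary_mem wb); first exact: (boundary_diverge mc mc).
    exact: diverge_together_trans (diverge_together_sym ab) ac.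
  have bc := boundary_diverge wb mc.
  apply: (boundary_mem va); first exact: (boundary_diverge mc mc).
  exact: diverge_together_trans ab bc.
case: v w va wb => [A hA] [B hB] /= _ _ AB.
by subst B; congr exist; exact: Prop_irrelevance.
Qed.

Lemma boundary_ex (w : boundary X) : exists a, sval w a.
Proof. by case: w => A /= [a aa ->] /=; exists a. Qed.

(* [kappa] absorbs all the errors made when a boundary point is replaced by a
   term of one of the sequences it is the class of. *)
Local Notation kappa := (delta + delta + 1).

(** Products with y never exceed d(x, y), while two sequences of the class w eventually have larger
    products with each other; hyperbolicity then makes their products with y differ by at most
    delta. Passing from [a] to another sequence costs this twice, and replacing y by a sequence
    tending to it costs 1, so every liminf in the supremum is within kappa of the terms of [a]. *)
Lemma ext_gromov_product_approx x y (w : boundary X) a : sval w a ->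
  ext_gromov_product x (Bdry w) (Inner y) \is a fin_num /\
  exists n0, forall i, (n0 <= i)%N ->
    `|gromov_product x (a i) y
      - fine (ext_gromov_product x (Bdry w) (Inner y))| <= kappa.
Proof.
move=> wa.
have [n1 n1P] := boundary_diverge wa wa x (mdist x y + kappa).
have d0 := hyperbolic_delta_ge0.
have close a' n2 i j : (forall i j, (n2 <= i)%N -> (n2 <= j)%N ->
     mdist x y + kappa <= gromov_product x (a i) (a' j)) ->
     (n2 <= i)%N -> (n2 <= j)%N ->
    `|gromov_product x (a i) y - gromov_product x (a' j) y| <= delta.
  move=> h ni nj; have := h i j ni nj; move=> k.
  have yi := gromov_product_le x (a i) y; have yj := gromov_product_le x (a' j) y.
  have k1 := @gromov_product_hyp x (a i) (a' j) y (gromov_product x (a' j) y).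
  have k2 := @gromov_product_hyp x (a' j) (a i) y (gromov_product x (a i) y).
  rewrite lexx in k1; rewrite lexx (gromov_productC x (a' j) (a i)) in k2.
  rewrite ler_norml; apply/andP; split.
    by have := k1 _ isT; lra.
  by have := k2 _ isT; lra.
pose S := [set l | exists a b, [/\ tends_to a (Bdry w), tends_to b (Inner y)
    & l = liminf2 (fun i j => gromov_product x (a i) (b j))]].
have Sbound i l : (n1 <= i)%N -> S l ->
    ((gromov_product x (a i) y - kappa)%:E <= l
       <= (gromov_product x (a i) y + kappa)%:E)%E.
  move=> ni [a' [b [wa' yb ->]]].
  have [n2 n2P] := boundary_diverge wa wa' x (mdist x y + kappa).
  have /metricType_numDomainType.cvgrPdist_le/(_ 1 ltr01)[n3 _ n3P] := yb.
  have near_ i' j' : (maxn n2 n3 <= i')%N -> (maxn n2 n3 <= j')%N ->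
      `|gromov_product x (a i) y - gromov_product x (a' i') (b j')| <= kappa.
    rewrite !geq_max => /andP[i2 i3] /andP[j2 j3].
    have yj : mdist y (b j') <= 1 := n3P _ j3.
    have := gromov_product_lip x (a' i') y (b j').
    have h1 := close a n1 i (maxn n1 n2) n1P ni (leq_maxl _ _).
    have h2 := close a' n2 (maxn n1 n2) i' n2P (leq_maxr _ _) i2.
    move: h1 h2; rewrite !ler_norml => /andP[? ?] /andP[? ?] /andP[? ?].
    by apply/andP; split; lra.
  apply/andP; split.
    apply: (@le_trans _ _ (ereal_inf [set (gromov_product x (a' i0) (b j0))%:E
        | i0 in [set i0 | (maxn n2 n3 <= i0)%N]
        & j0 in [set j0 | (maxn n2 n3 <= j0)%N]])).
      apply: le_ereal_inf_tmp => _ [i' /= hi' [j' /= hj' <-]].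
      by rewrite lee_fin; have := near_ _ _ hi' hj'; rewrite ler_norml => /andP[]; lra.
    by apply: ereal_sup_ubound; exists (maxn n2 n3).
  apply: ge_ereal_sup => _ [n _ <-].
  apply: (@le_trans _ _ (gromov_product x (a' (maxn n (maxn n2 n3)))
    (b (maxn n (maxn n2 n3))))%:E).
    apply: ereal_inf_lbound; exists (maxn n (maxn n2 n3)); first exact: leq_maxl.
    by exists (maxn n (maxn n2 n3)) => //; exact: leq_maxl.
  rewrite lee_fin; have := near_ _ _ (leq_maxr n _) (leq_maxr n _).
  by rewrite ler_norml => /andP[]; lra.
have [l0 Sl0] : S !=set0.
  by exists (liminf2 (fun i j => gromov_product x (a i) y)), a, (fun=> y);
    split=> //; exact: cvg_cst.
have supbound i : (n1 <= i)%N ->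
    ((gromov_product x (a i) y - kappa)%:E <= ereal_sup S
       <= (gromov_product x (a i) y + kappa)%:E)%E.
  move=> ni; apply/andP; split; last by apply: ge_ereal_sup => l /(Sbound _ _ ni)/andP[].
  have /andP[h _] := Sbound _ _ ni Sl0.
  by apply: (le_trans h); exact: ereal_sup_ubound.
have Sfin : ereal_sup S \is a fin_num.
  have /andP[h1 h2] := supbound n1 (leqnn _).
  rewrite fin_numE; apply/andP; split.
    by apply/eqP => e; rewrite e in h1.
  by apply/eqP => e; rewrite e in h2.
split; first exact: Sfin.
exists n1 => i ni; have := supbound i ni.
rewrite /ext_gromov_product -/S -(fineK Sfin) !lee_fin ler_norml => /andP[? ?].
by apply/andP; split; lra.
Qed.

Lemma ext_gromov_product_approx2 x y z (w : boundary X) : exists p : X,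
  `|gromov_product x p y - fine (ext_gromov_product x (Bdry w) (Inner y))| <= kappa
  /\ `|gromov_product x p z - fine (ext_gromov_product x (Bdry w) (Inner z))| <= kappa.
Proof.
have [a wa] := boundary_ex w.
have [_ [n1 n1P]] := ext_gromov_product_approx x y wa.
have [_ [n2 n2P]] := ext_gromov_product_approx x z wa.
exists (a (maxn n1 n2)); split; first by apply: n1P; exact: leq_maxl.
by apply: n2P; exact: leq_maxr.
Qed.

End GromovProduct.

(* the Gromov product (v, y)_x *)
Definition bgp {R : realType} {X : pmetricType R} (x : X)
    (v : borel_bordification X) (y : X) : R :=
  fine (ext_gromov_product x v (Inner y)).

(** The counting argument knows boundary points through these five inequalities only. Each holds in
    X for a point p of a sequence of the class of v, and passes to v up to a constant. The last one
    is [gromov_product_swap], read with p close to v and g^-1 p close to g^-1 v. *)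
Lemma bgp_hyperbolic (R : realType) (X : pmetricType R) (Gamma : groupType)
    (rho : isom_action Gamma X) : hyperbolic_space X ->
  exists2 kappa : R, 0 <= kappa & forall v : borel_bordification X, bdry v ->
  [/\ forall x y, - kappa <= bgp x v y <= mdist x y + kappa,
      forall x y z, Num.min (bgp x v y) (bgp x v z) - kappa <= gromov_product x y z,
      forall x y z, Num.min (gromov_product x y z) (bgp x v y) - kappa <= bgp x v z,
      forall x y z, bgp x v y <= bgp x v z + mdist y z + kappa &
      forall g x y, mdist x (rho g y) - kappa <=
        bgp x v (rho g y) + bgp y (bact rho g^-1%g v) (rho g^-1%g x)].
Proof.
move=> [delta delta0 hyp]; pose k := delta + delta + 1; exists (delta + 2 * k).
  by rewrite /k; lra.
have apx := ext_gromov_product_approx2 hyp.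
move=> _ [w _ <-]; split.
- move=> x y; have [p [+ _]] := apx x y y w; rewrite ler_norml /bgp => /andP[].
  have := gromov_product_ge0 x p y; have := gromov_product_le x p y.
  by rewrite /k => ? ? ? ?; apply/andP; split; lra.
- move=> x y z; have [p []] := apx x y z w; rewrite !ler_norml -!/(bgp _ _ _).
  move=> /andP[? ?] /andP[? ?]; set t := Num.min _ _.
  have [ty tz] : t <= bgp x (Bdry w) y /\ t <= bgp x (Bdry w) z.
    by rewrite /t !ge_min !lexx orbT.
  have h1 : t - k <= gromov_product x y p by rewrite gromov_productC /k; lra.
  have h2 : t - k <= gromov_product x p z by rewrite /k; lra.
  by have := gromov_product_hyp hyp h1 h2; rewrite /k; lra.
- move=> x y z; have [p []] := apx x y z w; rewrite !ler_norml -!/(bgp _ _ _).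
  move=> /andP[? ?] /andP[? ?]; set t := Num.min _ _.
  have [ty tz] : t <= gromov_product x y z /\ t <= bgp x (Bdry w) y.
    by rewrite /t !ge_min !lexx orbT.
  have h1 : t - k <= gromov_product x p y by rewrite /k; lra.
  have h2 : t - k <= gromov_product x y z by rewrite /k; lra.
  by have := gromov_product_hyp hyp h1 h2; rewrite /k; lra.
- move=> x y z; have [p []] := apx x y z w; have := gromov_product_lip x p y z.
  rewrite !ler_norml -!/(bgp _ _ _) => /andP[? ?] /andP[? ?] /andP[? ?].
  by rewrite /k; lra.
- move=> g x y; have [a wa] := boundary_ex w.
  have [_ [n1 n1P]] := ext_gromov_product_approx hyp x (rho g y) wa.
  have wga : sval (exist _ _ (boundary_class_act rho g^-1%g (svalP w))) (rho g^-1%g \o a).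
    by exists a.
  have [_ [n2 n2P]] := ext_gromov_product_approx hyp y (rho g^-1%g x) wga.
  have := n1P (maxn n1 n2) (leq_maxl _ _); have := n2P (maxn n1 n2) (leq_maxr _ _).
  have -> : gromov_product y ((rho g^-1%g \o a) (maxn n1 n2)) (rho g^-1%g x) =
      gromov_product (rho g y) (a (maxn n1 n2)) x.
    by rewrite -(gromov_product_act rho g) /= -!actM mulgV !act1.
  rewrite !ler_norml -!/(bgp _ _ _).
  have := gromov_product_swap x (rho g y) (a (maxn n1 n2)).
  move=> e /andP[h1 h2] /andP[h3 h4].
  by rewrite /k; lra.
Qed.

(** Limits along one ultrafilter replace the extraction of subsequences: any number of families
    valued in compact sets converge at once, without a diagonal argument. *)
Lemma ultra_compact_cvg (I : Type) (G : set_system I) (X : topologicalType)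
    (f : I -> X) (A : set X) : UltraFilter G -> compact A ->
  (\forall i \near G, A (f i)) -> exists2 p, A p & f @ G --> p.
Proof.
move=> UG cA GA; have [p [Ap clp]] := cA (f @ G) _ GA; exists p => // B Bp.
have [//|GC] := in_ultra_setVsetC (f @^-1` B) UG.
by have [y [nBy By]] := clp (~` B) B GC Bp.
Qed.

(** * Invariance of the hull under the group *)

Section HullInvariance.
Context {R : realType} {X : pmetricType R} {Gamma : groupType}.
Variable rho : isom_action Gamma X.

Lemma tends_to_act g (a : nat -> X) v : tends_to a v ->
  tends_to (rho g \o a) (bact rho g v).
Proof.
case: v => [y|w] /=; last by exists a.
move=> /metricType_numDomainType.cvgrPdist_lt ay.
apply/metricType_numDomainType.cvgrPdist_lt => e e0.
by near=> n; rewrite /= act_isom; near: n; exact: ay.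
Unshelve. all: by end_near. Qed.

Lemma ext_gromov_product_act g x v w :
  (ext_gromov_product x v w
    <= ext_gromov_product (rho g x) (bact rho g v) (bact rho g w))%E.
Proof.
apply: ereal_sup_le => l [a [b [va wb ->]]]; exists (rho g \o a), (rho g \o b).
split; [exact: tends_to_act|exact: tends_to_act|].
by congr liminf2; apply/funext => i; apply/funext => j; rewrite /= gromov_product_act.
Qed.

Lemma bact_open g (U : set (bordification X)) : open U ->
  open ((bact rho g : bordification X -> bordification X) @^-1` U).
Proof.
move=> [oU bU]; split.
  rewrite openE => y /= Uy.
  have := oU; rewrite openE => /(_ (rho g y) Uy).
  rewrite /interior.
  move=> /nbhs_ballP[e /= e0 eU]; apply/nbhs_ballP; exists e => //= z yz.
  by apply: eU; move: yz; rewrite !ballEmdist /= act_isom.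
move=> v Uv x; have [r rU] := bU _ Uv (rho g x).
exists r => w rw; apply: rU => /=.
exact: lt_le_trans rw (ext_gromov_product_act _ _ _ _).
Qed.

Lemma limit_set_act g (v : boundary X) : limit_set rho v ->
  limit_set rho (exist _ _ (boundary_class_act rho g (svalP v))).
Proof.
move=> lv B /=; rewrite nbhsE => -[U [oU Uv] UB].
have : nbhs (Bdry v) ((bact rho g : bordification X -> bordification X) @^-1` U).
  by rewrite nbhsE; exists (bact rho g @^-1` U) => //; split; [exact: bact_open|].
move=> /lv[_ [[h _ <-] /= Uh]].
exists (Inner (rho (g * h)%g point)); split; first by exists (g * h)%g.
by apply: UB; rewrite actM.
Qed.

Lemma geodesic_hull_act T g y : geodesic_hull rho T y ->
  geodesic_hull rho T (rho g y).
Proof.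
move=> [c [v [w [lc [lv lw] vc wc [t Tt ->]]]]].
exists (rho g \o c), (exist _ _ (boundary_class_act rho g (svalP v))),
  (exist _ _ (boundary_class_act rho g (svalP w))); split.
- by move=> s s' Ts Ts' /=; rewrite act_isom; exact: lc.
- by split; exact: limit_set_act.
- by exists (fun n => c n%:R).
- by exists (fun n => c (- n%:R)).
- by exists t.
Qed.

End HullInvariance.

(** * Geodesic lines in the hull of the limit set *)

(* Only quasi-geodesics of additive error [eps] are required, since a limit
   turns them into a geodesic line. *)
Definition almost_geodesic_space {R : realType} (X : pmetricType R) (T : time) :=
  forall (x y : X) (eps : R), 0 < eps -> exists c : R -> X,
    forall s, times T s -> 0 <= s <= mdist x y ->
    [/\ `|mdist x (c s) - s| <= eps, `|mdist (c s) y - (mdist x y - s)| <= eps &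
     forall t, times T t -> 0 <= t <= mdist x y ->
       `|mdist (c s) (c t) - `|s - t| | <= eps].

Lemma timesD (R : realType) T (s t : R) : times T s -> times T t -> times T (s + t).
Proof.
case: T => //= -[m _ <-] [n _ <-]; exists (m + n) => //.
by rewrite rmorphD.
Qed.

Lemma times_int (R : realType) T (m : int) : times T (m%:~R : R).
Proof. by case: T => //=; exists m. Qed.

Lemma times_nat (R : realType) T (n : nat) : times T (n%:R : R).
Proof. by rewrite pmulrn; exact: times_int. Qed.

Lemma times_natN (R : realType) T (n : nat) : times T (- n%:R : R).
Proof. by rewrite pmulrn -mulrNz; exact: times_int. Qed.

Lemma geodesic_line_diverge (R : realType) (X : pmetricType R) (T : time)
  (c : R -> X) : geodesic_line T c ->
  diverge_together (fun n => c n%:R) (fun n => c n%:R) /\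
  diverge_together (fun n => c (- n%:R)) (fun n => c (- n%:R)).
Proof.
move=> lc; have T0 : times T (0 : R) := times_nat R T 0.
have bnd (i j n0 : nat) (M : R) : M <= n0%:R -> (n0 <= i)%N -> (n0 <= j)%N ->
    M <= (i%:R + j%:R - `|i%:R - j%:R|) / 2.
  rewrite -!(ler_nat R) => Mn ni nj.
  by have [|] := ger0P (i%:R - j%:R : R) => ? /=; lra.
split; apply: (@diverge_together_base _ _ _ _ (c 0)) => M;
  exists (Num.truncn `|M|).+1 => i j ni nj.
  rewrite /gromov_product !lc//; try exact: times_nat.
  rewrite !sub0r !normrN !normr_nat; apply: bnd ni nj.
  by rewrite (le_trans (ler_norm _))// ltW// truncnS_gt.
rewrite /gromov_product !lc//; try exact: times_natN.
rewrite !sub0r !opprK !normr_nat [- _ + _]addrC distrC.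
apply: bnd ni nj.
by rewrite (le_trans (ler_norm _))// ltW// truncnS_gt.
Qed.

Section GeodesicLine.
Context {R : realType} {X : pmetricType R} (T : time).

(** As v and w differ, they are approached by points [p n] and [q n] with a bounded product at some
    x0. The almost geodesics from [p n] to [q n] then pass at bounded distance from x0; parametrized
    so as to be near x0 at time 0, they have a limit by properness. *)
Lemma geodesic_line_between (v w : boundary X) :
  hyperbolic_space X -> proper_space X -> almost_geodesic_space X T -> v <> w ->
  exists c : R -> X, [/\ geodesic_line T c, sval v (fun n => c (- n%:R))
    & sval w (fun n => c n%:R)].
Proof.
move=> [delta delta0 hyp] propX ageo vw.
have [a va] := boundary_ex v; have [b wb] := boundary_ex w.
have nab : ~ diverge_together a b by move/(boundary_eq hyp va wb).
(* Failure of divergence bounds the product for some pair of indices beyond each n, not for all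
   pairs; hence the reindexing of both sequences by [ij]. *)
have : exists (x0 : X) (M : R), forall n, exists ij : nat * nat,
    [/\ (n <= ij.1)%N, (n <= ij.2)%N & gromov_product x0 (a ij.1) (b ij.2) < M].
  apply: contrapT => /forallNP h; apply: nab => x M.
  have /forallNP/(_ M)/existsNP[n0 hn0] := h x; exists n0 => i j ni nj.
  by rewrite leNgt; apply/negP => lt; apply: hn0; exists (i, j).
move=> [x0 [M x0M]].
have [ij ijP] := choice x0M.
pose p n := a (ij n).1; pose q n := b (ij n).2; pose D n := mdist (p n) (q n).
have farp K : exists n0, forall n, (n0 <= n)%N -> K <= mdist x0 (p n).
  have [n0 n0P] := boundary_diverge hyp va va x0 K; exists n0 => n nn.
  have [h1 _ _] := ijP n; apply: le_trans (gromov_product_le _ (p n) _).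
  by apply: n0P; exact: leq_trans nn h1.
have farq K : exists n0, forall n, (n0 <= n)%N -> K <= mdist x0 (q n).
  have [n0 n0P] := boundary_diverge hyp wb wb x0 K; exists n0 => n nn.
  have [_ h1 _] := ijP n; apply: le_trans (gromov_product_le _ (q n) _).
  by apply: n0P; exact: leq_trans nn h1.
have pq n : gromov_product x0 (p n) (q n) < M by case: (ijP n).
pose eps (n : nat) : R := n.+1%:R^-1.
have eps0 n : 0 < eps n by rewrite invr_gt0.
have eps1 n : eps n <= 1 by rewrite invf_le1// ler1n.
have [e eP] := choice (fun n => ageo (p n) (q n) (eps n) (eps0 n)).
(* The point of a geodesic from p to q that is nearest to x0 lies about (x0, q)_p away from p. The
   floor makes this a time for integer parameters as well. *)
pose tau n : R := (Num.floor (gromov_product (p n) x0 (q n)))%:~R.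
have tauP n : tau n <= gromov_product (p n) x0 (q n) < tau n + 1.
  rewrite /tau floor_le /=.
  by have := floorD1_gt (gromov_product (p n) x0 (q n)); rewrite intrD.
have tau0 n : 0 <= tau n.
  by rewrite /tau ler0z floor_ge0 gromov_product_ge0.
have tauD n : tau n <= D n.
  by have := gromov_product_le (p n) x0 (q n); have := tauP n; rewrite /D => /andP[]; lra.
pose c n t := e n (tau n + t).
have far K : exists n0, forall n, (n0 <= n)%N -> K <= tau n /\ K <= D n - tau n.
  have [n1 n1P] := farp (K + M + 1); have [n2 n2P] := farq (K + M).
  exists (maxn n1 n2) => n; rewrite geq_max => /andP[nn1 nn2].
  have := n1P n nn1; have := n2P n nn2; have := tauP n; have := pq n.
  rewrite /gromov_product /D (metric_sym (p n) x0) => h /andP[h1 h2] h3 h4.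
  by split; lra.
have cT n t : times T t -> times T (tau n + t).
  by move=> Tt; apply: timesD => //; exact: times_int.
have T0 : times T (0 : R) := times_nat R T 0.
(* The point z almost lies between [p n] and [q n], so (p n, q n)_z is small. By hyperbolicity (p n,
   x0)_z or (x0, q n)_z is small too, and in either case d(x0, z) is close to (p n, q n)_x0 < M. *)
have : exists B, forall n, mdist x0 (c n 0) <= B.
  exists (M + 2 * delta + 4) => n; set z := c n 0.
  have [||h1 h2 _] := eP n (tau n + 0); first exact: cT.
    by rewrite addr0 tau0 tauD.
  rewrite -/(c n 0) -/z addr0 !ler_norml -/(D n) in h1 h2.
  have e1 := eps1 n; have := hyp z (p n) x0 (q n).
  have := pq n; have := tauP n.
  have [] := leP (gromov_product z (p n) x0) (gromov_product z x0 (q n)) => _;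
  rewrite /gromov_product (metric_sym z (p n)) (metric_sym (p n) x0) (metric_sym z x0) -/(D n);
  move: h1 h2 => /andP[? ?] /andP[? ?] /andP[? ?] ? ?; lra.
move=> [B cB].
have inside t : exists n0, forall n, (n0 <= n)%N -> 0 <= tau n + t <= D n.
  have [n0 n0P] := far `|t|; exists n0 => n /n0P[h1 h2].
  by have := ler_norm t; have := ler_norm (- t); rewrite normrN => ? ?; apply/andP; split; lra.
have cst s t : times T s -> times T t -> exists n0, forall n, (n0 <= n)%N ->
    `|mdist (c n s) (c n t) - `|s - t| | <= eps n.
  move=> Ts Tt; have [n1 n1P] := inside s; have [n2 n2P] := inside t.
  exists (maxn n1 n2) => n; rewrite geq_max => /andP[nn1 nn2].
  have [_ _ /(_ (tau n + t))] := eP n _ (cT n _ Ts) (n1P _ nn1).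
  rewrite opprD addrACA subrr add0r; apply; first exact: cT.
  exact: n2P.
have [G [UG sG]] := ultraFilterLemma (@eventually_filter).
have PG : ProperFilter G by exact: ultra_proper.
have GI (P Q : set nat) : G P -> G Q -> G (P `&` Q) by exact: filterI.
have Gex (P : set nat) : G P -> exists n, P n by exact: filter_ex.
have evG (P : set nat) n0 : (forall n, (n0 <= n)%N -> P n) -> G P.
  by move=> h; apply: sG; exists n0.
(* [point] is a dummy value at the reals that are not times. *)
have lim t : exists y, times T t ->
    forall r, 0 < r -> G [set n | mdist y (c n t) < r].
  have [Tt|nT] := pselect (times T t); last by exists point.
  have [n0 n0P] := cst 0 t T0 Tt.
  have inB : \forall n \near G, mdist x0 (c n t) <= B + `|t| + 1.
    apply: (evG _ n0) => n /n0P /=; rewrite sub0r normrN ler_norml => /andP[_ h].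
    have := metric_triangle x0 (c n 0) (c n t); have := cB n; have := eps1 n; lra.
  have [y _ /metricType_numDomainType.cvgrPdist_lt yP] :=
    ultra_compact_cvg UG (propX x0 (B + `|t| + 1)) inB.
  by exists y => _.
have [l lP] := choice lim.
have ge0 n0 : G [set n | (n0 <= n)%N] by exact: (evG _ n0).
have ll : geodesic_line T l.
  move=> s t Ts Tt; apply/eqP; rewrite -subr_eq0 -normr_le0.
  apply/ler_addgt0Pl => r r0; rewrite addr0.
  have [n0 n0P] := cst s t Ts Tt.
  have r3 : 0 < r / 3 by rewrite divr_gt0.
  have /Gex[n [[[/= h1 /= h2] /= h3] /= h4]] := GI _ _ (GI _ _ (GI _ _
    (lP s Ts _ r3) (lP t Tt _ r3)) (ge0 n0)) (ge0 (Num.truncn (r / 3)^-1)).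
  have en : eps n <= r / 3.
    rewrite -[leRHS]invrK lef_pV2 ?posrE// ?invr_gt0//.
    by rewrite ltW// (lt_le_trans (truncnS_gt _))// ler_nat.
  have := n0P _ h3; rewrite !ler_norml => /andP[? ?].
  have := metric_triangle (l s) (c n s) (l t).
  have := metric_triangle (c n s) (c n t) (l t).
  have := metric_triangle (c n s) (l s) (c n t).
  have := metric_triangle (l s) (l t) (c n t).
  rewrite (metric_sym (c n t) (l t)) (metric_sym (c n s) (l s)) => ? ? ? ?.
  by apply/andP; split; lra.
(* the limit line ends at [w] in positive times, and at [v] in negative ones *)
have [dl dlN] := geodesic_line_diverge ll.
have key (f : nat -> R) (a' : nat -> X) (p' : nat -> X) : (forall n, times T (f n)) ->
    (forall n, `|f n| = n%:R) ->
    (forall K, exists n0, forall n k, (n0 <= n)%N -> (n0 <= k)%N ->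
       K <= gromov_product x0 (p' n) (a' k)) ->
    (forall m, exists n0, forall n, (n0 <= n)%N -> forall z, z = c n (f m) ->
       mdist z (p' n) <= mdist (c n 0) (p' n) - m%:R + 2) ->
    diverge_together a' (fun n => l (f n)).
  (* One argument serves both ends, with [p'] equal to [p] or [q] and [f n] to -n or n. By [near_],
     time [f m] is about m closer to [p' n] than time 0 is, so the product of [p' n] and [l (f m)]
     at x0 grows with m. *)
  move=> Tf nf pa' near_; apply: (@diverge_together_base _ _ _ _ x0) => K.
  have [n1 n1P] := pa' (K + delta).
  have Bb : 0 <= B by exact: le_trans (mdist_ge0 _ _) (cB 0).
  exists (maxn n1 (Num.truncn (`|K| + delta + B + 10)).+1) => k m.
  rewrite !geq_max => /andP[kn1 _] /andP[mn1 mK].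
  have {}mK : K + delta + B + 10 <= m%:R.
    apply: (@le_trans _ _ (`|K| + delta + B + 10)); first by have := ler_norm K; lra.
    by rewrite ltW// (lt_le_trans (truncnS_gt _))// ler_nat.
  have [n2 n2P] := near_ m; have [n3 n3P] := cst 0 (f m) T0 (Tf m).
  have /Gex[n [[[/= h1 /= h2] /= h3] /= h4]] := GI _ _ (GI _ _ (GI _ _
    (lP (f m) (Tf m) _ ltr01) (ge0 n1)) (ge0 n2)) (ge0 n3).
  have h5 := n2P _ h3 _ erefl; have := n3P _ h4; rewrite sub0r normrN nf.
  rewrite ler_norml => /andP[h6 _]; have e1 := eps1 n; have h7 := cB n.
  have h8 : K + delta <= gromov_product x0 (p' n) (l (f m)).
    have := metric_triangle (c n (f m)) (l (f m)) (p' n).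
    have := metric_triangle (l (f m)) (c n (f m)) (p' n).
    have := metric_triangle (c n 0) x0 (l (f m)).
    have := metric_triangle (c n 0) (l (f m)) (c n (f m)).
    have := metric_triangle (c n 0) x0 (p' n).
    rewrite /gromov_product (metric_sym (p' n)) (metric_sym (c n 0) x0).
    lra.
  have h9 := n1P n k h2 kn1.
  rewrite gromov_productC in h9.
  by have := gromov_product_hyp hyp h9 h8; lra.
exists l; split=> //.
- apply: (boundary_mem hyp va dlN); apply: (key _ _ p) => [n|n|K|m].
  + exact: times_natN.
  + by rewrite normrN normr_nat.
  + have [n0 n0P] := boundary_diverge hyp va va x0 K; exists n0 => n k nn kn.
    by apply: n0P => //; case: (ijP n) => h _ _; exact: leq_trans nn h.
  + have [n0 n0P] := inside (- m%:R); exists n0 => n /n0P hn _ ->.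
    have [h1 _ _] := eP n _ (cT n _ (times_natN R T m)) hn.
    have [||h2 _ _] := eP n (tau n + 0); first exact: cT.
      by rewrite addr0 tau0 tauD.
    rewrite -!/(c n _) !ler_norml in h1 h2; have e1 := eps1 n.
    rewrite (metric_sym (c n _)) (metric_sym (c n 0)).
    by move: h1 h2 => /andP[? ?] /andP[? ?]; lra.
- apply: (boundary_mem hyp wb dl); apply: (key _ _ q) => [n|n|K|m].
  + exact: times_nat.
  + by rewrite normr_nat.
  + have [n0 n0P] := boundary_diverge hyp wb wb x0 K; exists n0 => n k nn kn.
    by apply: n0P => //; case: (ijP n) => _ h _; exact: leq_trans nn h.
  + have [n0 n0P] := inside m%:R; exists n0 => n /n0P hn _ ->.
    have [_ h1 _] := eP n _ (cT n _ (times_nat R T m)) hn.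
    have [||_ h2 _] := eP n (tau n + 0); first exact: cT.
      by rewrite addr0 tau0 tauD.
    rewrite -!/(c n _) !ler_norml in h1 h2; have e1 := eps1 n.
    by move: h1 h2 => /andP[? ?] /andP[? ?]; lra.
Qed.

End GeodesicLine.

Lemma geodesic_hull_line (R : realType) (X : pmetricType R) (Gamma : groupType)
    (rho : isom_action Gamma X) (T : time) :
  hyperbolic_space X -> proper_space X -> almost_geodesic_space X T ->
  nonelementary rho ->
  exists2 c : R -> X, geodesic_line T c
    & forall t, times T t -> geodesic_hull rho T (c t).
Proof.
move=> hypX propX ageo [v [w [_ [[lv lw _] [vw _ _]]]]].
have wv : w <> v by move=> e; apply: vw.
have [c [lc wc vc]] := geodesic_line_between hypX propX ageo wv.
exists c => // t Tt; exists c, v, w; split=> //.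
by exists t.
Qed.

Lemma geodesic_almost_geodesic (R : realType) (X : pmetricType R) :
  @geodesic_space R X -> almost_geodesic_space X RealTime.
Proof.
move=> geoX x y e e0; have [c [ic c0 c1]] := geoX x y; exists c => s _ sxy.
have in0 : `[0, mdist x y]%classic (0 : R) by rewrite /= in_itv /= lexx mdist_ge0.
have in1 : `[0, mdist x y]%classic (mdist x y) by rewrite /= in_itv /= lexx mdist_ge0.
have ins : `[0, mdist x y]%classic s by rewrite /= in_itv.
have /andP[s0 s1] := sxy.
split.
- rewrite -[in mdist x (c s)]c0 ic// sub0r normrN (ger0_norm s0) subrr normr0.
  exact: ltW.
- have e1 : `|s - mdist x y| = mdist x y - s by rewrite distrC ger0_norm// subr_ge0.
  by rewrite -[in mdist (c s) y]c1 ic// e1 subrr normr0 ltW.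
- move=> t _ txy; have int_ : `[0, mdist x y]%classic t by rewrite /= in_itv.
  rewrite ic//.
  by rewrite subrr normr0 ltW.
Qed.

(** * Word metrics *)

Section HyperbolicGroup.
Context {R : realType} {X : pmetricType R} {Gamma : groupType}.
Variable rho : isom_action Gamma X.

Lemma word_product_cat (u v : seq Gamma) :
  word_product (u ++ v) = (word_product u * word_product v)%g.
Proof. by elim: u => [|s u IH] /=; rewrite ?mul1g// IH mulgA. Qed.

Lemma word_dist_min (S : set Gamma) (g h : Gamma) :
  (forall g, exists2 w, word_in S w & word_product w = g) ->
  exists w, [/\ word_in S w, word_product w = (g^-1 * h)%g &
    word_dist S g h = (size w)%:R :> R].
Proof.
move=> gen; pose P n := `[< exists w, [/\ word_in S w,
  word_product w = (g^-1 * h)%g & size w = n] >].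
have exP : exists n, P n.
  have [w Sw wE] := gen (g^-1 * h)%g.
  by exists (size w); apply/asboolP; exists w.
have [n /asboolP[w [Sw wE sw]] nmin] := ex_minnP exP.
exists w; split=> //; apply/eqP; rewrite eq_le; apply/andP; split.
  apply: ge_inf; last by exists w.
  by exists 0 => _ [w' _ <-].
apply: lb_le_inf; first by exists (size w)%:R, w.
move=> _ [w' [Sw' w'E] <-]; rewrite ler_nat sw; apply: nmin.
by apply/asboolP; exists w'.
Qed.

Lemma word_dist_le (S : set Gamma) (g h : Gamma) (w : seq Gamma) :
  word_in S w -> word_product w = (g^-1 * h)%g ->
  word_dist S g h <= (size w)%:R :> R.
Proof.
move=> Sw wE; apply: ge_inf; last by exists w.
by exists 0 => _ [w' _ <-].
Qed.

(** X is a single orbit, so a ball of X is the image of a set of group elements that discreteness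
    makes finite. *)
Lemma hyperbolic_group_proper :
  discrete_action rho -> class_hyperbolic_group rho -> proper_space X.
Proof.
move=> disc [_ [S [f [_ _ _ [f' fK f'K] [_ fact_]]]]] x r.
apply: finite_compact.
have fin := disc (f 1%g) (mdist (f 1%g) x + r).
apply: sub_finite_set (finite_image (fun g => f g) fin) => y /= xy.
exists (f' y); last by rewrite f'K.
rewrite /= fact_ mulg1 f'K (le_trans (metric_triangle _ x _))//.
by rewrite lerD2l.
Qed.

(** The prefixes of a shortest word trace a geodesic: each subword bounds a distance from above by
    its length, and since the total length is attained, all these bounds are equalities. *)
Lemma hyperbolic_group_almost_geodesic :
  class_hyperbolic_group rho -> almost_geodesic_space X IntegerTime.
Proof.
move=> [_ [S [f [_ _ gen [f' fK f'K] [fdist fact_]]]]] x y e e0.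
have [w [Sw wE dw]] := word_dist_min (f' x) (f' y) gen.
have dxy : mdist x y = (size w)%:R by rewrite -[x]f'K -[y]f'K fdist dw.
pose p k := (f' x * word_product (take k w))%g.
have step i j : (i <= j)%N -> (j <= size w)%N ->
    mdist (f (p i)) (f (p j)) <= (j - i)%:R.
  move=> ij jw; rewrite fdist; have -> : (j - i)%N = size (drop i (take j w)).
    by rewrite size_drop size_take; case: ltnP jw => // wj jw; rewrite (@anti_leq (size w) j) ?wj.
  apply: word_dist_le.
    by move=> s /mem_drop /mem_take; exact: Sw.
  rewrite /p invgM mulgA -(mulgA _ _ (f' x)) mulVg mulg1.
  rewrite -[in RHS](cat_take_drop i (take j w)) take_takel// word_product_cat.
  by rewrite mulgA mulVg mul1g.
have px : f (p 0) = x by rewrite /p take0 /= mulg1 f'K.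
have py : f (p (size w)) = y.
  by rewrite /p take_size wE mulgA mulgV mul1g f'K.
have dist i j : (i <= j)%N -> (j <= size w)%N ->
    mdist (f (p i)) (f (p j)) = (j - i)%:R.
  move=> ij jw; apply/eqP; rewrite eq_le step//=.
  have := step 0 i (leq0n _) (leq_trans ij jw).
  have := step j (size w) jw (leqnn _); rewrite px py.
  have := metric_triangle x (f (p i)) y; have := metric_triangle (f (p i)) (f (p j)) y.
  by rewrite dxy subn0 !natrB//; lra.
have distn i j : (i <= size w)%N -> (j <= size w)%N ->
    mdist (f (p i)) (f (p j)) = `|i%:R - j%:R|.
  move=> iw jw; have [ij|/ltnW ij] := leqP i j.
    by rewrite dist// natrB// distrC ger0_norm// subr_ge0 ler_nat.
  by rewrite metric_sym dist// natrB// ger0_norm// subr_ge0 ler_nat.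
exists (fun t => f (p (Num.truncn t))) => _ [m _ <-] /andP[m0 mw].
have [i im] : exists i : nat, m = i%:Z.
  by exists `|m|%N; rewrite gez0_abs// -(ler0z R).
rewrite im -pmulrn in mw m0 *; rewrite natrK.
have iw : (i <= size w)%N by rewrite -(ler_nat R) -dxy.
split.
- rewrite -[in mdist x (f _)]px distn// sub0r normrN normr_nat subrr normr0.
  exact: ltW.
- have e1 : `|i%:R - (size w)%:R| = (size w)%:R - i%:R :> R.
    by rewrite distrC ger0_norm// subr_ge0 ler_nat.
  by rewrite -[in mdist (f _) y]py distn// dxy e1 subrr normr0 ltW.
- move=> _ [n _ <-] /andP[n0 nw].
  have [j jn] : exists j : nat, n = j%:Z.
    by exists `|n|%N; rewrite gez0_abs// -(ler0z R).
  rewrite jn -pmulrn in nw n0 *; rewrite natrK.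
  have jw : (j <= size w)%N by rewrite -(ler_nat R) -dxy.
  by rewrite distn// subrr normr0 ltW.
Qed.

End HyperbolicGroup.

(** * Closed linear groups and their exponential *)

Lemma cvg_sum_real (R : realType) (I : Type) (F : set_system I) {FF : Filter F}
    (J : finType) (f : J -> I -> R) (l : J -> R) :
  (forall j, f j x @[x --> F] --> l j) ->
  \sum_j f j x @[x --> F] --> \sum_j l j.
Proof.
move=> fl; elim: (index_enum J) => [|j s IH].
  by rewrite big_nil; under eq_fun do rewrite big_nil; exact: cvg_cst.
by rewrite big_cons; under eq_fun do rewrite big_cons; exact: cvgD.
Qed.

Section EntryNorm.
Context {R : realType} {N : nat}.
Local Notation M := 'M[R]_N.
Implicit Types A B C : M.

(** The entrywise l1 norm is submultiplicative, unlike the maximum of the entries, which is the norm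
    that matrices carry. Its value at the identity is N, whence the factors [nrm 1] below. *)
Definition nrm A : R := \sum_i \sum_j `|A i j|.

Lemma nrm_ge0 A : 0 <= nrm A.
Proof. by apply: sumr_ge0 => i _; apply: sumr_ge0. Qed.

Lemma nrm_entry A i j : `|A i j| <= nrm A.
Proof.
rewrite /nrm (bigD1 i)//= (bigD1 j)//= -addrA lerDl addr_ge0//.
  exact: sumr_ge0.
by apply: sumr_ge0 => k _; apply: sumr_ge0.
Qed.

Lemma nrmD A B : nrm (A + B) <= nrm A + nrm B.
Proof.
rewrite /nrm -big_split/=; apply: ler_sum => i _.
by rewrite -big_split/=; apply: ler_sum => j _; rewrite mxE ler_normD.
Qed.

Lemma nrmN A : nrm (- A) = nrm A.
Proof.
by apply: eq_bigr => i _; apply: eq_bigr => j _; rewrite mxE normrN.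
Qed.

Lemma nrmB A B : nrm (A - B) <= nrm A + nrm B.
Proof. by rewrite -(nrmN B); exact: nrmD. Qed.

Lemma nrmBC A B : nrm (A - B) = nrm (B - A).
Proof. by rewrite -nrmN opprB. Qed.

Lemma nrmZ a A : nrm (a *: A) = `|a| * nrm A.
Proof.
rewrite /nrm mulr_sumr; apply: eq_bigr => i _; rewrite mulr_sumr.
by apply: eq_bigr => j _; rewrite mxE normrM.
Qed.

Lemma nrm0 : nrm 0 = 0.
Proof. by rewrite -(scale0r 0) nrmZ normr0 mul0r. Qed.

Lemma nrm_eq0 A : nrm A = 0 -> A = 0.
Proof.
move=> A0; apply/matrixP => i j; rewrite mxE; apply/eqP.
by rewrite -normr_le0 -A0; exact: nrm_entry.
Qed.

Lemma nrm_triangle B A C : nrm (A - C) <= nrm (A - B) + nrm (B - C).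
Proof. by rewrite (le_trans _ (nrmD _ _))// addrA subrK. Qed.

Lemma nrmM A B : nrm (A * B) <= nrm A * nrm B.
Proof.
rewrite {1}/nrm; have : forall i j, `|(A * B) i j| <= \sum_k `|A i k| * `|B k j|.
  move=> i j; rewrite mxE (le_trans (ler_norm_sum _ _ _))//.
  by apply: ler_sum => k _; rewrite normrM.
move=> AB; apply: (@le_trans _ _ (\sum_i \sum_j \sum_k `|A i k| * `|B k j|)).
  by apply: ler_sum => i _; apply: ler_sum => j _.
rewrite mulr_suml; apply: ler_sum => i _.
rewrite exchange_big/= mulr_suml; apply: ler_sum => k _.
rewrite -mulr_sumr ler_wpM2l// /nrm [leRHS](bigD1 k)//= lerDl.
by apply: sumr_ge0 => l _; apply: sumr_ge0.
Qed.

Lemma nrm_trmx A : nrm A^T = nrm A.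
Proof.
by rewrite /nrm exchange_big; apply: eq_bigr => i _; apply: eq_bigr => j _; rewrite mxE.
Qed.

Lemma nrm_sum n (f : 'I_n -> M) : nrm (\sum_i f i) <= \sum_i nrm (f i).
Proof.
elim/big_ind2: _ => [|x1 x2 y1 y2 h1 h2|//]; first by rewrite nrm0.
by rewrite (le_trans (nrmD _ _))// lerD.
Qed.

Lemma nrmMX C A n : nrm (C * A ^+ n) <= nrm C * nrm A ^+ n.
Proof.
elim: n => [|n IH]; first by rewrite !expr0 !mulr1.
rewrite exprSr mulrA (le_trans (nrmM _ _))// exprSr mulrA.
by rewrite ler_wpM2r// nrm_ge0.
Qed.

Lemma nrm_expB r A B n : nrm A <= r -> nrm B <= r ->
  nrm (A ^+ n.+1 - B ^+ n.+1) <= nrm (A - B) * (n.+1%:R * r ^+ n).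
Proof.
move=> Ar Br; have r0 : 0 <= r by rewrite (le_trans _ Ar)// nrm_ge0.
elim: n => [|n IH]; first by rewrite !expr1 expr0 !mulr1.
have -> : A ^+ n.+2 - B ^+ n.+2 =
    A * (A ^+ n.+1 - B ^+ n.+1) + (A - B) * B ^+ n.+1.
  by rewrite mulrBr mulrBl -!exprS addrA subrK.
rewrite (le_trans (nrmD _ _))//.
apply: (@le_trans _ _ (r * (nrm (A - B) * (n.+1%:R * r ^+ n)) +
    nrm (A - B) * r ^+ n.+1)).
  apply: lerD.
    by rewrite (le_trans (nrmM _ _))// ler_pM// nrm_ge0.
  rewrite (le_trans (nrmMX _ _ _))// ler_wpM2l ?nrm_ge0//.
  by rewrite lerXn2r// ?nnegrE ?nrm_ge0.
by rewrite exprS -[in leRHS]natr1 le_eqVlt; apply/orP; left; apply/eqP; ring.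
Qed.

Section Convergence.
Context {I : Type} (F : set_system I) {FF : ProperFilter F}.

Definition mconv (S : I -> M) A := forall i j, S n i j @[n --> F] --> A i j.

Lemma mconvP S A : mconv S A <-> nrm (S n - A) @[n --> F] --> (0 : R).
Proof.
split=> [SA|SA i j].
  have <- : \sum_(i < N) \sum_(j < N) `|0 : R| = 0.
    by apply: big1 => i _; apply: big1 => j _; rewrite normr0.
  apply: cvg_sum_real => i; apply: cvg_sum_real => j; apply: cvg_norm.
  have -> : (fun n => (S n - A) i j) = (fun n => S n i j - A i j).
    by apply/funext => n; rewrite !mxE.
  by rewrite -(subrr (A i j)); apply: cvgB; [exact: SA|exact: cvg_cst].
apply/cvgrPdist_lt => e e0.
have /cvgrPdist_lt/(_ _ e0) SAe := SA; apply: filterS SAe => n.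
rewrite sub0r normrN (ger0_norm (nrm_ge0 _)); apply: le_lt_trans.
by rewrite nrmBC; have := nrm_entry (A - S n) i j; rewrite !mxE.
Qed.

Lemma mconv_cst A : mconv (fun=> A) A.
Proof. by move=> i j; exact: cvg_cst. Qed.

Lemma mconvD S1 S2 A B : mconv S1 A -> mconv S2 B ->
  mconv (fun n => S1 n + S2 n) (A + B).
Proof.
move=> SA SB i j; rewrite mxE.
have -> : (fun n => (S1 n + S2 n) i j) = (fun n => S1 n i j + S2 n i j).
  by apply/funext => n; rewrite mxE.
by apply: cvgD; [exact: SA|exact: SB].
Qed.

Lemma mconvM S1 S2 A B : mconv S1 A -> mconv S2 B ->
  mconv (fun n => S1 n * S2 n) (A * B).
Proof.
move=> SA SB i j; rewrite mxE.
have -> : (fun n => (S1 n * S2 n) i j) = (fun n => \sum_k S1 n i k * S2 n k j).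
  by apply/funext => n; rewrite mxE.
by apply: cvg_sum_real => k; apply: cvgM; [exact: SA|exact: SB].
Qed.

Lemma mconvN S A : mconv S A -> mconv (fun n => - S n) (- A).
Proof.
move=> SA i j; rewrite mxE.
have -> : (fun n => (- S n) i j) = (fun n => - S n i j).
  by apply/funext => n; rewrite mxE.
by apply: cvgN; exact: SA.
Qed.

Lemma mconvB S1 S2 A B : mconv S1 A -> mconv S2 B ->
  mconv (fun n => S1 n - S2 n) (A - B).
Proof. by move=> SA SB; apply: mconvD => //; exact: mconvN. Qed.

Lemma mconv_nrm S A : mconv S A -> nrm (S n) @[n --> F] --> nrm A.
Proof.
by move=> SA; rewrite /nrm; apply: cvg_sum_real => i; apply: cvg_sum_real => j;
  apply: cvg_norm; exact: SA.
Qed.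

Lemma mconv_nrm_le S A (r : R) : mconv S A ->
  (\forall n \near F, nrm (S n) <= r) -> nrm A <= r.
Proof.
move=> /mconv_nrm SA Sr; rewrite -(cvg_lim (@Rhausdorff R) SA).
by apply: limr_le => //; exact: cvgP SA.
Qed.

Lemma mconv_unique S A B : mconv S A -> mconv S B -> A = B.
Proof.
move=> SA SB; apply/matrixP => i j.
by rewrite -(cvg_lim (@Rhausdorff R) (SA i j)) -(cvg_lim (@Rhausdorff R) (SB i j)).
Qed.

Lemma mconv_cvg S A : mconv S A -> S @ F --> A.
Proof.
move=> /mconvP/cvgrPdist_lt SA; apply/cvgrPdist_lt => e /SA SAe; apply: filterS SAe => n.
rewrite sub0r normrN (ger0_norm (nrm_ge0 _)) nrmBC; apply: le_lt_trans.
rewrite [leLHS]/Num.Def.normr/= mx_normrE (bigmax_le _ (nrm_ge0 _))//= => -[i j] _.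
exact: nrm_entry.
Qed.

End Convergence.

Lemma ultra_mconv (I : Type) (G : set_system I) (S : I -> M) (r : R) :
  UltraFilter G -> (\forall n \near G, nrm (S n) <= r) ->
  exists2 A, mconv G S A & nrm A <= r.
Proof.
move=> UG Sr; have PG : ProperFilter G by exact: ultra_proper.
have lim i j : exists a, S n i j @[n --> G] --> (a : R).
  have cI : compact `[- r, r]%classic := @segment_compact R _ _.
  have [|a _ Sa] := @ultra_compact_cvg I G R (fun n => S n i j) _ UG cI; last by exists a.
  apply: filterS Sr => n Sn /=; rewrite in_itv /= -ler_norml.
  by rewrite (le_trans _ Sn)// nrm_entry.
have [a aP] := choice (fun ij => lim ij.1 ij.2).
exists (\matrix_(i, j) a (i, j)).
  by move=> i j; rewrite mxE; exact: aP (i, j).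
apply: (mconv_nrm_le (F := G) (S := S)) => // i j.
by rewrite mxE; exact: aP (i, j).
Qed.

End EntryNorm.
Arguments mconv_cst {R N I F FF} A i j.

(** * The matrix exponential *)

Section MatrixExponential.
Context {R : realType} {N : nat}.
Local Notation M := 'M[R]_N.
Implicit Types A B C : M.

Definition mexp_psum A n : M := \sum_(0 <= k < n) (k`!%:R^-1 *: A ^+ k).
Definition mexp A : M := \matrix_(i, j) limn (fun n => mexp_psum A n i j).

Lemma series_exp_coeff_le (x : R) n : 0 <= x -> series (exp_coeff x) n <= expR x.
Proof.
move=> x0; apply: nondecreasing_cvgn_le; last exact: is_cvg_series_exp_coeff.
apply: nondecreasing_series => k _ _; exact: exp_coeff_ge0.
Qed.

(** The coefficients of the (i, j) entry of A^m exp(t A) as a power series in t. Formal derivation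
    raises m by 1, so that one family covers exp(t A) and its derivatives. *)
Let coef A i j (m : nat) : nat -> R := fun n => (A ^+ (n + m)) i j / n`!%:R.

Lemma mexp_pseries_cvg A i j m (x : R) : cvgn (pseries (coef A i j m) x).
Proof.
apply: normed_cvg.
apply: (@series_le_cvg _ _ (fun n => nrm (A ^+ m) * exp_coeff (nrm A * `|x|) n)) => //=.
- by move=> n; rewrite mulr_ge0 ?nrm_ge0// exp_coeff_ge0// mulr_ge0// nrm_ge0.
- move=> n; rewrite /coef /exp_coeff /= !normrM normfV normr_nat normrX.
  rewrite exprMn [leLHS]mulrAC !mulrA ler_wpM2r ?invr_ge0// ler_wpM2r ?exprn_ge0//.
  rewrite addnC exprD (le_trans (nrm_entry _ i j))// nrmMX //.
- apply: is_cvg_seriesZ; exact: is_cvg_series_exp_coeff.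
Qed.

Lemma pseries_diffs_coef A i j m : pseries_diffs (coef A i j m) = coef A i j m.+1.
Proof.
apply/funext => n; rewrite /pseries_diffs /coef factS natrM addSnnS.
by rewrite invfM mulrCA mulVKf.
Qed.

Lemma mexp_psum_entry A n i j (t : R) m :
  (A ^+ m * mexp_psum (t *: A) n) i j = pseries (coef A i j m) t n.
Proof.
rewrite /mexp_psum mulr_sumr summxE /pseries /series /=.
apply: eq_bigr => k _; rewrite /coef.
have -> : (t *: A) ^+ k = t ^+ k *: A ^+ k.
  elim: k => [|k IH]; first by rewrite !expr0 scale1r.
  by rewrite !exprS IH -!mulmxE -scalemxAl -scalemxAr scalerA.
rewrite -mulmxE -!scalemxAr mulmxE -exprD [LHS]mxE [X in _ * X]mxE addnC.
by ring.
Qed.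

Lemma mexp_conv A : mconv \oo (mexp_psum A) (mexp A).
Proof.
move=> i j; rewrite mxE.
have := @mexp_pseries_cvg A i j 0 1.
suff -> : pseries (coef A i j 0) 1 = (fun n => mexp_psum A n i j) by [].
by apply/funext => n; rewrite -mexp_psum_entry expr0 mul1r scale1r.
Qed.

Arguments mexp_conv A i j : clear implicits.

Lemma mexp_entry_pseries A i j m t :
  (A ^+ m * mexp (t *: A)) i j = limn (pseries (coef A i j m) t).
Proof.
apply/esym/cvg_lim => //.
have h : mconv \oo (fun n => A ^+ m * mexp_psum (t *: A) n) (A ^+ m * mexp (t *: A)).
  by apply: mconvM; [exact: mconv_cst|exact: mexp_conv].
have := h i j.
by under eq_fun do rewrite mexp_psum_entry.
Qed.

Definition mderiv (c : R -> M) (t : R) A :=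
  forall i j, is_derive t (1 : R) (fun s => c s i j) (A i j).

Lemma mexp_deriv A t : mderiv (fun s => mexp (s *: A)) t (A * mexp (t *: A)).
Proof.
move=> i j; have xK : `|t| < `| (`|t| + 1)|.
  by rewrite [ltRHS]ger0_norm ?addr_ge0// ltrDl.
(* Termwise derivation at t requires the series and its first two formal derivatives to converge at
   a point of larger absolute value. *)
have cv m := @mexp_pseries_cvg A i j m (`|t| + 1).
have := @pseries_snd_diffs R (coef A i j 0) (`|t| + 1) t (cv 0).
rewrite !pseries_diffs_coef => /(_ (cv 1) (cv 2) xK).
rewrite -mexp_entry_pseries expr1; congr (is_derive _ _ _ _).
by apply/funext => s; rewrite -mexp_entry_pseries expr0 mul1r.
Qed.

Lemma mexp_comm A t : A * mexp (t *: A) = mexp (t *: A) * A.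
Proof.
apply: (@mconv_unique _ _ _ \oo _ (fun n => A * mexp_psum (t *: A) n)).
  by apply: mconvM; [exact: mconv_cst|exact: mexp_conv].
rewrite [X in mconv _ X](_ : _ = fun n => mexp_psum (t *: A) n * A).
  by apply: mconvM; [exact: mexp_conv|exact: mconv_cst].
apply/funext => n.
rewrite /mexp_psum mulr_sumr mulr_suml; apply: eq_bigr => k _.
rewrite -!mulmxE -scalemxAl -scalemxAr !mulmxE; congr (_ *: _).
elim: k => [|k IH]; first by rewrite !expr0 mulr1 mul1r.
rewrite exprS mulrA (_ : A * (t *: A) = (t *: A) * A); first by rewrite -!mulrA IH.
by rewrite -!mulmxE -scalemxAl -scalemxAr.
Qed.

Lemma mexp0 : mexp 0 = 1 :> M.
Proof.
apply: (@mconv_unique _ _ _ \oo _ (mexp_psum 0)); first exact: mexp_conv.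
move=> i j; apply: cvg_near_cst.
exists 1%N => // n /= n0; rewrite /mexp_psum big_ltn// big_nat_cond big1 => [|k].
  by rewrite addr0 fact0 invr1 scale1r expr0.
by move=> /andP[/andP[k0 _] _]; rewrite expr0n; case: k k0 => // k _; rewrite scaler0.
Qed.

Lemma mderivM (c1 c2 : R -> M) t A B : mderiv c1 t A -> mderiv c2 t B ->
  mderiv (fun s => c1 s * c2 s) t (A * c2 t + c1 t * B).
Proof.
move=> d1 d2 i j; rewrite !mxE -big_split/=.
have -> : (fun s => (c1 s * c2 s) i j) =
    \sum_(k < N) ((fun s => c1 s i k) * (fun s => c2 s k j)).
  by apply/funext => s; rewrite mxE fct_sumE.
apply: is_derive_sum => k.
have := is_deriveM (d1 i k) (d2 k j); congr (is_derive _ _ _ _).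
by rewrite addrC [c2 t k j *: _]mulrC.
Qed.

Lemma mderiv_comp (c : R -> M) (f : R -> R) t a A :
  is_derive t (1 : R) f a -> mderiv c (f t) A -> mderiv (c \o f) t (a *: A).
Proof.
by move=> df dc i j; have := is_derive1_comp (dc i j) df; rewrite mxE mulrC.
Qed.

Lemma mderiv0_cst (c : R -> M) s t : (forall u, mderiv c u 0) -> c s = c t.
Proof.
move=> dc; apply/matrixP => i j; apply: (@is_derive_0_is_cst _ (fun u => c u i j)).
by move=> u; have := dc u i j; rewrite mxE.
Qed.

Lemma mderiv_mexp_affine A a b t :
  mderiv (fun s => mexp ((a * s + b) *: A)) t (a *: (A * mexp ((a * t + b) *: A))).
Proof.
apply: (@mderiv_comp (fun s => mexp (s *: A)) (fun s => a * s + b)).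
  have -> : (fun s => a * s + b) = a *: id + cst b by [].
  by apply: is_derive_eq; rewrite addr0 /GRing.scale /= mulr1.
exact: mexp_deriv.
Qed.

(** The left side has derivative 0 in t, because A commutes with its exponentials. The addition
    formula follows without multiplying series. *)
Let mexpNs A s t : mexp (- t *: A) * mexp ((s + t) *: A) = mexp (s *: A).
Proof.
pose c u := mexp ((-1 * u + 0) *: A) * mexp ((1 * u + s) *: A).
have -> : mexp (- t *: A) * mexp ((s + t) *: A) = c t.
  by rewrite /c mulN1r addr0 mul1r addrC.
rewrite (@mderiv0_cst c t 0); first by rewrite /c !mulr0 !add0r scale0r mexp0 mul1r.
move=> u; have := mderivM (mderiv_mexp_affine A (-1) 0 u) (mderiv_mexp_affine A 1 s u).
congr (mderiv _ _ _).
by rewrite scale1r scaleN1r mexp_comm mulNr -mulrA addNr.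
Qed.

Lemma mexpVr A t : mexp (- t *: A) * mexp (t *: A) = 1.
Proof. by rewrite -[in X in _ * X](add0r t) mexpNs scale0r mexp0. Qed.

Lemma mexpD A s t : mexp ((s + t) *: A) = mexp (t *: A) * mexp (s *: A).
Proof.
have e : mexp (t *: A) * mexp (- t *: A) = 1 by rewrite -[in X in X * _](opprK t) mexpVr.
by rewrite -(mexpNs A s t) mulrA e mul1r.
Qed.

Lemma mexpN A : mexp (- A) * mexp A = 1.
Proof. by have := mexpVr A 1; rewrite scaleN1r scale1r. Qed.

Lemma mexpMn A n : mexp (n%:R *: A) = mexp A ^+ n.
Proof.
elim: n => [|n IH]; first by rewrite scale0r mexp0 expr0.
by rewrite -natr1 mexpD IH scale1r -exprS.
Qed.

Let psum_bound A C n : nrm (C * mexp_psum A n) <= nrm C * expR (nrm A).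
Proof.
rewrite /mexp_psum mulr_sumr (@le_trans _ _ (\sum_(0 <= k < n) nrm C * (exp_coeff (nrm A) k)))//.
  elim/big_ind2: _ => [|x1 x2 y1 y2 h1 h2|k _]; first by rewrite nrm0.
    by rewrite (le_trans (nrmD _ _))// lerD.
  rewrite -mulmxE -scalemxAr mulmxE nrmZ ger0_norm ?invr_ge0//.
  by rewrite mulrC /exp_coeff /= mulrA ler_wpM2r ?invr_ge0// nrmMX.
by rewrite -mulr_sumr ler_wpM2l ?nrm_ge0// series_exp_coeff_le// nrm_ge0.
Qed.

Lemma nrm_Mmexp C A : nrm (C * mexp A) <= nrm C * expR (nrm A).
Proof.
apply: (@mconv_nrm_le _ _ _ \oo _ (fun n => C * mexp_psum A n)).
  by apply: mconvM; [exact: mconv_cst|exact: mexp_conv].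
by near=> n; exact: psum_bound.
Unshelve. all: by end_near. Qed.

Lemma mexp_taylor A : nrm (mexp A - 1 - A) <= nrm A ^+ 2 * expR (nrm A).
Proof.
apply: (@mconv_nrm_le _ _ _ \oo _ (fun n => mexp_psum A n - 1 - A)).
  by do 2?apply: mconvB; [exact: mexp_conv|exact: mconv_cst|exact: mconv_cst].
exists 2%N => // -[|[|n]]//= _.
rewrite /mexp_psum big_nat_recl//= big_nat_recl//=.
rewrite !fact0 invr1 !scale1r expr0 expr1 [1 + _]addrC addrK [A + _]addrC addrK.
apply: (@le_trans _ _ (\sum_(0 <= k < n) nrm A ^+ 2 * (exp_coeff (nrm A) k))).
  elim/big_ind2: _ => [|x1 x2 y1 y2 h1 h2|k _]; first by rewrite nrm0.
    by rewrite (le_trans (nrmD _ _))// lerD.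
  rewrite nrmZ ger0_norm ?invr_ge0// mulrC /exp_coeff /= mulrA.
  apply: ler_pM; rewrite ?nrm_ge0 ?invr_ge0//.
    by rewrite -exprD exprS (le_trans (nrmMX _ _ _))// -exprS.
  rewrite lef_pV2 ?posrE ?ltr0n ?fact_gt0// ler_nat.
  by rewrite leq_fact// -addn2 leq_addr.
by rewrite -mulr_sumr ler_wpM2l ?exprn_ge0 ?nrm_ge0// series_exp_coeff_le// nrm_ge0.
Qed.

Lemma mexp_lip (r : R) A B : nrm A <= r -> nrm B <= r ->
  nrm (mexp A - mexp B) <= nrm (A - B) * expR r.
Proof.
move=> Ar Br; have r0 : 0 <= r by rewrite (le_trans _ Ar)// nrm_ge0.
apply: (@mconv_nrm_le _ _ _ \oo _ (fun n => mexp_psum A n - mexp_psum B n)).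
  by apply: mconvB; exact: mexp_conv.
exists 1%N => // -[|n]//= _.
rewrite /mexp_psum !big_nat_recl//= !expr0 opprD addrACA subrr add0r -sumrB.
apply: (@le_trans _ _ (\sum_(0 <= k < n) nrm (A - B) * (exp_coeff r k))).
  elim/big_ind2: _ => [|x1 x2 y1 y2 h1 h2|k _]; first by rewrite nrm0.
    by rewrite (le_trans (nrmD _ _))// lerD.
  rewrite -scalerBr nrmZ ger0_norm ?invr_ge0// /exp_coeff /=.
  rewrite mulrC ler_pdivrMr ?ltr0n ?fact_gt0//.
  rewrite (le_trans (nrm_expB k Ar Br))// factS natrM.
  rewrite -[leRHS]mulrA ler_wpM2l ?nrm_ge0// mulrCA divfK ?pnatr_eq0 -?lt0n ?fact_gt0//.
by rewrite -mulr_sumr ler_wpM2l ?nrm_ge0// series_exp_coeff_le.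
Qed.

End MatrixExponential.
Arguments mexp_conv {R N} A i j.

(** * The tangent space of a closed linear group *)

Section ClosedLinearGroup.
Context {R : realType} {N : nat}.
Local Notation M := 'M[R]_N.
Implicit Types A B C : M.

Lemma mexp_unit A : mexp A \in unitmx.
Proof. by have := mexpN A; rewrite -mulmxE => /mulmx1_unit[]. Qed.

Lemma mexpNE A : mexp (- A) = invmx (mexp A).
Proof.
have u := mexp_unit A; rewrite -[LHS]mulmx1 -(mulmxV u) mulmxA.
by rewrite [mexp (- A) *m _]mexpN mul1mx.
Qed.

(** The hypotheses bound the multiplications by A and by B rather than their norms: matrices close
    to 1 have norm close to N, and its k-th power would be useless, whereas r is close to 1. *)
Let nrm_pow_diff A B (r : R) k : 1 <= r ->
  (forall C, nrm (A * C) <= r * nrm C) -> (forall C, nrm (C * B) <= nrm C * r) ->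
  nrm (A ^+ k - B ^+ k) <= k%:R * r ^+ k * nrm (A - B).
Proof.
move=> r1 hA hB; have r0 : 0 <= r by exact: le_trans r1.
have hAk n C : nrm (A ^+ n * C) <= r ^+ n * nrm C.
  elim: n => [|n IH]; first by rewrite !expr0 !mul1r.
  by rewrite !exprS -!mulrA (le_trans (hA _))// ler_wpM2l.
elim: k => [|k IH]; first by rewrite !expr0 subrr nrm0 !mul0r.
have -> : A ^+ k.+1 - B ^+ k.+1 = A ^+ k * (A - B) + (A ^+ k - B ^+ k) * B.
  by rewrite mulrBr mulrBl -!exprSr addrA subrK.
rewrite (le_trans (nrmD _ _))//.
apply: (@le_trans _ _ (r ^+ k * nrm (A - B) + k%:R * r ^+ k * nrm (A - B) * r)).
  by rewrite lerD// (le_trans (hB _))// ler_wpM2r.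
rewrite -natr1 !mulrDl mul1r addrC lerD//.
  by rewrite exprSr le_eqVlt; apply/orP; left; apply/eqP; ring.
by rewrite ler_wpM2r ?nrm_ge0// exprS ler_peMl// exprn_ge0.
Qed.

Section Limits.
Context {I : Type} (F : set_system I) {FF : ProperFilter F}.

(** Replacing 1 + x by exp(x) costs O(|x|^2) per factor, hence O(k |x|^2) in all, which tends to 0
    because k x stays bounded; and exp(x)^k = exp(k x) tends to exp(B). *)
Lemma mexp_limit (x : I -> M) (k : I -> nat) B :
  mconv F x 0 -> mconv F (fun i => (k i)%:R *: x i) B ->
  mconv F (fun i => (1 + x i) ^+ k i) (mexp B).
Proof.
move=> x0 kx; apply/mconvP; set b := nrm B.
have x0' : nrm (x i) @[i --> F] --> (0 : R).
  by have /mconvP := x0; under eq_fun do rewrite subr0.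
have kx' : nrm ((k i)%:R *: x i - B) @[i --> F] --> (0 : R) by apply/mconvP.
have kb : nrm ((k i)%:R *: x i) @[i --> F] --> b by exact: mconv_nrm.
pose u i := (b + 1) * expR (b + 2) * nrm (x i) + expR (b + 1) * nrm ((k i)%:R *: x i - B).
have u0 : u i @[i --> F] --> (0 : R).
  rewrite -[0](_ : (b + 1) * expR (b + 2) * 0 + expR (b + 1) * 0 = 0); last first.
    by rewrite !mulr0 addr0.
  by apply: cvgD; apply: cvgMl_tmp.
apply: (@squeeze_cvgr _ F _ _ (fun=> 0) u) => //; last exact: cvg_cst.
near=> i; rewrite nrm_ge0/= /u.
have xi1 : nrm (x i) <= 1.
  by near: i; apply: (cvgr_le _ x0'); exact: ltr01.
have kb1 : nrm ((k i)%:R *: x i) <= b + 1.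
  by near: i; apply: (cvgr_le _ kb); rewrite ltrDl.
have b0 : 0 <= b := nrm_ge0 B.
apply: le_trans (nrm_triangle (mexp (x i) ^+ k i) _ _) _; apply: lerD; last first.
  rewrite -mexpMn mulrC; apply: mexp_lip => //.
  by rewrite lerDl.
have nx0 := nrm_ge0 (x i).
have e1 : 1 <= expR (nrm (x i)) by rewrite -expR0 ler_expR.
apply: le_trans (nrm_pow_diff (k i) e1 _ _) _.
- move=> C; rewrite mulrDl mul1r (le_trans (nrmD _ _))//.
  apply: (@le_trans _ _ ((1 + nrm (x i)) * nrm C)).
    by rewrite mulrDl mul1r lerD2l nrmM.
  by rewrite ler_wpM2r ?nrm_ge0// expR_ge1Dx.
- by move=> C; exact: nrm_Mmexp.
have := mexp_taylor (x i); rewrite -addrA -opprD nrmBC => tay.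
apply: (@le_trans _ _ ((k i)%:R * expR (nrm (x i)) ^+ k i *
    (nrm (x i) ^+ 2 * expR (nrm (x i))))).
  by rewrite ler_wpM2l// mulr_ge0// exprn_ge0// expR_ge0.
move: kb1; rewrite nrmZ ger0_norm// -expRM_natl; set kn := (k i)%:R * nrm (x i) => kb1.
rewrite (_ : _ * _ = kn * expR (kn + nrm (x i)) * nrm (x i)); last first.
  by rewrite expRD /kn; ring.
by rewrite ler_wpM2r// ler_pM// ?mulr_ge0 ?expR_ge0// ler_expR; lra.
Unshelve. all: by end_near. Qed.

End Limits.

Variable (L : set M).
Hypothesis clL : closed_linear_group L.

Let L1 : L 1. Proof. by case: clL => -[]. Qed.
Let LM A B : L A -> L B -> L (A * B). Proof. by case: clL => -[_ _ h _] _; exact: h. Qed.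

Lemma linear_groupX A n : L A -> L (A ^+ n).
Proof. by move=> LA; elim: n => [|n IH]; rewrite ?expr0// exprS; exact: LM. Qed.

Lemma closed_linear_group_lim (I : Type) (F : set_system I) (FF : ProperFilter F)
    (S : I -> M) A : (\forall i \near F, L (S i)) -> mconv F S A ->
  A \in unitmx -> L A.
Proof.
move=> LS SA uA; have [_] := clL; apply; split=> // B nB.
have SB : F (S @^-1` B) by apply: (mconv_cvg SA).
by have [i [Li Bi]] := filter_ex (filterI LS SB); exists (S i).
Qed.

(** Used with the increments at 1 of a curve of L, and with those of a sequence of L tending to
    1. *)
Lemma mexp_in_group (I : Type) (F : set_system I) (FF : ProperFilter F)
    (x : I -> M) (k : I -> nat) B : (\forall i \near F, L (1 + x i)) ->
  mconv F x 0 -> mconv F (fun i => (k i)%:R *: x i) B -> L (mexp B).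
Proof.
move=> Lx x0 kx; apply: (closed_linear_group_lim (F := F)) (mexp_limit x0 kx) _.
  by apply: filterS Lx => i; exact: linear_groupX.
exact: mexp_unit.
Qed.

Lemma mderiv_is_derive (c : R -> M) t A : mderiv c t A <-> is_derive t 1 c A.
Proof.
split=> [d|d i j].
  have dc : derivable c t 1 by apply/derivable_mxP => i j; case: (d i j).
  split=> //; rewrite derive_mx//; apply/matrixP => i j; rewrite mxE.
  by case: (d i j).
have dc : derivable c t 1 by case: d.
have /derivable_mxP/(_ i j) dij := dc; split=> //.
by case: d => _ <-; rewrite derive_mx// mxE.
Qed.

Variable (g : {vspace M}).
Hypothesis Lg : is_lie_algebra_of L g.

Lemma harmonic_dnbhs : (n.+1%:R^-1 : R) @[n --> \oo] --> (0 : R)^'.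
Proof.
move=> P [e /= e0 eP].
have /cvgrPdist_lt/(_ _ e0) := @cvg_harmonic R; apply: filterS => n /= hn.
by apply: eP => //=; rewrite gt_eqF// invr_gt0.
Qed.

Lemma mexp_lie_algebra A : A \in g -> L (mexp A).
Proof.
move=> /Lg[c [Lc c0 /mderiv_is_derive dc]].
pose x n := c (n.+1%:R^-1) - 1.
have lim : mconv \oo (fun n => n.+1%:R *: x n) A.
  move=> i j; have [+ dij] := dc i j.
  rewrite /derivable; set h := (fun _ => _) => cvh.
  have hA : h s @[s --> 0^'] --> A i j by move: cvh; rewrite -dij.
  have := cvg_comp _ _ harmonic_dnbhs hA.
  rewrite (_ : h \o _ = (fun n => (n.+1%:R *: x n) i j))//.
  apply/funext => n; rewrite /h /x /= invrK !mxE addr0 c0 /GRing.scale /= mulr1 !mxE.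
  by [].
have x0 : mconv \oo x 0.
  apply/mconvP; under eq_fun do rewrite subr0.
  have -> : (fun n => nrm (x n)) = (fun n => n.+1%:R^-1 * nrm (n.+1%:R *: x n)).
    by apply/funext => n; rewrite nrmZ ger0_norm// mulKf// pnatr_eq0.
  rewrite -[0](mul0r (nrm A)); apply: cvgM; first exact: cvg_harmonic.
  exact: mconv_nrm.
apply: (@mexp_in_group nat \oo _ x succn) => //.
by near=> n; rewrite /x addrC subrK.
Unshelve. all: by end_near. Qed.

(* Otherwise the directions of a sequence of counterexamples tending to 1 have
   a limit w along an ultrafilter, and L contains the exponentials of t w. *)
Lemma lie_algebra_tangent (eta : R) : 0 < eta -> exists2 r, 0 < r &
  forall h, L h -> nrm (h - 1) <= r ->
    exists2 A, A \in g & nrm (h - 1 - A) <= eta * nrm (h - 1).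
Proof.
move=> eta0; apply: contrapT => H.
have bad n : exists h, [/\ L h, nrm (h - 1) <= n.+1%:R^-1 &
    forall A, A \in g -> eta * nrm (h - 1) < nrm (h - 1 - A)].
  apply: contrapT => H'; apply: H; exists n.+1%:R^-1; first by rewrite invr_gt0.
  move=> h Lh hn; apply: contrapT => H2; apply: H'; exists h; split=> // A gA.
  by rewrite ltNge; apply/negP => le; apply: H2; exists A.
have [h hP] := choice bad; pose x n := h n - 1; pose d n := nrm (x n).
have d0 n : 0 < d n.
  rewrite lt_def nrm_ge0 andbT; apply/negP => /eqP dn.
  have [_ _ /(_ 0 (mem0v _))] := hP n.
  by rewrite subr0 -/(x n) -/(d n) dn mulr0 ltxx.
have [G [UG sG]] := ultraFilterLemma (@eventually_filter).
have PG : ProperFilter G by exact: ultra_proper.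
have nw n : nrm ((d n)^-1 *: x n) = 1.
  by rewrite nrmZ ger0_norm ?invr_ge0 ?ltW// mulVf// gt_eqF.
have [|w dw _] := @ultra_mconv _ _ _ _ (fun n => (d n)^-1 *: x n) 1 UG.
  by apply: sG; exists 0%N => // n _ /=; rewrite nw.
have dG : d n @[n --> G] --> (0 : R).
  have : d n @[n --> \oo] --> (0 : R).
    apply: (@squeeze_cvgr _ \oo _ _ (fun=> 0) harmonic); [|exact: cvg_cst|exact: cvg_harmonic].
    by near=> n; rewrite ltW//=; case: (hP n).
  by move=> dc; apply: cvg_trans dc => P /=; exact: sG.
have x0 : mconv G x 0.
  by apply/mconvP; under eq_fun do rewrite subr0.
have Ltw t : 0 <= t -> L (mexp (t *: w)).
  (* With this exponent [k n * d n] tends to t, so that [h n ^+ k n] tends to exp(t w). *)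
  move=> t0; pose k n := Num.truncn (t / d n).
  apply: (@mexp_in_group nat G _ x k) => //.
    by apply: sG; exists 0%N => // n _ /=; rewrite /x addrC subrK; case: (hP n).
  have kt : (k n)%:R * d n @[n --> G] --> t.
    apply: (@squeeze_cvgr _ G _ _ (fun n => t - d n) (fun=> t)).
    - near=> n; have /truncn_itv/andP[k1 k2] : 0 <= t / d n by rewrite divr_ge0// ltW.
      rewrite -ler_pdivlMr// k1 andbT lerBlDr -[X in _ + X]mul1r -mulrDl.
      by rewrite -ler_pdivrMr// natr1 ltW.
    - by rewrite -[X in _ --> X]subr0; apply: cvgB => //; exact: cvg_cst.
    - exact: cvg_cst.
  move=> i j; rewrite mxE.
  have -> : (fun n => ((k n)%:R *: x n) i j) =
      (fun n => (k n)%:R * d n * ((d n)^-1 *: x n) i j).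
    by apply/funext => n; rewrite !mxE -mulrA mulVKf// gt_eqF.
  by apply: cvgM => //; exact: dw.
have gw : w \in g.
  apply/Lg; exists (fun t => mexp (t *: w)); split.
  - move=> t; have [t0|t0] := leP 0 t; first exact: Ltw.
    rewrite -[t]opprK scaleNr mexpNE.
    by case: clL => -[_ _ _ h'] _; apply: h'; apply: Ltw; rewrite oppr_ge0 ltW.
  - by rewrite scale0r mexp0.
  - apply/mderiv_is_derive; have := mexp_deriv w 0.
    by rewrite scale0r mexp0 mulr1.
(* For a suitable n, [d n *: w] contradicts the choice of [h n]: it lies in g and is within eta
   times [d n] of [h n - 1]. *)
have /mconvP/cvgrPdist_lt/(_ _ eta0) := dw.
move=> /filter_ex[n]; rewrite sub0r normrN (ger0_norm (nrm_ge0 _)) => lt.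
have [_ _ /(_ (d n *: w))] := hP n.
have -> : h n - 1 - d n *: w = d n *: ((d n)^-1 *: x n - w).
  by rewrite scalerBr scalerA divff ?gt_eqF// scale1r /x.
rewrite memvZ// => /(_ isT); rewrite -/(x n) -/(d n) nrmZ (ger0_norm (ltW (d0 n))).
by rewrite mulrC ltr_pM2l// ltNge (ltW lt).
Unshelve. all: by end_near. Qed.

End ClosedLinearGroup.

Lemma addr_telescope (V : zmodType) (a b c d e f g : V) :
  a - b - (c + d) = (a - e - f) + (f - c) + (e - b - g) + (g - d).
Proof.
rewrite subrKA -[RHS]addrA subrKA [a - e - c]addrAC -[e - b - d]addrA subrKA.
by rewrite opprD addrACA [- b - d]addrC addrA.
Qed.

(** * Coordinates near the identity *)

Section LocalCoordinates.
Context {R : realType} {N : nat}.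
Local Notation M := 'M[R]_N.
Implicit Types A B C : M.

(** Coordinates of the second kind. Each factor moves inside a one-parameter group, so its
    increments are given by [mexpD], and no exponential of a sum of non-commuting matrices has to be
    expanded. *)
Fixpoint mexp_prod (b : nat -> M) (t : nat -> R) n : M :=
  if n is m.+1 then mexp_prod b t m * mexp (t m *: b m) else 1.

Definition l1norm (t : nat -> R) n : R := \sum_(i < n) `|t i|.

Definition lincomb (b : nat -> M) (s : nat -> R) n : M := \sum_(i < n) s i *: b i.

Lemma l1norm_ge0 t n : 0 <= l1norm t n.
Proof. exact: sumr_ge0. Qed.

Lemma l1normS t n : l1norm t n.+1 = l1norm t n + `|t n|.
Proof. by rewrite /l1norm big_ord_recr. Qed.

Lemma l1normD t s n : l1norm (t + s) n <= l1norm t n + l1norm s n.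
Proof. by rewrite /l1norm -big_split; apply: ler_sum => i _; exact: ler_normD. Qed.

Lemma nrm_lincomb b s n :
  nrm (lincomb b s n) <= (\sum_(i < n) nrm (b i)) * l1norm s n.
Proof.
rewrite (le_trans (nrm_sum _))// mulr_suml; apply: ler_sum => i _.
rewrite nrmZ mulrC ler_wpM2l ?nrm_ge0// /l1norm (bigD1 i)//= lerDl.
exact: sumr_ge0.
Qed.

Lemma nrm_mexpB1 A (r : R) : nrm A <= r -> nrm (mexp A - 1) <= nrm A * expR r.
Proof.
move=> Ar; have := @mexp_lip _ _ r A 0 Ar; rewrite nrm0 mexp0 subr0; apply.
by rewrite (le_trans _ Ar)// nrm_ge0.
Qed.

Let mexp_strict A (a c : R) : `|a| <= 1 -> `|c| <= 1 ->
  nrm (mexp ((a + c) *: A) - mexp (a *: A) - c *: A)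
    <= 2 * (nrm A ^+ 2 * expR (2 * nrm A)) * (`|a| + `|c|) * `|c|.
Proof.
move=> a1 c1; have A0 := nrm_ge0 A.
have -> : mexp ((a + c) *: A) - mexp (a *: A) - c *: A =
    (mexp (c *: A) - 1 - c *: A) * mexp (a *: A) + c *: A * (mexp (a *: A) - 1).
  by rewrite mexpD !mulrBl mul1r mulrBr mulr1 [in RHS]addrA subrK.
have sA (x : R) : `|x| <= 1 -> nrm (x *: A) <= nrm A.
  by move=> x1; rewrite nrmZ ler_piMl.
rewrite (le_trans (nrmD _ _))//.
have h1 : nrm ((mexp (c *: A) - 1 - c *: A) * mexp (a *: A)) <=
    (nrm A ^+ 2 * expR (2 * nrm A)) * (`|c| * `|c|).
  rewrite (le_trans (nrm_Mmexp _ _))//.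
  apply: (@le_trans _ _ (nrm (c *: A) ^+ 2 * expR (nrm A) * expR (nrm A))).
    apply: ler_pM; rewrite ?nrm_ge0 ?expR_ge0// ?ler_expR ?sA//.
    by rewrite (le_trans (mexp_taylor _))// ler_wpM2l ?exprn_ge0 ?nrm_ge0// ler_expR sA.
  rewrite nrmZ -mulrA -expRD -mulr2n -[nrm A *+ 2]mulr_natl.
  by rewrite le_eqVlt; apply/orP; left; apply/eqP; ring.
have h2 : nrm (c *: A * (mexp (a *: A) - 1)) <=
    (nrm A ^+ 2 * expR (2 * nrm A)) * (`|a| * `|c|).
  rewrite (le_trans (nrmM _ _))//.
  apply: (@le_trans _ _ (nrm (c *: A) * (nrm (a *: A) * expR (2 * nrm A)))).
    rewrite ler_wpM2l ?nrm_ge0// (le_trans (nrm_mexpB1 (sA _ a1)))//.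
    by rewrite ler_wpM2l ?nrm_ge0// ler_expR; lra.
  by rewrite !nrmZ le_eqVlt; apply/orP; left; apply/eqP; ring.
rewrite (le_trans (lerD h1 h2))// -mulrDr.
set K := nrm A ^+ 2 * _; have K0 : 0 <= K by rewrite mulr_ge0 ?exprn_ge0 ?expR_ge0.
have := normr_ge0 a; have := normr_ge0 c => c0 a0.
rewrite -mulrDl addrC mulrA ler_wpM2r// ler_wpM2r ?addr_ge0//; lra.
Qed.

(** Strict differentiability at 0: the linear approximation holds between any two small points t and
    t + s, with an error that is a small multiple of the increment. A Newton step taken at t needs
    this, and not just the derivative at 0. *)
Lemma mexp_prod_strict b n : exists2 C : R, 0 <= C &
  forall t s, l1norm t n <= 1 -> l1norm s n <= 1 ->
  nrm (mexp_prod b (t + s) n - mexp_prod b t n - lincomb b s n)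
    <= C * (l1norm t n + l1norm s n) * l1norm s n.
Proof.
elim: n => [|n [C C0 IH]].
  exists 0 => // t s _ _ /=.
  by rewrite subrr sub0r nrmN /lincomb big_ord0 nrm0 !mul0r.
pose B := \sum_(i < n) nrm (b i); pose be := nrm (b n).
have B0 : 0 <= B by apply: sumr_ge0 => i _; exact: nrm_ge0.
have be0 : 0 <= be := nrm_ge0 _.
pose K := 2 * (be ^+ 2 * expR (2 * be)); pose e2 := expR (2 * be).
have e20 : 0 <= e2 := expR_ge0 _.
have K0 : 0 <= K by rewrite mulr_ge0// mulr_ge0 ?exprn_ge0 ?expR_ge0.
(* One term for each of the four summands bounded in [q1] to [q4]. *)
exists (C * e2 + B * (be * e2) + (nrm (1 : M) + C + B) * K + (C + B) * be).
  have := nrm_ge0 (1 : M) => n10.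
  by rewrite !addr_ge0 ?mulr_ge0 ?addr_ge0.
move=> t s; rewrite !l1normS => t1 s1 /=.
have tn0 := l1norm_ge0 t n; have sn0 := l1norm_ge0 s n.
have ta0 := normr_ge0 (t n); have sa0 := normr_ge0 (s n).
set rho := _ + _ + (_ + _); set sig := _ + `|s n|.
have sig0 : 0 <= sig by rewrite addr_ge0.
have rho0 : 0 <= rho by rewrite addr_ge0// addr_ge0.
have [t1' s1'] : l1norm t n <= 1 /\ l1norm s n <= 1 by split; lra.
have [ta1 sa1] : `|t n| <= 1 /\ `|s n| <= 1 by split; lra.
have IHts := IH t s t1' s1'.
have P1 : nrm (mexp_prod b t n - 1) <= (C + B) * l1norm t n.
  have l0 : l1norm 0 n = 0 by apply: big1 => i _; exact: normr0.
  have := IH 0 t; rewrite l0 ler01 !add0r => /(_ isT t1') h.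
  have e0 : mexp_prod b 0 n = 1.
    elim: (n) => //= m ->.
    by rewrite mul1r (_ : 0 m = 0 :> R)// scale0r mexp0.
  rewrite e0 in h.
  rewrite -[X in nrm X](subrK (lincomb b t n)) (le_trans (nrmD _ _))//.
  rewrite mulrDl lerD ?nrm_lincomb// (le_trans h)//.
  by rewrite ler_piMr// mulr_ge0.
set P' := mexp_prod b (t + s) n in IHts *; set P := mexp_prod b t n in IHts P1 *.
set U := lincomb b s n in IHts.
have -> : lincomb b s n.+1 = U + s n *: b n by rewrite /lincomb big_ord_recr.
set E' := mexp _; set E := mexp _; set V := s n *: b n.
have -> : P' * E' - P * E - (U + V) =
    (P' - P - U) * E' + U * (E' - 1) + P * (E' - E - V) + (P - 1) * V.
  by rewrite !mulrBl !mulrBr mul1r mulr1; exact: addr_telescope.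
have nV : nrm V <= be * `|s n| by rewrite nrmZ mulrC.
have nU : nrm U <= B * sig.
  by rewrite (le_trans (nrm_lincomb _ _ _))// ler_wpM2l// lerDl.
have ab2 : nrm ((t n + s n) *: b n) <= 2 * be.
  by rewrite nrmZ ler_wpM2r// (le_trans (ler_normD _ _))//; lra.
have tr : l1norm t n <= rho by rewrite /rho; lra.
have ab : `|t n + s n| <= rho.
  by rewrite (le_trans (ler_normD _ _))// /rho; lra.
have q1 : nrm ((P' - P - U) * E') <= C * e2 * rho * sig.
  rewrite (le_trans (nrm_Mmexp _ _))//.
  apply: (@le_trans _ _ (C * rho * sig * e2)); last by rewrite le_eqVlt; apply/orP; left; apply/eqP; ring.
  apply: ler_pM; rewrite ?nrm_ge0 ?expR_ge0 ?ler_expR//.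
  rewrite (le_trans IHts)// -!mulrA ler_wpM2l// ler_pM ?addr_ge0//.
    by rewrite /rho; lra.
  by rewrite /sig; lra.
have q2 : nrm (U * (E' - 1)) <= B * (be * e2) * rho * sig.
  rewrite (le_trans (nrmM _ _))//.
  apply: (@le_trans _ _ ((B * sig) * (rho * be * e2))); last by rewrite le_eqVlt; apply/orP; left; apply/eqP; ring.
  rewrite ler_pM ?nrm_ge0// (le_trans (nrm_mexpB1 ab2))// ler_wpM2r//.
  by rewrite nrmZ ler_wpM2r.
have nP : nrm P <= nrm (1 : M) + C + B.
  rewrite -[P](subrK 1) (le_trans (nrmD _ _))// addrC -addrA lerD2l (le_trans P1)//.
  by rewrite ler_piMr// addr_ge0.
have q3 : nrm (P * (E' - E - V)) <= (nrm (1 : M) + C + B) * K * rho * sig.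
  rewrite (le_trans (nrmM _ _))//.
  apply: (@le_trans _ _ ((nrm (1 : M) + C + B) * (K * rho * sig))); last by rewrite !mulrA.
  rewrite ler_pM ?nrm_ge0//.
  have : nrm (E' - E - V) <= K * (`|t n| + `|s n|) * `|s n| by exact: mexp_strict.
  move/le_trans; apply; rewrite -[leLHS]mulrA -[leRHS]mulrA.
  rewrite ler_wpM2l// ler_pM ?addr_ge0//; first by rewrite /rho; lra.
  by rewrite /sig; lra.
have q4 : nrm ((P - 1) * V) <= (C + B) * be * rho * sig.
  rewrite (le_trans (nrmM _ _))//.
  apply: (@le_trans _ _ (((C + B) * rho) * (be * sig))); last by rewrite le_eqVlt; apply/orP; left; apply/eqP; ring.
  apply: ler_pM; rewrite ?nrm_ge0//.
    by rewrite (le_trans P1)// ler_wpM2l// addr_ge0.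
  by rewrite (le_trans nV)// ler_wpM2l// /sig; lra.
apply: (@le_trans _ _ (C * e2 * rho * sig + B * (be * e2) * rho * sig +
  (nrm (1 : M) + C + B) * K * rho * sig + (C + B) * be * rho * sig)).
  rewrite (le_trans (nrmD _ _))// lerD// (le_trans (nrmD _ _))// lerD//.
  by rewrite (le_trans (nrmD _ _))// lerD.
by rewrite -!mulrDl.
Qed.

End LocalCoordinates.

Section LocalSurjectivity.
Context {R : realType} {N : nat}.
Local Notation M := 'M[R]_N.
Implicit Types A B C : M.

Definition lie_basis (g : {vspace M}) (k : nat) : M := (vbasis g)`_k.

Lemma lie_coord (g : {vspace M}) : exists2 kappa : R, 0 <= kappa &
  forall A, A \in g -> exists2 s : nat -> R,
    A = lincomb (lie_basis g) s (\dim g) & l1norm s (\dim g) <= kappa * nrm A.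
Proof.
pose X := vbasis g.
pose kap (i : 'I_(\dim g)) := \sum_j \sum_k `|coord X i (delta_mx j k)|.
exists (\sum_i kap i).
  by apply: sumr_ge0 => i _; apply: sumr_ge0 => j _; exact: sumr_ge0.
move=> A gA.
pose s k : R := if insub k is Some i then coord X i A else 0.
have sE (i : 'I_(\dim g)) : s i = coord X i A by rewrite /s valK.
exists s.
  rewrite /lincomb [LHS](coord_vbasis gA); apply: eq_bigr => i _.
  by rewrite sE.
rewrite /l1norm mulr_suml; apply: ler_sum => i _; rewrite sE.
rewrite {1}[A]matrix_sum_delta linear_sum /= (le_trans (ler_norm_sum _ _ _))//.
rewrite /kap mulr_suml; apply: ler_sum => j _.
rewrite linear_sum /= (le_trans (ler_norm_sum _ _ _))// mulr_suml.
apply: ler_sum => k _; rewrite linearZ /= normrM mulrC ler_wpM2l//.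
exact: nrm_entry.
Qed.

Lemma nrm_inv_near1 A B : A * B = 1 -> nrm (A - 1) <= 1 / 2 ->
  nrm B <= 2 * nrm (1 : M).
Proof.
move=> AB A1; have -> : B = 1 - (A - 1) * B by rewrite mulrBl mul1r AB opprB addrC subrK.
have := nrmB 1 ((A - 1) * B); have := nrmM (A - 1) B.
have -> : 1 - (A - 1) * B = B by rewrite mulrBl mul1r AB opprB addrC subrK.
have := nrm_ge0 B; nra.
Qed.

(** P is the current point, A the tangent vector approximating x = P^-1 h - 1, and P' the point
    after the step. The new error is (x - A) + (P - 1) x - (P' - P - A); the first two terms are at
    most |y| / 8 each and the third at most |y| / 4. *)
Lemma newton_step_error (h P Q P' A : M) (n1 eta : R) : P * Q = 1 -> Q * P = 1 ->
  nrm Q <= 2 * n1 -> 0 <= eta -> eta * (16 * n1) = 1 -> nrm (P - 1) <= eta ->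
  nrm (Q * h - 1 - A) <= eta * nrm (Q * h - 1) -> nrm (P' - P - A) <= nrm (h - P) / 4 ->
  nrm (h - P') <= nrm (h - P) / 2.
Proof.
move=> PQ QP nQ eta0 eta1 P1 hA hP'; set y := h - P in hP' *; set x := Q * h - 1 in hA.
have xy : x = Q * y by rewrite /x /y mulrBr QP.
have nx : nrm x <= 2 * n1 * nrm y.
  by rewrite xy; apply: le_trans (nrmM _ _) _; rewrite ler_wpM2r// nrm_ge0.
have h0 : eta * nrm x <= nrm y / 8.
  apply: le_trans (ler_wpM2l eta0 nx) _.
  have -> : eta * (2 * n1 * nrm y) = eta * (16 * n1) * (nrm y / 8) by field.
  by rewrite eta1 mul1r.
have -> : h - P' = (x - A) + (P - 1) * x - (P' - P - A).
  have -> : (P - 1) * x = y - x by rewrite mulrBl mul1r xy mulrA PQ mul1r.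
  rewrite [x - A + _]addrC subrKA [- (P' - P - A)]opprB subrKA opprB.
  by rewrite /y subrKA.
have h1 := nrmB ((x - A) + (P - 1) * x) (P' - P - A).
have h2 := nrmD (x - A) ((P - 1) * x).
have h3 : nrm ((P - 1) * x) <= eta * nrm x.
  by apply: le_trans (nrmM _ _) _; rewrite ler_wpM2r// nrm_ge0.
lra.
Qed.

Lemma mexp_prod_in (L : set M) (g : {vspace M}) t n : closed_linear_group L ->
  is_lie_algebra_of L g -> L (mexp_prod (lie_basis g) t n).
Proof.
move=> clL Lg; elim: n => [|n IH] /=; first by case: clL => -[].
have [[_ _ LM _] _] := clL; apply: LM => //; apply: (mexp_lie_algebra clL Lg).
rewrite memvZ// /lie_basis; have [ng|gn] := ltnP n (\dim g).
  by apply: vbasis_mem; rewrite mem_nth// size_tuple.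
by rewrite nth_default ?mem0v// size_tuple.
Qed.

(** Row vectors carry the topology in which a minimum is sought, sequences the recursion of
    [mexp_prod]. *)
Let ext d (t : 'rV[R]_d) (k : nat) : R := if insub k is Some i then t 0 i else 0.

Let extE d (t : 'rV[R]_d) (i : 'I_d) : ext t i = t 0 i.
Proof. by rewrite /ext valK. Qed.

Let ext_continuous d k : continuous (fun t : 'rV[R]_d => ext t k).
Proof.
move=> t; rewrite /ext; case: insubP => [i _ _|_]; last exact: cst_continuous.
exact: coord_continuous.
Qed.

Let mexp_prod_continuous d (b : nat -> M) n (t0 : 'rV[R]_d) :
  mconv (nbhs t0) (fun t : 'rV[R]_d => mexp_prod b (ext t) n) (mexp_prod b (ext t0) n).
Proof.
elim: n => [|n IH] /=; first exact: mconv_cst.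
apply: mconvM => // i j.
have dc : derivable (fun s : R => mexp (s *: b n) i j) (ext t0 n) 1.
  by case: (mexp_deriv (b n) (ext t0 n) i j).
have /derivable1_diffP/differentiable_continuous := dc => cc.
apply: (@continuous_comp _ _ _ (fun t : 'rV[R]_d => ext t n)
  (fun s : R => mexp (s *: b n) i j)); [exact: ext_continuous|exact: cc].
Qed.

Let mexp_prod_ext (b : nat -> M) (u v : nat -> R) n :
  (forall k, (k < n)%N -> u k = v k) -> mexp_prod b u n = mexp_prod b v n.
Proof.
elim: n => [_|n IH uv]; first by [].
rewrite [LHS]/= [RHS]/= (uv n (leqnn _)) IH; first by [].
by move=> k kn; apply: uv; exact: ltnW.
Qed.

(* [h] near [1] is reached by the coordinates minimizing
   [|h - P t| + lambda * |t|]: a Newton step would decrease it otherwise. *)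
Lemma local_coordinates (L : set M) (g : {vspace M}) : closed_linear_group L ->
  is_lie_algebra_of L g -> exists r K : R, [/\ 0 < r, 0 <= K & forall h, L h ->
    nrm (h - 1) <= r -> exists2 t : nat -> R, h = mexp_prod (lie_basis g) t (\dim g) &
      l1norm t (\dim g) <= K * nrm (h - 1)].
Proof.
move=> clL Lg; set b := lie_basis g; set d := \dim g.
have [C C0 strict] := mexp_prod_strict b d.
have [kap kap0 coordP] := lie_coord g.
pose n1 := nrm (1 : M) + 1; have n10 : 1 <= n1 by rewrite /n1 lerDr nrm_ge0.
pose B := \sum_(i < d) nrm (b i).
have B0 : 0 <= B by apply: sumr_ge0 => i _; exact: nrm_ge0.
(* The inverse of the current point has norm at most 2 n1, so this value makes eta |x| at most |y| /
   8 in [newton_step_error]. *)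
pose eta := (16 * n1)^-1.
have eta0 : 0 < eta by rewrite invr_gt0; lra.
have eta1 : eta * (16 * n1) = 1 by rewrite mulVf//; lra.
have [r1 r10 tangent] := lie_algebra_tangent clL Lg eta0.
(* The weight lambda is 1 / (4 sigma): a Newton step halves the error y1 and lengthens the
   coordinates by at most sigma y1, which costs only y1 / 4. *)
have decrease (y1 y2 s1 s2 sigma : R) : 0 < sigma -> 0 < y1 -> y2 <= y1 / 2 ->
    s2 <= s1 + sigma * y1 -> y2 + (4 * sigma)^-1 * s2 < y1 + (4 * sigma)^-1 * s1.
  move=> sigma0 y10 y21 s21; have sigma4 : 0 <= (4 * sigma)^-1 by rewrite invr_ge0; lra.
  have := ler_wpM2l sigma4 s21.
  have -> : (4 * sigma)^-1 * (s1 + sigma * y1) = (4 * sigma)^-1 * s1 + y1 / 4.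
    by field; lra.
  lra.
(* [sigma] bounds the size of a Newton step in terms of the error *)
pose sigma := 4 * kap * n1 + 1; have sigma0 : 0 < sigma.
  by rewrite /sigma ltr_wpDl// !mulr_ge0//; lra.
(* 1 / D is the radius of the ball of coordinates where the minimum is sought. Its three terms give
   rho <= 1 / 4, (C + B) rho <= eta and C rho sigma <= 1 / 8. *)
pose D := 4 + (C + B) * (16 * n1) + 8 * C * sigma.
have CB0 : 0 <= C + B by rewrite addr_ge0.
have q1 : 0 <= (C + B) * (16 * n1) by rewrite mulr_ge0//; lra.
have q2 : 0 <= 8 * C * sigma by rewrite !mulr_ge0// ltW.
have D0 : 4 <= D by rewrite /D; lra.
pose rho := D^-1; have rho0 : 0 < rho by rewrite invr_gt0; lra.
have rhoD : rho * D = 1 by rewrite mulVf//; lra.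
have rhole c : 0 <= c -> c <= D -> rho * c <= 1.
  by move=> c0 cD; rewrite -rhoD ler_wpM2l// ltW.
have rho1 : rho * 4 <= 1 by exact: rhole.
have rho2 : rho * ((C + B) * (16 * n1)) <= 1 by apply: rhole => //; rewrite /D; lra.
have rho3 : rho * (8 * C * sigma) <= 1 by apply: rhole => //; rewrite /D; lra.
(* The first bound keeps the minimizer and the Newton step within rho / 2 each, so that the new
   point is still a competitor; the second lets [tangent] apply to P^-1 h. *)
pose r := Num.min (rho / (8 * sigma)) (r1 / (2 * n1)).
have r0 : 0 < r by rewrite lt_min !divr_gt0//; lra.
have r_rho : 8 * sigma * r <= rho.
  by rewrite mulrC -ler_pdivlMr ?ge_min ?lexx//; lra.
have r_r1 : 2 * n1 * r <= r1.
  by rewrite mulrC -ler_pdivlMr ?ge_min ?lexx ?orbT//; lra.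
exists r, (4 * sigma); split=> //; first by lra.
have CBrho : (C + B) * rho <= eta.
  by rewrite -[leRHS]mul1r -ler_pdivrMr// invrK mulrC -!mulrA mulrCA; lra.
have eta2 : eta <= 1 / 16 by rewrite div1r lef_pV2 ?posrE//; lra.
have eta_half : eta <= 1 / 2 by lra.
have eta_le1 : eta <= 1 by lra.
have sigr : sigma * r <= rho / 2 by lra.
have sig4r : 4 * sigma * r <= rho / 2 by lra.
have rho_half : rho / 2 <= 1 by lra.
have rho_sigma : C * rho * sigma <= 1 / 4 by lra.
have n1_ge0 : 0 <= 2 * n1 by lra.
have kap4 : 0 <= 4 * kap * n1 by rewrite !mulr_ge0//; lra.
have sigma4 : 0 < 4 * sigma by lra.
have sigmaE : sigma = 4 * kap * n1 + 1 by [].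
have n1E : n1 = nrm (1 : M) + 1 by [].
have BE : \sum_(i < d) nrm (b i) = B by [].
clearbody r rho D eta sigma B n1.
move=> h Lh hr; set e := nrm (h - 1) in hr *.
have e0 : 0 <= e := nrm_ge0 _.
pose sn (t : 'rV[R]_d) := l1norm (ext t) d.
pose P (t : 'rV[R]_d) := mexp_prod b (ext t) d.
pose f t := nrm (h - P t) + (4 * sigma)^-1 * sn t.
pose A0 := [set t | sn t <= rho].
have sn_cont (t : 'rV[R]_d) : sn u @[u --> t] --> sn t.
  apply: (@cvg_sum_real R _ (nbhs t) (nbhs_filter t) _
    (fun (i : 'I_d) u => `|ext u i|) (fun i : 'I_d => `|ext t i|)).
  by move=> i; apply: cvg_norm; exact: ext_continuous.
have f_cont (t : 'rV[R]_d) : f u @[u --> t] --> f t.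
  have h1 : nrm (h - P u) @[u --> t] --> nrm (h - P t).
    refine (@mconv_nrm R N _ (nbhs t) _ (fun u => h - P u) _ _).
    by apply: mconvB; [exact: mconv_cst|exact: mexp_prod_continuous].
  have h2 : (4 * sigma)^-1 * sn u @[u --> t] --> (4 * sigma)^-1 * sn t.
    exact: (cvgMl_tmp (sn_cont t)).
  exact: (cvgD h1 h2).
have sn0 : sn 0 = 0.
  by apply: big1 => i _; rewrite extE mxE normr0.
have mexp_prod0 (u : nat -> R) m : (forall k, u k = 0) -> mexp_prod b u m = 1.
  by move=> u0; elim: m => //= m ->; rewrite mul1r u0 scale0r mexp0.
have P0 : P 0 = 1.
  apply: mexp_prod0 => k; rewrite /ext.
  by case: insubP => // i _ _; rewrite mxE.
have cA0 : compact A0.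
  apply: bounded_closed_compact.
    exists rho; split; first by rewrite num_real.
    move=> x rx t /= tA; apply: (le_trans _ (ltW rx)); apply: le_trans tA.
    rewrite [leLHS]/Num.Def.normr/= mx_normrE (bigmax_le _ (l1norm_ge0 _ _))//= => -[i j] _.
    have -> : t i j = ext t j by rewrite extE ord1.
    by rewrite /sn /l1norm (bigD1 j)//= lerDl; exact: sumr_ge0.
  rewrite (_ : A0 = sn @^-1` [set x | x <= rho])//.
  apply: preimage_closed; last exact: closed_le.
  by move=> t _; exact: (sn_cont t).
have A00 : A0 !=set0 by exists 0; rewrite /A0 /= sn0 ltW.
have cfA : {within A0, continuous f} by apply: continuous_subspaceT => t; exact: f_cont.
have [t /set_mem tA tmin] := EVT_min_rV A00 cA0 cfA.
have PE u : P u = mexp_prod b (ext u) d by [].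
have snE u : sn u = l1norm (ext u) d by [].
have fE u : f u = nrm (h - P u) + (4 * sigma)^-1 * sn u by [].
clearbody f P sn.
clear rhole rhoD rho2 q1 q2 D0 D sn_cont f_cont cA0 A00 cfA.
have ft : f t <= e.
  by have := tmin 0 (mem_set _); rewrite (fE 0) sn0 P0 mulr0 addr0; apply; rewrite /A0 /= sn0 ltW.
have lam0 : 0 < (4 * sigma)^-1 by rewrite invr_gt0.
have st0 : 0 <= sn t by rewrite snE l1norm_ge0.
have snt : sn t <= 4 * sigma * e.
  rewrite mulrC -ler_pdivrMr//.
  by apply: le_trans ft; rewrite fE mulrC lerDr nrm_ge0.
have ye : nrm (h - P t) <= e.
  by apply: le_trans ft; rewrite fE lerDl mulr_ge0// ltW.
set y := h - P t in ye.
have sntr : sn t <= rho / 2.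
  by apply: le_trans snt (le_trans _ sig4r); rewrite ler_wpM2l// ltW.
have [y0|y0] := eqVneq y 0.
  by exists (ext t); [move/eqP: y0; rewrite /y subr_eq0 PE => /eqP|rewrite -snE].
exfalso; have yp : 0 < nrm y.
  by rewrite lt_def nrm_ge0 andbT; apply: contra y0 => /eqP/nrm_eq0/eqP.
have z1 : l1norm (ext t) d <= 1 by rewrite -snE; exact: le_trans rho_half.
have P1 : nrm (P t - 1) <= eta.
  have := strict 0 (ext t).
  have -> : l1norm (0 : nat -> R) d = 0 by rewrite /l1norm big1// => i _; exact: normr0.
  rewrite ler01 add0r !add0r => /(_ isT z1).
  rewrite (mexp_prod0 0)// -PE -snE => st1.
  have st2 := nrm_lincomb b (ext t) d; rewrite BE -snE in st2.
  rewrite -[X in nrm X](subrK (lincomb b (ext t) d)); apply: le_trans (nrmD _ _) _.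
  apply: le_trans CBrho; apply: (@le_trans _ _ ((C + B) * sn t)).
    rewrite mulrDl; apply: lerD => //; apply: (le_trans st1).
    by rewrite ler_piMr ?mulr_ge0// (le_trans sntr).
  by rewrite ler_wpM2l// (le_trans sntr)// ler_pdivrMr// ler_peMr ?ltW// ltr1n.
have LP : L (P t) by rewrite PE; exact: mexp_prod_in.
have [[Lu _ LM LV] _] := clL.
have uP := Lu _ LP; pose Q := invmx (P t).
have PQ : P t * Q = 1 by rewrite -mulmxE mulmxV.
have QP : Q * P t = 1 by rewrite -mulmxE mulVmx.
have nQ : nrm Q <= 2 * n1.
  apply: le_trans (nrm_inv_near1 PQ _) _; first exact: le_trans P1 eta_half.
  by rewrite n1E mulrDr lerDl mulr1.
pose x := Q * h - 1.
have nx : nrm x <= 2 * n1 * nrm y.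
  have -> : x = Q * y by rewrite /x /y mulrBr QP.
  by apply: le_trans (nrmM _ _) _; rewrite ler_wpM2r// nrm_ge0.
have n1y : 2 * n1 * nrm y <= r1.
  by apply: le_trans r_r1; rewrite ler_wpM2l ?(le_trans ye).
have LQh : L (Q * h) by apply: LM => //; exact: LV.
have [A gA hA] := tangent _ LQh (le_trans nx n1y).
have [s sA snA] := coordP A gA.
have nA : nrm A <= 2 * nrm x.
  rewrite -[A](subKr x); apply: le_trans (nrmB _ _) _.
  rewrite mulr2n mulrDl mul1r lerD2l; apply: (le_trans hA).
  by rewrite ler_piMl ?nrm_ge0.
have sy : l1norm s d <= sigma * nrm y.
  apply: (le_trans snA); rewrite sigmaE mulrDl mul1r.
  apply: (@le_trans _ _ (4 * kap * n1 * nrm y)); last by rewrite lerDl nrm_ge0.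
  have -> : 4 * kap * n1 * nrm y = kap * (2 * (2 * n1 * nrm y)) by ring.
  by rewrite ler_wpM2l// (le_trans nA)// ler_wpM2l.
have s0 := l1norm_ge0 s d.
have s_half : l1norm s d <= rho / 2.
  apply: (le_trans sy); apply: le_trans sigr.
  by rewrite ler_wpM2l ?(ltW sigma0)// (le_trans ye).
pose t' : 'rV[R]_d := \row_i (ext t i + s i).
have t'E : forall i : 'I_d, ext t' i = (ext t + s) i.
  by move=> i; rewrite extE mxE.
have snt' : sn t' <= sn t + l1norm s d.
  by rewrite !snE (le_trans _ (l1normD _ _ _))// /l1norm; apply: ler_sum => i _; rewrite t'E.
have Pt' : P t' = mexp_prod b (ext t + s) d.
  by rewrite PE; apply: mexp_prod_ext => m md; exact: (t'E (Ordinal md)).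
have t'A : A0 t'.
  by rewrite /A0 /=; apply: (le_trans snt'); rewrite [rho]splitr lerD.
have := tmin _ (mem_set t'A); rewrite leNgt !fE => /negP; apply.
apply: decrease => //; last by rewrite (le_trans snt')// lerD2l.
apply: (newton_step_error PQ QP nQ (ltW eta0) eta1 P1 hA).
have z2 : l1norm s d <= 1 by exact: le_trans s_half rho_half.
have := strict _ _ z1 z2; rewrite -sA -Pt' -PE -snE => /le_trans; apply.
apply: (@le_trans _ _ (C * rho * (sigma * nrm y))).
  apply: ler_pM => //; first by rewrite mulr_ge0 ?addr_ge0.
  by rewrite ler_wpM2l// [rho]splitr lerD.
rewrite mulrA [leRHS](_ : _ = 1 / 4 * nrm y); first by rewrite ler_wpM2r ?nrm_ge0.
by rewrite mul1r mulrC.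
Qed.

End LocalSurjectivity.

(** * Rank one symmetric spaces *)

Section Antiderivative.
Context {R : realType}.

Lemma continuous_antiderivative (f : R -> R) : continuous f ->
  exists F : R -> R, forall t : R, 0 <= t <= 1 -> is_derive t (1 : R) F (f t).
Proof.
move=> cf.
(* On this larger interval 0 and 1 are interior points, where the derivative of the integral is
   two-sided. *)
have fi : (@lebesgue_measure R).-integrable `[-1, 2] (EFin \o f).
  apply: continuous_compact_integrable; first exact: segment_compact.
  exact: continuous_subspaceT.
exists (fun x => \int[lebesgue_measure]_(s in `[-1, x]) f s)%R => t /andP[t0 t1].
have [||dF F'] := @continuous_FTC1_closed R f (-1) t 2 _ fi _ (cf t); first by lra.
  by lra.
by apply: DeriveDef; [exact: dF|rewrite -derive1E; exact: F'].
Qed.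

Lemma Rintegral01 (f F : R -> R) : continuous f ->
  (forall t : R, 0 <= t <= 1 -> is_derive t (1 : R) F (f t)) ->
  (\int[lebesgue_measure]_(t in `[0, 1]) f t = F 1 - F 0)%R.
Proof.
move=> cf dF; rewrite /Rintegral (@continuous_FTC2 R f F 0 1)//.
- exact: continuous_subspaceT.
- have cF (t : R) : 0 <= t <= 1 -> {for t, continuous F}.
    by move=> /dF[/derivable1_diffP/differentiable_continuous].
  split.
  + by move=> t; rewrite in_itv /= => /andP[t0 t1]; case: (dF t); rewrite ?ltW.
  + by apply: cvg_at_right_filter; apply: cF; rewrite lexx ler01.
  + by apply: cvg_at_left_filter; apply: cF; rewrite lexx ler01.
- move=> t; rewrite in_itv /= => /andP[t0 t1].
  by rewrite derive1E; case: (dF t); rewrite ?ltW.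
Qed.

End Antiderivative.

Section MatrixInverse.
Context {R : realType} {N : nat}.
Local Notation M := 'M[R]_N.

Lemma invmxM (A B : M) : A \in unitmx -> B \in unitmx ->
  invmx (A * B) = invmx B * invmx A.
Proof.
move=> uA uB; have uAB : A *m B \in unitmx by rewrite unitmx_mul uA.
rewrite -[RHS]mulr1 (_ : 1 = A * B * invmx (A * B)); last by rewrite -!mulmxE mulmxV.
by rewrite -!mulmxE !mulmxA -(mulmxA (invmx B)) mulVmx// mulmx1 mulVmx// mul1mx.
Qed.

(** The inverses of the [S i] are eventually bounded, because [invmx A * S i] is close to 1; the
    difference of inverses is then controlled by S i - A. *)
Lemma mconv_inv (I : Type) (F : set_system I) {FF : ProperFilter F} (S : I -> M) (A : M) :
  mconv F S A -> A \in unitmx -> (forall i, S i \in unitmx) ->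
  mconv F (fun i => invmx (S i)) (invmx A).
Proof.
move=> SA uA uS; apply/mconvP.
have VA : mconv F (fun i => invmx A * S i) 1.
  have -> : 1 = invmx A * A by rewrite -mulmxE mulVmx.
  by apply: mconvM => //; exact: mconv_cst.
have bnd : \forall i \near F, nrm (invmx (S i)) <= 2 * nrm (1 : M) * nrm (invmx A).
  have /mconvP/cvgrPdist_le/(_ (1 / 2)) h := VA; have {}h := h ltac:(lra).
  apply: filterS h => i; rewrite sub0r normrN (ger0_norm (nrm_ge0 _)) => hi.
  have e1 : (invmx A * S i) * (invmx (S i) * A) = 1.
    by rewrite mulrA -(mulrA (invmx A)) -!mulmxE mulmxV// mulmx1 mulVmx.
  have -> : invmx (S i) = invmx (S i) * A * invmx A by rewrite -!mulmxE mulmxK.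
  by rewrite (le_trans (nrmM _ _))// ler_wpM2r ?nrm_ge0// (nrm_inv_near1 e1).
set K := 2 * _ * _ in bnd.
have /mconvP SA0 := SA.
apply: (@squeeze_cvgr _ F _ _ (fun=> 0) (fun i => K * nrm (invmx A) * nrm (S i - A))).
- apply: filterS bnd => i bi; rewrite nrm_ge0 /=.
  have -> : invmx (S i) - invmx A = invmx (S i) * (A - S i) * invmx A.
    by rewrite mulrBr mulrBl -!mulmxE mulmxK// mulVmx// mul1mx.
  apply: le_trans (nrmM _ _) _; rewrite mulrAC; apply: ler_wpM2r; first exact: nrm_ge0.
  apply: le_trans (nrmM _ _) _; rewrite nrmBC; apply: ler_wpM2r => //.
  exact: nrm_ge0.
- exact: cvg_cst.
- by rewrite -[X in _ --> X](mulr0 (K * nrm (invmx A))); exact: cvgMl_tmp.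
Qed.

End MatrixInverse.

(** * Paths and distances in L / K *)

Section HomogeneousSpace.
Context {R : realType} {N : nat}.
Local Notation M := 'M[R]_N.
Implicit Types A B C : M.
Variables (L K : set M) (g : {vspace M}) (q : M -> M -> R).
Variables (X : pmetricType R) (pr : M -> X).
Hypothesis clL : closed_linear_group L.
Hypothesis Lg : is_lie_algebra_of L g.
Hypothesis qlin : forall a A B C, q (a *: A + B) C = a * q A C + q B C.
Hypothesis qsym : forall A B, q A B = q B A.
Hypothesis qpos : forall A, A \in g -> 0 <= q A A.
Hypothesis hom : homogeneous_riemannian L K q pr.

Let L1 : L 1. Proof. by case: clL => -[]. Qed.
Let LM A B : L A -> L B -> L (A * B). Proof. by case: clL => -[_ _ h _] _; exact: h. Qed.
Let LV A : L A -> L (invmx A). Proof. by case: clL => -[_ _ _ h] _; exact: h. Qed.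
Let Lu A : L A -> A \in unitmx. Proof. by case: clL => -[h _ _ _] _; exact: h. Qed.

Lemma biform0 B : q 0 B = 0.
Proof. by have := qlin 1 0 0 B; rewrite scale1r addr0 mul1r; lra. Qed.

Lemma biformZ a A B : q (a *: A) B = a * q A B.
Proof. by have := qlin a A 0 B; rewrite addr0 biform0 addr0. Qed.

Lemma biformD A B C : q (A + B) C = q A C + q B C.
Proof. by have := qlin 1 A B C; rewrite scale1r mul1r. Qed.

Lemma biform_sum (I : Type) (r : seq I) (F : I -> M) B :
  q (\sum_(i <- r) F i) B = \sum_(i <- r) q (F i) B.
Proof.
by elim: r => [|i r IH]; rewrite ?big_nil ?biform0// !big_cons biformD IH.
Qed.

Lemma biform_bound : exists2 Q : R, 0 <= Q & forall A B, `|q A B| <= Q * nrm A * nrm B.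
Proof.
pose D i j : M := delta_mx i j.
exists (\sum_i \sum_j \sum_k \sum_l `|q (D i j) (D k l)|).
  by do 4?(apply: sumr_ge0 => ? _).
have half A B : `|q A B| <= (\sum_i \sum_j `|q (D i j) B|) * nrm A.
  rewrite {1}[A]matrix_sum_delta biform_sum (le_trans (ler_norm_sum _ _ _))// mulr_suml.
  apply: ler_sum => i _; rewrite biform_sum (le_trans (ler_norm_sum _ _ _))// mulr_suml.
  by apply: ler_sum => j _; rewrite biformZ normrM mulrC ler_wpM2l// nrm_entry.
move=> A B; rewrite mulrAC (le_trans (half A B))// ler_wpM2r ?nrm_ge0//.
rewrite mulr_suml; apply: ler_sum => i _; rewrite mulr_suml; apply: ler_sum => j _.
by rewrite qsym (le_trans (half _ _))// ler_wpM2r ?nrm_ge0//;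
  apply: ler_sum => k _; apply: ler_sum => l _; rewrite qsym.
Qed.

Lemma biform_cvg (I : Type) (F : set_system I) {FF : ProperFilter F} (S : I -> M) A :
  mconv F S A -> q (S i) (S i) @[i --> F] --> q A A.
Proof.
move=> SA; have [Q Q0 qQ] := biform_bound.
have SA0 : nrm (S i - A) @[i --> F] --> (0 : R) by apply/mconvP.
have Sn : nrm (S i) @[i --> F] --> nrm A by exact: mconv_nrm.
have d0 : (q (S i) (S i) - q A A) @[i --> F] --> (0 : R).
  have bnd : Q * nrm (S i - A) * (nrm (S i) + nrm A) @[i --> F] --> (0 : R).
    rewrite -[X in _ --> X](_ : Q * 0 * (nrm A + nrm A) = 0); last by rewrite mulr0 mul0r.
    by apply: cvgM; [exact: cvgMl_tmp|apply: cvgD => //; exact: cvg_cst].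
  have h i : - (Q * nrm (S i - A) * (nrm (S i) + nrm A)) <= q (S i) (S i) - q A A
       <= Q * nrm (S i - A) * (nrm (S i) + nrm A).
    rewrite -ler_norml.
    have -> : q (S i) (S i) - q A A = q (S i - A) (S i) + q (S i - A) A.
      have := biformD (S i - A) A (S i); have := biformD (S i - A) A A.
      by rewrite subrK (qsym (S i) A); lra.
    by rewrite (le_trans (ler_normD _ _))// mulrDr lerD.
  apply: (@squeeze_cvgr _ F _ _ (fun i => - (Q * nrm (S i - A) * (nrm (S i) + nrm A)))
    (fun i => Q * nrm (S i - A) * (nrm (S i) + nrm A))) => //.
    by near=> i; exact: h.
  by rewrite -oppr0; exact: cvgN.
have dc : ((q (S i) (S i) - q A A) + q A A) @[i --> F] --> 0 + q A A.
  by apply: cvgD => //; exact: cvg_cst.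
by move: dc; rewrite add0r; under eq_fun do rewrite subrK.
Unshelve. all: by end_near. Qed.

Definition velocity (c : R -> M) (t : R) : M := invmx (c t) * derive1 c t.
Definition speed (c : R -> M) (t : R) : R :=
  Num.sqrt (q (velocity c t) (velocity c t)).

Lemma mderiv_derive1 (c : R -> M) t A : mderiv c t A -> derive1 c t = A.
Proof. by move=> /mderiv_is_derive[_ dE]; rewrite derive1E; exact: dE. Qed.

Lemma mderiv_derivable (c : R -> M) t A : mderiv c t A -> derivable c t 1.
Proof. by move=> /mderiv_is_derive[d _]; exact: d. Qed.

Lemma C1_path_mderiv c t : C1_path L c -> mderiv c t (derive1 c t).
Proof.
move=> [_ dc _]; apply/mderiv_is_derive; apply: DeriveDef; first exact: dc.
by rewrite derive1E.
Qed.

Lemma mconv_of_cvg (I : Type) (F : set_system I) {FF : ProperFilter F} (S : I -> M) A :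
  S @ F --> A -> mconv F S A.
Proof.
move=> SA i j; have := @coord_continuous R N N i j A.
exact: (@cvg_comp _ _ _ S (fun B : M => B i j) F _ _ SA).
Qed.

Lemma mderiv_mconv (c : R -> M) t A : mderiv c t A -> mconv (nbhs t) c (c t).
Proof.
by move=> dc i j; case: (dc i j) => /derivable1_diffP/differentiable_continuous.
Qed.

(** The curve s |-> c(t)^-1 c(s + t) stays in L, passes through 1 at s = 0 and has this derivative
    there. *)
Lemma velocity_in c t : C1_path L c -> velocity c t \in g.
Proof.
move=> Cc; have [Lc _ _] := Cc; apply/Lg.
exists (fun s => invmx (c t) * c (1 * s + t)); split.
- by move=> s; apply: LM => //; exact: LV.
- by rewrite mulr0 add0r -mulmxE mulVmx// Lu.
- apply/mderiv_is_derive.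
  have e : is_derive (0 : R) (1 : R) (fun s : R => 1 * s + t) 1.
    have -> : (fun s : R => 1 * s + t) = id + cst t by apply/funext => s; rewrite mul1r.
    by apply: is_derive_eq; rewrite addr0.
  have d1 : mderiv (fun=> invmx (c t)) 0 0.
    by move=> i j; rewrite mxE; exact: is_derive_cst.
  have d2 : mderiv c (1 * 0 + t) (derive1 c t).
    by rewrite mulr0 add0r; exact: C1_path_mderiv.
  have := mderivM d1 (mderiv_comp e d2).
  by rewrite scale1r mul0r add0r.
Qed.

Lemma speed_continuous c : C1_path L c -> continuous (speed c).
Proof.
move=> Cc t; have [Lc _ dc] := Cc.
have qc : q (velocity c s) (velocity c s) @[s --> t] --> q (velocity c t) (velocity c t).
  refine (@biform_cvg _ (nbhs t) _ (velocity c) _ _).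
  apply: mconvM; last by apply: mconv_of_cvg; exact: dc.
  apply: mconv_inv; [exact: mderiv_mconv (C1_path_mderiv t Cc)|exact: Lu|].
  by move=> s; exact: Lu.
exact: (@cvg_comp _ _ _ _ Num.sqrt _ _ _ qc (@sqrt_continuous R _)).
Qed.

Lemma affine_continuous (D : R -> M) (a b : R) : continuous D ->
  continuous (fun t : R => a *: D (a * t + b)).
Proof.
move=> cD t.
have es : (a * s + b) @[s --> t] --> a * t + b.
  by apply: cvgD; [apply: cvgMl_tmp; exact: cvg_id|exact: cvg_cst].
have c1 : D (a * s + b) @[s --> t] --> D (a * t + b).
  exact: (cvg_comp _ _ es (cD (a * t + b))).
have c2 : mconv (nbhs t) (fun s => D (a * s + b)) (D (a * t + b)).
  exact: mconv_of_cvg.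
refine (@mconv_cvg R N _ (nbhs t) _ _ _ _) => i j; rewrite mxE.
have -> : (fun s => (a *: D (a * s + b)) i j) = (fun s => a * D (a * s + b) i j).
  by apply/funext => s; rewrite mxE.
by refine (cvgMl_tmp _); exact: c2.
Qed.

Lemma C1_path_affine c a b : C1_path L c -> C1_path L (fun s => c (a * s + b)).
Proof.
move=> Cc; have [Lc _ cd] := Cc.
have e t : is_derive t (1 : R) (fun s : R => a * s + b) a.
  have -> : (fun s : R => a * s + b) = a *: id + cst b by [].
  by apply: is_derive_eq; rewrite addr0 /GRing.scale /= mulr1.
have d t : mderiv (fun s => c (a * s + b)) t (a *: derive1 c (a * t + b)).
  exact: mderiv_comp (e t) (C1_path_mderiv _ Cc).
split; [move=> t; exact: Lc|move=> t; exact: mderiv_derivable (d t)|].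
have -> : derive1 (fun s => c (a * s + b)) = fun t => a *: derive1 c (a * t + b).
  by apply/funext => t; exact: mderiv_derive1 (d t).
exact: affine_continuous cd.
Qed.

Lemma velocity_affine c a b t : C1_path L c ->
  velocity (fun s => c (a * s + b)) t = a *: velocity c (a * t + b).
Proof.
move=> Cc; rewrite /velocity.
have e : is_derive t (1 : R) (fun s : R => a * s + b) a.
  have -> : (fun s : R => a * s + b) = a *: id + cst b by [].
  by apply: is_derive_eq; rewrite addr0 /GRing.scale /= mulr1.
have d := mderiv_derive1 (mderiv_comp e (C1_path_mderiv _ Cc)).
by rewrite [X in _ * X]d -!mulmxE -scalemxAr.
Qed.

Lemma dist_le_length c h h' : L h -> L h' -> C1_path L c -> pr (c 0) = pr h ->
  pr (c 1) = pr h' -> mdist (pr h) (pr h') <= path_length q c.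
Proof.
move=> Lh Lh' Cc c0 c1; have [_ _ _ ->//] := hom.
apply: ge_inf; last by exists c.
exists 0 => _ [c' _ <-]; apply: Rintegral_ge0 => t _; exact: sqrtr_ge0.
Qed.

(** F is the arc length of c up to a constant. The distance only involves paths parametrized by
    [0, 1], so the piece of c between a and b is first reparametrized affinely. *)
Lemma path_potential c : C1_path L c -> exists F : R -> R,
  [/\ forall t : R, 0 <= t <= 1 -> is_derive t (1 : R) F (speed c t),
      path_length q c = F 1 - F 0 &
      forall a b, 0 <= a -> a <= b -> b <= 1 ->
        mdist (pr (c a)) (pr (c b)) <= F b - F a].
Proof.
move=> Cc; have [Lc _ _] := Cc; have cs := speed_continuous Cc.
have [F dF] := continuous_antiderivative cs; exists F; split=> //.
  by rewrite /path_length (Rintegral01 (F := F) cs).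
move=> a b a0 ab b1; pose c' s := c ((b - a) * s + a).
have Cc' : C1_path L c' by exact: C1_path_affine.
apply: (le_trans (@dist_le_length c' (c a) (c b) _ _ Cc' _ _)) => //.
- by rewrite /c' mulr0 add0r.
- by rewrite /c' mulr1 subrK.
have E := @Rintegral01 R (speed c') (fun s => F ((b - a) * s + a))
  (speed_continuous Cc').
suff /E e : forall t : R, 0 <= t <= 1 ->
    is_derive t (1 : R) (fun s => F ((b - a) * s + a)) (speed c' t).
  by rewrite mulr0 mulr1 add0r subrK in e; rewrite -e.
move=> t /andP[t0 t1].
have e : is_derive t (1 : R) (fun s : R => (b - a) * s + a) (b - a).
  have -> : (fun s : R => (b - a) * s + a) = (b - a) *: id + cst a by [].
  by apply: is_derive_eq; rewrite addr0 /GRing.scale /= mulr1.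
have rng : 0 <= (b - a) * t + a <= 1 by apply/andP; split; nra.
have := @is_derive1_comp R F (fun s => (b - a) * s + a) t _ _ (dF _ rng) e.
rewrite /comp.
congr (is_derive _ _ _ _); rewrite /speed velocity_affine//.
rewrite biformZ qsym biformZ mulrA -expr2 sqrtrM ?sqr_ge0// sqrtr_sqr ger0_norm ?subr_ge0//.
by rewrite mulrC.
Qed.

(** Left translation of a path by h leaves its velocity unchanged, hence its length. *)
Lemma mdist_prM h h1 h2 : L h -> L h1 -> L h2 ->
  mdist (pr (h * h1)) (pr (h * h2)) <= mdist (pr h1) (pr h2).
Proof.
move=> Lh Lh1 Lh2; have [_ prE ne distE] := hom; rewrite [leRHS]distE//.
have prM a b : L a -> L b -> pr a = pr b -> pr (h * a) = pr (h * b).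
  move=> La Lb /prE Kab; apply/prE; [exact: LM|exact: LM|].
  have -> : invmx (h * a) *m (h * b) = invmx a *m b; last exact: Kab.
  have ua := Lu La; have uh := Lu Lh.
  by rewrite invmxM// -!mulmxE !mulmxA -(mulmxA (invmx a)) mulVmx// mulmx1.
apply: lb_le_inf.
  have [c Pc] := ne _ _ Lh1 Lh2; exists (path_length q c); by exists c.
move=> _ [c [Cc [c0 c1]] <-]; have [Lc _ dc] := Cc.
have d t : mderiv (fun s => h * c s) t (h * derive1 c t).
  have d1 : mderiv (fun=> h) t 0 by move=> i j; rewrite mxE; exact: is_derive_cst.
  by have := mderivM d1 (C1_path_mderiv t Cc); rewrite mul0r add0r.
have dE : derive1 (fun s => h * c s) = fun t => h * derive1 c t.
  by apply/funext => t; exact: mderiv_derive1 (d t).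
have Chc : C1_path L (fun s => h * c s).
  split; [move=> t; exact: LM|move=> t; exact: mderiv_derivable (d t)|].
  rewrite dE => t; refine (@mconv_cvg R N _ (nbhs t) _ _ _ _).
  apply: mconvM; first exact: mconv_cst.
  by apply: mconv_of_cvg; exact: dc.
have -> : path_length q c = path_length q (fun s => h * c s).
  apply: eq_Rintegral => t _.
  have -> : invmx (h * c t) *m (fun s => h * c s)^`()%classic t = invmx (c t) *m derive1 c t.
    have uc := Lu (Lc t); have uh := Lu Lh.
    by rewrite dE invmxM// -!mulmxE !mulmxA -(mulmxA (invmx (c t))) mulVmx// mulmx1.
  by [].
by apply: dist_le_length; [exact: LM|exact: LM|exact: Chc|apply: prM|apply: prM].
Qed.

(** The path s |-> h exp(s A) has constant velocity A. *)
Lemma mdist_mexp h A : L h -> A \in g ->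
  mdist (pr h) (pr (h * mexp A)) <= Num.sqrt (q A A).
Proof.
move=> Lh gA; pose c s := h * mexp (s *: A).
have d t : mderiv c t (c t * A).
  have d1 : mderiv (fun=> h) t 0 by move=> i j; rewrite mxE; exact: is_derive_cst.
  have := mderivM d1 (mexp_deriv A t); rewrite mul0r add0r mexp_comm mulrA.
  by [].
have dE : derive1 c = fun t => c t * A.
  by apply/funext => t; exact: mderiv_derive1 (d t).
have Lc t : L (c t) by apply: LM => //; apply: (mexp_lie_algebra clL Lg); exact: memvZ.
have Cc : C1_path L c.
  split; [exact: Lc|move=> t; exact: mderiv_derivable (d t)|].
  rewrite dE => t; refine (@mconv_cvg R N _ (nbhs t) _ _ _ _).
  apply: mconvM; last exact: mconv_cst.
  exact: mderiv_mconv (d t).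
apply: (le_trans (@dist_le_length c _ _ Lh _ Cc _ _)).
- by rewrite -[A]scale1r; exact: (Lc 1).
- by rewrite /c scale0r mexp0 mulr1.
- by rewrite /c scale1r.
rewrite /path_length (_ : (fun t => _) = cst (Num.sqrt (q A A))).
  by rewrite Rintegral_cst//= lebesgue_measure_itv/= lte_fin ltr01 sube0 /= mulr1.
apply/funext => t /=; rewrite dE.
have uc := Lu (Lc t).
by rewrite -!mulmxE mulmxA mulVmx// mul1mx.
Qed.

Lemma mdist_mexp_prod h t n : L h ->
  mdist (pr h) (pr (h * mexp_prod (lie_basis g) t n)) <=
  (\sum_(i < n) Num.sqrt (q (lie_basis g i) (lie_basis g i))) * l1norm t n.
Proof.
move=> Lh; pose sg i := Num.sqrt (q (lie_basis g i) (lie_basis g i)).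
suff : mdist (pr h) (pr (h * mexp_prod (lie_basis g) t n)) <=
  (\sum_(i < n) sg i) * l1norm t n by [].
elim: n => [|n IH] /=; first by rewrite mulr1 mdistxx big_ord0 mul0r.
have gb : lie_basis g n \in g.
  rewrite /lie_basis; have [ng|gn] := ltnP n (\dim g).
    by apply: vbasis_mem; rewrite mem_nth// size_tuple.
  by rewrite nth_default ?mem0v// size_tuple.
have LP : L (h * mexp_prod (lie_basis g) t n) by apply: LM => //; exact: mexp_prod_in.
have step := mdist_mexp LP (memvZ (t n) gb).
rewrite biformZ qsym biformZ mulrA -expr2 sqrtrM ?sqr_ge0// sqrtr_sqr -mulrA in step.
apply: le_trans (metric_triangle _ _ _) (le_trans (lerD IH step) _).
rewrite l1normS big_ord_recr /= mulrDl.
have S0 : 0 <= \sum_(i < n) sg i by apply: sumr_ge0 => i _; exact: sqrtr_ge0.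
have s0 : 0 <= sg n by exact: sqrtr_ge0.
have := l1norm_ge0 t n; have := normr_ge0 (t n); rewrite -/(sg n).
by nra.
Qed.

(** Since distances are infima over paths of L, an h that is close to 1 as a matrix must be joined
    to 1 by a short path inside L. The exponentials of [local_coordinates] provide one. *)
Lemma pr_near1 eps : 0 < eps -> exists2 r, 0 < r &
  forall h, L h -> nrm (h - 1) <= r -> mdist (pr 1) (pr h) <= eps.
Proof.
move=> eps0; have [r [K0 [r0 K00 coordP]]] := local_coordinates clL Lg.
pose S := \sum_(i < \dim g) Num.sqrt (q (lie_basis g i) (lie_basis g i)).
have S0 : 0 <= S by apply: sumr_ge0 => i _; exact: sqrtr_ge0.
have SK : 0 <= S * K0 by exact: mulr_ge0.
exists (Num.min r (eps / (S * K0 + 1))).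
  by rewrite lt_min r0 divr_gt0//; lra.
move=> h Lh; rewrite le_min => /andP[hr he].
have [t hE tn] := coordP h Lh hr.
rewrite hE -[mexp_prod _ _ _]mul1r (le_trans (mdist_mexp_prod t _ L1))// -/S.
apply: (@le_trans _ _ (S * (K0 * nrm (h - 1)))); first by rewrite ler_wpM2l.
rewrite mulrA (@le_trans _ _ ((S * K0) * (eps / (S * K0 + 1))))//.
  by rewrite ler_wpM2l.
rewrite mulrA ler_pdivrMr; last by lra.
by nra.
Qed.

End HomogeneousSpace.

(** * A form invariant under K *)

Section InvariantForm.
Context {R : realType} {N : nat}.
Local Notation M := 'M[R]_N.
Implicit Types A B C : M.

Definition fro A : R := \sum_i \sum_j A i j ^+ 2.

Lemma fro_ge0 A : 0 <= fro A.
Proof. by apply: sumr_ge0 => i _; apply: sumr_ge0 => j _; exact: sqr_ge0. Qed.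

Lemma fro_trE A : fro A = \tr (A * A^T).
Proof.
by apply: eq_bigr => i _; rewrite mxE; apply: eq_bigr => j _; rewrite mxE expr2.
Qed.

Lemma fro_entry A i j : A i j ^+ 2 <= fro A.
Proof.
rewrite /fro (bigD1 i)//= (bigD1 j)//= -addrA lerDl addr_ge0//.
  by apply: sumr_ge0 => k _; exact: sqr_ge0.
by apply: sumr_ge0 => k _; apply: sumr_ge0 => l _; exact: sqr_ge0.
Qed.

Lemma fro_le_nrm A : fro A <= nrm A ^+ 2.
Proof.
rewrite expr2 {1}/nrm mulr_suml; apply: ler_sum => i _; rewrite mulr_suml.
apply: ler_sum => j _; rewrite -real_normK ?num_real// expr2.
by rewrite ler_wpM2l// nrm_entry.
Qed.

Lemma nrm_le_fro A : nrm A ^+ 2 <= (N * N)%:R ^+ 2 * fro A.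
Proof.
have nA : nrm A <= (N * N)%:R * Num.sqrt (fro A).
  apply: (@le_trans _ _ (\sum_(i < N) \sum_(j < N) Num.sqrt (fro A))).
    apply: ler_sum => i _; apply: ler_sum => j _.
    by rewrite -sqrtr_sqr ler_wsqrtr// fro_entry.
  by rewrite !sumr_const !card_ord -mulrnA mulr_natl.
rewrite -[X in _ * X]sqr_sqrtr ?fro_ge0// -exprMn.
by rewrite lerXn2r// nnegrE ?nrm_ge0// mulr_ge0// sqrtr_ge0.
Qed.

Lemma fro_eq0 A : fro A <= 0 -> A = 0.
Proof.
move=> A0; apply/matrixP => i j; rewrite mxE; apply/eqP; rewrite -sqrf_eq0.
by rewrite eq_le sqr_ge0 andbT (le_trans (fro_entry A i j)).
Qed.

Lemma fro_parallelogram A B :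
  fro (2^-1 *: (A + B)) = 2^-1 * fro A + 2^-1 * fro B - 4^-1 * fro (A - B).
Proof.
rewrite /fro !mulr_sumr -big_split -sumrB; apply: eq_bigr => i _ /=.
rewrite !mulr_sumr -big_split -sumrB; apply: eq_bigr => j _ /=.
by rewrite !mxE; field.
Qed.

Lemma fro_cvg (I : Type) (F : set_system I) {FF : ProperFilter F} (S : I -> M) A :
  mconv F S A -> fro (S i) @[i --> F] --> fro A.
Proof.
move=> SA; rewrite /fro.
refine (cvg_sum_real _) => i; refine (cvg_sum_real _) => j.
by under eq_fun do rewrite expr2; rewrite expr2; exact: cvgM (SA i j) (SA i j).
Qed.

Lemma tr_cvg (I : Type) (F : set_system I) {FF : ProperFilter F} (S : I -> M) A :
  mconv F S A -> \tr (S i) @[i --> F] --> \tr A.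
Proof. by move=> SA; refine (cvg_sum_real _) => i; exact: SA. Qed.

Lemma compact_nrm_bounded (K : set M) : compact K ->
  exists2 C : R, 1 <= C & forall A, K A -> nrm A <= C.
Proof.
move=> /compact_bounded[B [_ BK]].
exists ((N * N)%:R * (`|B| + 1) + 1).
  by rewrite lerDr mulr_ge0// addr_ge0.
move=> A KA; have AB : `|A| <= `|B| + 1.
  by apply: BK => //; rewrite (le_lt_trans (ler_norm B))// ltrDl.
rewrite (@le_trans _ _ ((N * N)%:R * (`|B| + 1)))// ?lerDl//.
apply: (@le_trans _ _ (\sum_(i < N) \sum_(j < N) (`|B| + 1))).
  apply: ler_sum => i _; apply: ler_sum => j _; apply: le_trans AB.
  rewrite [leRHS]/Num.Def.normr/= mx_normrE.
  exact: (le_bigmax _ (fun ij : 'I_N * 'I_N => `|A ij.1 ij.2|) (i, j)).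
by rewrite !sumr_const !card_ord -mulrnA mulr_natl.
Qed.

(* The K-invariant form minimizes the largest Frobenius norm of its K-orbit,
   and such a minimizer is unique by the parallelogram law. *)
Lemma invariant_form (K : set M) : linear_group K -> compact K ->
  exists S : M, exists2 m : R, 0 < m &
    (forall k, K k -> k * S * k^T = S) /\
    (forall Y : M, m * fro Y <= \tr (Y * S * Y^T)).
Proof.
move=> [Ku K1 KM KV] cK; have [C C1 KC] := compact_nrm_bounded cK.
have C0 : 0 <= C by exact: le_trans C1.
pose n4 : R := (N * N)%:R ^+ 2; have n40 : 0 <= n4 by rewrite exprn_ge0.
have KVr k : K k -> k * invmx k = 1 by move=> Kk; rewrite -mulmxE mulmxV// Ku.
have KVl k : K k -> invmx k * k = 1 by move=> Kk; rewrite -mulmxE mulVmx// Ku.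
have act_nrm k (D : M) : K k -> nrm (k * D * k^T) <= C * nrm D * C.
  move=> Kk; apply: le_trans (nrmM _ _) _.
  rewrite nrm_trmx ler_pM ?nrm_ge0 ?KC//.
  by apply: le_trans (nrmM _ _) _; rewrite ler_wpM2r ?nrm_ge0// KC.
have actK k (D : M) : K k -> invmx k * (k * D * k^T) * (invmx k)^T = D.
  move=> Kk; rewrite -!mulmxE !mulmxA mulVmx ?Ku// mul1mx -mulmxA -trmx_mul.
  by rewrite mulVmx ?Ku// trmx1 mulmx1.
pose c := (n4 * C ^+ 4 + 1)^-1.
have c0 : 0 < c by rewrite invr_gt0 ltr_wpDl// mulr_ge0// exprn_ge0.
have act_fro k D : K k -> c * fro D <= fro (k * D * k^T).
  move=> Kk; rewrite mulrC ler_pdivrMr ?ltr_wpDl ?mulr_ge0 ?exprn_ge0//.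
  rewrite -{1}(actK k D Kk).
  set E := k * D * k^T.
  apply: le_trans (fro_le_nrm _) _.
  have h1 : nrm (invmx k * E * (invmx k)^T) <= C * nrm E * C by apply: act_nrm; exact: KV.
  apply: (@le_trans _ _ ((C * nrm E * C) ^+ 2)).
    by rewrite lerXn2r// nnegrE ?nrm_ge0// !mulr_ge0 ?nrm_ge0.
  rewrite (_ : _ ^+ 2 = C ^+ 4 * nrm E ^+ 2); last by ring.
  apply: (@le_trans _ _ (C ^+ 4 * (n4 * fro E))).
    by rewrite ler_wpM2l ?exprn_ge0// nrm_le_fro.
  by have := fro_ge0 E; set u := C ^+ 4; nra.
pose m := (n4 * C ^+ 2 + 1)^-1.
have m0 : 0 < m by rewrite invr_gt0 ltr_wpDl// mulr_ge0// exprn_ge0.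
(* Positivity is imposed with one constant m along the whole orbit, so that it survives limits and
   midpoints. *)
pose pos (S : M) := forall k, K k -> forall Y : M,
  m * fro Y <= \tr (Y * (k * S * k^T) * Y^T).
pose bnd (S : M) r := forall k, K k -> fro (k * S * k^T) <= r.
pose V := [set r | exists S, pos S /\ bnd S r].
have V0 : V !=set0.
  exists ((C * nrm (1 : M) * C) ^+ 2), 1; split.
    move=> k Kk Y; rewrite mulr1 -!mulmxE !mulmxA -mulmxA -trmx_mul mulmxE -fro_trE.
    rewrite mulrC ler_pdivrMr ?ltr_wpDl ?mulr_ge0 ?exprn_ge0//.
    set E := Y * k; have -> : Y = E * invmx k by rewrite -mulmxE mulmxK// Ku.
    apply: le_trans (fro_le_nrm _) _.
    have h1 : nrm (E * invmx k) <= nrm E * C.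
      by apply: le_trans (nrmM _ _) _; rewrite ler_wpM2l ?nrm_ge0// KC//; exact: KV.
    apply: (@le_trans _ _ ((nrm E * C) ^+ 2)).
      by rewrite lerXn2r// nnegrE ?nrm_ge0// !mulr_ge0 ?nrm_ge0.
    rewrite exprMn; have := nrm_le_fro E; have := fro_ge0 E; have := sqr_ge0 C.
    rewrite -/n4; set u := C ^+ 2; set v := nrm E ^+ 2; set w := fro E => u0 w0 vw.
    have : v * u <= n4 * w * u by rewrite ler_wpM2r.
    nra.
  move=> k Kk; apply: le_trans (fro_le_nrm _) _.
  by rewrite lerXn2r// ?nnegrE ?nrm_ge0 ?mulr_ge0 ?nrm_ge0// act_nrm.
have Vlb : lbound V 0.
  move=> r [S [_ bS]]; exact: le_trans (fro_ge0 _) (bS 1 K1).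
pose r := inf V.
have hinf : has_inf V by split=> //; exists 0.
have near_ n : exists S, pos S /\ bnd S (r + n.+1%:R^-1).
  have n0 : 0 < (n.+1%:R^-1 : R) by rewrite invr_gt0.
  have [s [S [pS bS]] sr] := inf_adherent n0 hinf.
  by exists S; split=> // k Kk; exact: le_trans (bS k Kk) (ltW sr).
have [S SP] := choice near_.
have [G [UG sG]] := ultraFilterLemma (@eventually_filter).
have PG : ProperFilter G by exact: ultra_proper.
have Sb : \forall n \near G, nrm (S n) <= n4 * (r + 1) + 1.
  apply: sG; exists 0%N => // n _ /=.
  have [_ /(_ 1 K1)] := SP n; rewrite mul1r trmx1 mulr1 => fS.
  have n1 : n.+1%:R^-1 <= 1 :> R by rewrite invf_le1// ler1n.
  have := nrm_le_fro (S n); have := nrm_ge0 (S n); rewrite -/n4.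
  have : n4 * fro (S n) <= n4 * (r + 1) by rewrite ler_wpM2l// (le_trans fS)// lerD2l.
  by nra.
have [S0 SS0 _] := ultra_mconv UG Sb.
have actc k : mconv G (fun n => k * S n * k^T) (k * S0 * k^T).
  by apply: mconvM; [apply: mconvM => //|]; exact: mconv_cst.
have pS0 : pos S0.
  move=> k Kk Y.
  have cv : \tr (Y * (k * S n * k^T) * Y^T) @[n --> G] --> \tr (Y * (k * S0 * k^T) * Y^T).
    apply: tr_cvg; apply: mconvM; last exact: mconv_cst.
    by apply: mconvM => //; exact: mconv_cst.
  rewrite -(cvg_lim (@Rhausdorff R) cv); apply: limr_ge; first exact: cvgP cv.
  by apply: sG; exists 0%N => // n _ /=; have [h _] := SP n; exact: h.
have bS0 : bnd S0 r.
  move=> k Kk; have cv : fro (k * S n * k^T) @[n --> G] --> fro (k * S0 * k^T).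
    by apply: fro_cvg; exact: actc.
  have cr : r + n.+1%:R^-1 @[n --> G] --> r.
    rewrite -[X in _ --> X]addr0; apply: cvgD; first exact: cvg_cst.
    have h : harmonic n @[n --> \oo] --> (0 : R) by exact: cvg_harmonic.
    by apply: cvg_trans h => P /=; exact: sG.
  refine (ler_cvg_to cv cr _).
  by apply: sG; exists 0%N => // n _ /=; have [_ h] := SP n; exact: h.
have uniq_ S1 S2 : pos S1 -> bnd S1 r -> pos S2 -> bnd S2 r -> S1 = S2.
  move=> p1 b1 p2 b2; apply/eqP; rewrite -subr_eq0; apply/eqP.
  have actD k (D1 D2 : M) a : k * (a *: (D1 + D2)) * k^T = a *: (k * D1 * k^T + k * D2 * k^T).
    by rewrite -!mulmxE -scalemxAr -scalemxAl mulmxDr mulmxDl.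
  (* The midpoint of two minimizers is admissible and beats the infimum r by the parallelogram
     defect, which [act_fro] bounds below uniformly on the orbit. *)
  have Vmid : V (r - 4^-1 * (c * fro (S1 - S2))).
    exists (2^-1 *: (S1 + S2)); split.
      move=> k Kk Y; rewrite actD -!mulmxE -scalemxAr -scalemxAl.
      rewrite mulmxDr mulmxDl mxtraceZ mxtraceD.
      have := p1 k Kk Y; have := p2 k Kk Y; rewrite -!mulmxE; lra.
    move=> k Kk; rewrite actD fro_parallelogram.
    have -> : k * S1 * k^T - k * S2 * k^T = k * (S1 - S2) * k^T.
      by rewrite mulrBr mulrBl.
    have := b1 k Kk; have := b2 k Kk; have := act_fro k (S1 - S2) Kk; lra.
  have := ge_inf (ex_intro _ 0 Vlb) Vmid; rewrite -/r => le.
  apply: fro_eq0; have f0 : c * fro (S1 - S2) <= 0 by lra.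
  by rewrite -(pmulr_rle0 _ c0).
exists S0, m => //; split.
  (* The matrix k S0 k^T has the same K-orbit as S0, hence is a minimizer too. *)
  move=> k Kk; apply: uniq_ => //.
    move=> k' Kk' Y; have := pS0 _ (KM _ _ Kk' Kk) Y.
    by rewrite trmx_mul -!mulmxE !mulmxA.
  move=> k' Kk'; have := bS0 _ (KM _ _ Kk' Kk).
  by rewrite trmx_mul -!mulmxE !mulmxA.
by move=> Y; have := pS0 1 K1 Y; rewrite mul1r trmx1 mulr1.
Qed.

End InvariantForm.

(** * Linear maps that vanish on k *)

Section FormControl.
Context {R : realType} {N : nat}.
Local Notation M := 'M[R]_N.
Implicit Types A B C : M.

Lemma linear_nrm_bound (f : {linear M -> M}) :
  exists2 C : R, 0 <= C & forall A, nrm (f A) <= C * nrm A.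
Proof.
exists (\sum_i \sum_j nrm (f (delta_mx i j))).
  by apply: sumr_ge0 => i _; apply: sumr_ge0 => j _; exact: nrm_ge0.
move=> A; rewrite {1}[A]matrix_sum_delta linear_sum /=.
rewrite (le_trans (nrm_sum _))// mulr_suml; apply: ler_sum => i _.
rewrite linear_sum /= (le_trans (nrm_sum _))// mulr_suml; apply: ler_sum => j _.
by rewrite linearZ /= nrmZ mulrC ler_wpM2l ?nrm_ge0// nrm_entry.
Qed.

Lemma vspace_mconv (U : {vspace M}) (I : Type) (F : set_system I)
    {FF : ProperFilter F} (S : I -> M) A :
  (forall i, S i \in U) -> mconv F S A -> A \in U.
Proof.
move=> SU SA; have [C C0 fC] := linear_nrm_bound (projv U).
have e : mconv F S (projv U A).
  apply/mconvP.
  have SA0 : nrm (S i - A) @[i --> F] --> (0 : R) by apply/mconvP.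
  apply: (@squeeze_cvgr _ F _ _ (fun=> 0) (fun i => C * nrm (S i - A))).
  - apply: filterS (@filterT _ F _) => i _.
    by rewrite nrm_ge0 /= -{1}(projv_id (SU i)) -linearB /= fC.
  - exact: cvg_cst.
  - by rewrite -[X in _ --> X](mulr0 C); exact: cvgMl_tmp.
by rewrite (mconv_unique SA e) memv_proj.
Qed.

Variables (g k : {vspace M}) (q : M -> M -> R).
Hypothesis qlin : forall a A B C, q (a *: A + B) C = a * q A C + q B C.
Hypothesis qsym : forall A B, q A B = q B A.
Hypothesis qpos : forall A, A \in g -> 0 <= q A A.
Hypothesis qnull : forall A, A \in g -> (q A A = 0 <-> A \in k).
Hypothesis kg : (k <= g)%VS.

(** As q A A = 0, the value of q at B + t A is affine in t; being nonnegative for all t, it has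
    slope 0. *)
Lemma form_null A B : A \in k -> B \in g -> q A B = 0.
Proof.
move=> kA gB; have gA := subvP kg _ kA; have qA := (qnull gA).2 kA.
have pos (t : R) : 0 <= q B B + 2 * t * q A B.
  have /qpos : B + t *: A \in g by rewrite memvD// memvZ.
  rewrite (biformD qlin) (biformZ qlin) (qsym B) (qsym A (B + _)) !(biformD qlin).
  rewrite !(biformZ qlin) qA (qsym B A); lra.
apply/eqP/negPn/negP => q0; have := pos (- (q B B + 1) / (2 * q A B)).
by rewrite mulrAC mulrCA divff ?mulf_neq0// ?mulr1; have := qpos gB; lra.
Qed.

(** Compactness of the unit sphere of a complement of k in g: a limit of unit vectors on which q
    tends to 0 would lie both in k and in the complement. *)
Lemma form_nondegenerate : exists2 c : R, 0 < c &
  forall A, A \in (g :\: k)%VS -> c * nrm A ^+ 2 <= q A A.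
Proof.
apply: contrapT => H.
have bad n : exists A, [/\ A \in (g :\: k)%VS, nrm A = 1 & q A A <= n.+1%:R^-1].
  apply: contrapT => H'; apply: H; exists n.+1%:R^-1; first by rewrite invr_gt0.
  move=> A wA; have gA : A \in g by apply: subvP wA; exact: diffvSl.
  have [A0|A0] := eqVneq (nrm A) 0; first by rewrite A0 expr0n mulr0 qpos.
  rewrite leNgt; apply/negP => lt; apply: H'.
  have nA : 0 < nrm A by rewrite lt_def A0 nrm_ge0.
  exists ((nrm A)^-1 *: A); split; first exact: memvZ.
    by rewrite nrmZ ger0_norm ?invr_ge0 ?nrm_ge0// mulVf.
  rewrite (biformZ qlin) qsym (biformZ qlin) mulrA -expr2 exprVn mulrC ler_pdivrMr ?exprn_gt0//.
  exact: ltW.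
have [A AP] := choice bad.
have [G [UG sG]] := ultraFilterLemma (@eventually_filter).
have PG : ProperFilter G by exact: ultra_proper.
have nA : \forall n \near G, nrm (A n) <= 1.
  by apply: sG; exists 0%N => // n _ /=; case: (AP n) => _ -> _.
have [B AB _] := ultra_mconv UG nA.
have wB : B \in (g :\: k)%VS.
  by apply: (vspace_mconv _ AB) => n; case: (AP n).
have gB : B \in g by apply: subvP wB; exact: diffvSl.
have nB : nrm B = 1.
  have cv : nrm (A n) @[n --> G] --> nrm B by exact: mconv_nrm.
  rewrite -(cvg_lim (@Rhausdorff R) cv) (_ : (fun n => nrm (A n)) = cst 1).
    exact: lim_cst.
  by apply/funext => n; case: (AP n).
have qB : q B B <= 0.
  have cv : q (A n) (A n) @[n --> G] --> q B B by exact: (biform_cvg qlin qsym).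
  have cr : harmonic n @[n --> G] --> (0 : R).
    have h : harmonic n @[n --> \oo] --> (0 : R) by exact: cvg_harmonic.
    by apply: cvg_trans h => P /=; exact: sG.
  refine (ler_cvg_to cv cr _).
  by apply: sG; exists 0%N => // n _ /=; case: (AP n).
have kB : B \in k by apply/(qnull gB)/eqP; rewrite eq_le qB qpos.
have : B \in ((g :\: k) :&: k)%VS by rewrite memv_cap wB.
rewrite capv_diff memv0 => /eqP B0.
by move: nB; rewrite B0 nrm0 => /eqP; rewrite eq_sym oner_eq0.
Qed.

(** Both f and q factor through g / k, where q is positive definite. *)
Lemma form_control (f : {linear M -> M}) : (forall A, A \in k -> f A = 0) ->
  exists2 C : R, 0 <= C & forall A, A \in g -> nrm (f A) <= C * Num.sqrt (q A A).
Proof.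
move=> fk; have [c c0 qc] := form_nondegenerate.
have [C C0 fC] := linear_nrm_bound f.
exists (C * Num.sqrt c^-1); first by rewrite mulr_ge0// sqrtr_ge0.
move=> A gA.
have : A \in (g :\: k + k)%VS.
  by rewrite addv_diff; apply: subvP gA; exact: addvSl.
move=> /memv_addP[B wB [D kD AE]].
have gB : B \in g by apply: subvP wB; exact: diffvSl.
have -> : f A = f B by rewrite AE linearD /= (fk D kD) addr0.
have -> : q A A = q B B.
  have gD := subvP kg _ kD.
  rewrite AE (biformD qlin) (qsym B) (qsym D) !(biformD qlin) (qsym B D).
  by rewrite (form_null kD gB) (form_null kD gD) !addr0.
rewrite (le_trans (fC B))// -mulrA ler_wpM2l//.
have <- : Num.sqrt (c^-1 * q B B) = Num.sqrt c^-1 * Num.sqrt (q B B).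
  by rewrite sqrtrM// invr_ge0 ltW.
rewrite -[leLHS]ger0_norm ?nrm_ge0// -sqrtr_sqr.
by rewrite ler_wsqrtr// mulrC ler_pdivlMr// mulrC qc.
Qed.

End FormControl.

(** * Properness and almost geodesics of L / K *)

Section SymmetricSpace.
Context {R : realType} {N : nat}.
Local Notation M := 'M[R]_N.
Implicit Types A B C : M.
Variables (L K : set M) (g k : {vspace M}) (q : M -> M -> R).
Variables (X : pmetricType R) (pr : M -> X).
Hypothesis clL : closed_linear_group L.
Hypothesis Lg : is_lie_algebra_of L g.
Hypothesis lgK : linear_group K.
Hypothesis cK : compact K.
Hypothesis KL : K `<=` L.
Hypothesis Kk : is_lie_algebra_of K k.
Hypothesis qlin : forall a A B C, q (a *: A + B) C = a * q A C + q B C.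
Hypothesis qsym : forall A B, q A B = q B A.
Hypothesis qpos : forall A, A \in g -> 0 <= q A A.
Hypothesis qnull : forall A, A \in g -> (q A A = 0 <-> A \in k).
Hypothesis hom : homogeneous_riemannian L K q pr.

Let L1 : L 1. Proof. by case: clL => -[]. Qed.
Let LM A B : L A -> L B -> L (A * B). Proof. by case: clL => -[_ _ h _] _; exact: h. Qed.
Let LV A : L A -> L (invmx A). Proof. by case: clL => -[_ _ _ h] _; exact: h. Qed.
Let Lu A : L A -> A \in unitmx. Proof. by case: clL => -[h _ _ _] _; exact: h. Qed.

Let kg : (k <= g)%VS.
Proof.
apply/subvP => A /Kk[c [Kc c0 dc]]; apply/Lg; exists c; split=> // t.
exact: KL.
Qed.

Lemma mderiv_trmx (c : R -> M) t A : mderiv c t A -> mderiv (fun s => (c s)^T) t A^T.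
Proof.
move=> dc i j; rewrite mxE; under eq_fun do rewrite mxE; exact: dc.
Qed.

Lemma mderiv_unique (c : R -> M) t A B : mderiv c t A -> mderiv c t B -> A = B.
Proof. by move=> /mderiv_derive1 <- /mderiv_derive1 <-. Qed.

Lemma mderiv_form (c : R -> M) S t A : mderiv c t A ->
  mderiv (fun s => c s * S * (c s)^T) t (A * S * (c t)^T + c t * S * A^T).
Proof.
move=> dc.
have dS : mderiv (fun=> S) t 0 by move=> i j; rewrite mxE; exact: is_derive_cst.
have := mderivM (mderivM dc dS) (mderiv_trmx dc).
by rewrite mulr0 addr0.
Qed.

(** The derivative at h = 1 of h S h^T in the direction A. It vanishes on k when S is invariant
    under K. *)
Let lam (S : M) (A : M) : M := A *m S + S *m A^T.

Let lam_is_linear S : linear (lam S).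
Proof.
move=> a A B; rewrite /lam linearP /= mulmxDl mulmxDr -scalemxAl -scalemxAr.
by rewrite scalerDr addrACA.
Qed.

HB.instance Definition _ S := GRing.isLinear.Build R M M _ (lam S) (lam_is_linear S).

Lemma mderiv_tr (c : R -> M) t A : mderiv c t A ->
  is_derive t (1 : R) (fun s => \tr (c s)) (\tr A).
Proof.
move=> dc; rewrite (_ : (fun s => _) = \sum_(i < N) (fun s => c s i i)).
  exact: is_derive_sum.
by apply/funext => s; rewrite fct_sumE.
Qed.

Lemma nrm_tr A : `|\tr A| <= nrm A.
Proof.
rewrite (le_trans (ler_norm_sum _ _ _))//; apply: ler_sum => i _.
by rewrite (bigD1 i)//= lerDl sumr_ge0.
Qed.

(* For the K-invariant form S, u = tr (c S c^T) descends to L / K and satisfies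
   |u'| <= C1 speed u along a path c, hence is bounded in terms of its length. *)
Lemma ball_bounded (rho : R) : exists B : R, forall h, L h ->
  mdist (pr 1) (pr h) <= rho -> nrm h <= B.
Proof.
have [S [m m0 [KS Spos]]] := invariant_form lgK cK.
have lam0 A : A \in k -> lam S A = 0.
  move=> /Kk[c [Kc c0 /mderiv_is_derive dc]].
  have := mderiv_form S dc; rewrite c0 (_ : (fun s => _) = cst S); last first.
    by apply/funext => s; exact: KS.
  have dS : mderiv (cst S) 0 0 by move=> i j; rewrite mxE; exact: is_derive_cst.
  move=> /mderiv_unique/(_ dS); rewrite trmx1.
  by rewrite -!mulmxE mulmx1 mul1mx.
have [C C0 fC] := form_control qlin qsym qpos qnull kg (f := lam S) lam0.
pose n4 : R := (N * N)%:R ^+ 2; have n40 : 0 <= n4 by rewrite exprn_ge0.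
pose C1 := n4 / m * C.
have C10 : 0 <= C1 by rewrite mulr_ge0// divr_ge0// ltW.
pose E := \tr S * expR (C1 * (rho + 1)).
exists (n4 * (m^-1 * E) + 1) => h Lh hrho.
have [_ prE ne distE] := hom.
have hinf : has_inf [set path_length q c | c in
   [set c | C1_path L c /\ pr (c 0) = pr 1 /\ pr (c 1) = pr h]].
  split; first by have [c Pc] := ne _ _ L1 Lh; exists (path_length q c), c.
  by exists 0 => _ [c _ <-]; apply: Rintegral_ge0 => t _; exact: sqrtr_ge0.
have [_ [c [Cc [c0 c1]] <-] lc] := inf_adherent ltr01 hinf.
rewrite -distE// in lc; have [Lc _ _] := Cc.
have [F [dF FE _]] := path_potential clL qlin qsym hom Cc.
have Sinv h1 h2 : L h1 -> L h2 -> pr h1 = pr h2 ->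
    \tr (h1 * S * h1^T) = \tr (h2 * S * h2^T).
  move=> Lh1 Lh2 /(prE _ _ Lh1 Lh2)/KS e.
  rewrite -[in LHS]e -!mulmxE trmx_mul !mulmxA mulmxV ?Lu// mul1mx.
  by rewrite -!mulmxA -!trmx_mul mulmxV ?Lu// mul1mx !mulmxA.
pose u t := \tr (c t * S * (c t)^T).
have dc t := mderiv_form S (C1_path_mderiv t Cc).
have du t := mderiv_tr (dc t).
have u_ge0 t : m * fro (c t) <= u t by exact: Spos.
have sp t : \tr (derive1 c t * S * (c t)^T + c t * S * (derive1 c t)^T) <=
    C1 * speed q c t * u t.
  have e : derive1 c t = c t * velocity c t.
    by rewrite /velocity -!mulmxE mulmxA mulmxV ?Lu// mul1mx.
  have -> : derive1 c t * S * (c t)^T + c t * S * (derive1 c t)^T =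
      c t * lam S (velocity c t) * (c t)^T.
    by rewrite e /lam -!mulmxE trmx_mul mulmxDr mulmxDl !mulmxA.
  apply: (le_trans (ler_norm _)); apply: (le_trans (nrm_tr _)).
  apply: le_trans (nrmM _ _) _; rewrite nrm_trmx.
  apply: (@le_trans _ _ (nrm (c t) * nrm (lam S (velocity c t)) * nrm (c t))).
    by rewrite ler_wpM2r ?nrm_ge0// nrmM.
  have vg := velocity_in clL Lg t Cc; have := fC _ vg; rewrite -/(speed q c t) => hl.
  rewrite mulrAC -expr2.
  apply: (@le_trans _ _ ((n4 * (m^-1 * u t)) * (C * speed q c t))).
    apply: ler_pM; rewrite ?exprn_ge0 ?nrm_ge0//.
    apply: le_trans (nrm_le_fro _) _; rewrite ler_wpM2l//.
    by rewrite mulrC ler_pdivlMr// mulrC.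
  by rewrite le_eqVlt; apply/orP; left; apply/eqP; rewrite /C1; ring.
clearbody C1.
(* Gronwall's argument: F' is the speed, so the bound [sp] on u' makes w nonincreasing. *)
pose w t := u t * expR (- C1 * F t).
have dw (t : R) : 0 <= t <= 1 -> is_derive t (1 : R) w
    (expR (- C1 * F t) * (\tr (derive1 c t * S * (c t)^T + c t * S * (derive1 c t)^T)
      - C1 * speed q c t * u t)).
  move=> t01.
  have dCF : is_derive t (1 : R) (fun s => - C1 * F s) (- C1 * speed q c t).
    have -> : (fun s => - C1 * F s) = (- C1) *: F by [].
    by have := dF t t01 => dFt; apply: is_derive_eq.
  have de := @is_derive1_comp R (@expR R) (fun s => - C1 * F s) t _ _
    (is_derive_expR (- C1 * F t)) dCF.
  have := is_deriveM (du t) de; congr (is_derive _ _ _ _).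
  by rewrite /GRing.scale /= /comp; ring.
have w10 : w 1 <= w 0.
  apply: (@ler0_derive1_nincr R w 0 1 _ _ _ 0 1 (lexx _) ler01 (lexx _)).
  - move=> t; rewrite in_itv /= => /andP[t0 t1]; have t01 : 0 <= t <= 1 by rewrite !ltW.
    by case: (dw t t01).
  - move=> t; rewrite in_itv /= => /andP[t0 t1]; have t01 : 0 <= t <= 1 by rewrite !ltW.
    rewrite derive1E; case: (dw t t01) => _ ->.
    by rewrite pmulr_rle0 ?expR_gt0// subr_le0.
  - apply: derivable_within_continuous => t; rewrite in_itv /= => t01.
    by case: (dw t t01).
have u1 : u 1 <= u 0 * expR (C1 * (F 1 - F 0)).
  have := ler_wpM2r (expR_ge0 (C1 * F 1)) w10; rewrite /w -!mulrA -!expRD.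
  have -> : - C1 * F 1 + C1 * F 1 = 0 by ring.
  have -> : - C1 * F 0 + C1 * F 1 = C1 * (F 1 - F 0) by ring.
  by rewrite expR0 mulr1.
have u0 : u 0 = \tr S.
  by rewrite /u (Sinv _ 1 (Lc 0) L1 c0) trmx1 mul1r mulr1.
have trS : 0 <= \tr S.
  by rewrite -u0 (le_trans _ (u_ge0 0))// mulr_ge0 ?fro_ge0// ltW.
have uh : m * fro h <= E.
  apply: le_trans (Spos h) _; rewrite -(Sinv _ _ (Lc 1) Lh c1).
  apply: (le_trans u1); rewrite u0 ler_wpM2l// ler_expR ler_wpM2l//.
  by rewrite -FE; lra.
have hE : nrm h ^+ 2 <= n4 * (m^-1 * E).
  by apply: le_trans (nrm_le_fro _) _; rewrite ler_wpM2l// mulrC ler_pdivlMr// mulrC.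
by have := nrm_ge0 h; nra.
Qed.

(** L is closed only among invertible matrices, so limits also require bounded inverses. These come
    for free, since h^-1 moves the base point no farther than h does. *)
Lemma ball_bounded_inv (rho : R) : exists B : R, forall h, L h ->
  mdist (pr 1) (pr h) <= rho -> nrm h <= B /\ nrm (invmx h) <= B.
Proof.
have [B hB] := ball_bounded rho; exists B => h Lh hrho; split; first exact: hB.
apply: hB; first exact: LV.
have := mdist_prM clL hom (LV Lh) Lh L1.
rewrite (_ : invmx h * h = 1) ?mulr1 => [h'|]; last by rewrite -mulmxE mulVmx// Lu.
by apply: (le_trans h'); rewrite metric_sym.
Qed.

(** Lifts to L of the points of a ball converge along the ultrafilter together with their inverses,
    to some h1 in L. As h1^-1 times the lifts tends to 1, [pr_near1] turns this into convergence in
    X. *)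
Lemma symmetric_space_proper : proper_space X.
Proof.
have [surj _ _ _] := hom.
have lift y : exists h, L h /\ pr h = y.
  by have : [set: X] y by []; rewrite -surj => -[h Lh <-]; exists h.
have [s sP] := choice lift.
move=> x r; rewrite compact_ultra => G UG Gball.
have PG : ProperFilter G by exact: ultra_proper.
have [B hB] := ball_bounded_inv (mdist (pr 1) x + r).
have sB : \forall y \near G, nrm (s y) <= B /\ nrm (invmx (s y)) <= B.
  apply: filterS Gball => y /= xy; have [Ls sE] := sP y; apply: hB => //.
  by rewrite sE (le_trans (metric_triangle _ x _))// lerD2l.
have [h1 sh1 _] : exists2 h1, mconv G s h1 & nrm h1 <= B.
  by apply: ultra_mconv => //; apply: filterS sB => y [].
have [h2 sh2 _] : exists2 h2, mconv G (fun y => invmx (s y)) h2 & nrm h2 <= B.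
  by apply: ultra_mconv => //; apply: filterS sB => y [].
have h12 : h1 * h2 = 1.
  apply: (@mconv_unique _ _ _ G _ (fun y => s y * invmx (s y))).
    exact: mconvM.
  rewrite (_ : (fun y => _) = cst 1); first exact: mconv_cst.
  by apply/funext => y; have [Ls _] := sP y; rewrite -mulmxE mulmxV// Lu.
have uh1 : h1 \in unitmx by have := h12; rewrite -mulmxE => /mulmx1_unit[].
have Lh1 : L h1.
  have LsG : \forall y \near G, L (s y).
    by apply: filterS (@filterT _ G _) => y _; case: (sP y).
  exact: (closed_linear_group_lim clL PG LsG sh1 uh1).
have lim : mconv G (fun y => invmx h1 * s y) 1.
  have -> : 1 = invmx h1 * h1 by rewrite -mulmxE mulVmx.
  by apply: mconvM => //; exact: mconv_cst.
have cv e : 0 < e -> \forall y \near G, mdist (pr h1) y <= e.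
  move=> e0; have [d d0 dP] := pr_near1 clL Lg qlin qsym hom e0.
  have /mconvP/cvgrPdist_le/(_ _ d0) lim0 := lim.
  apply: filterS lim0 => y; rewrite sub0r normrN (ger0_norm (nrm_ge0 _)) => nd.
  have [Ls sE] := sP y; have LQ : L (invmx h1 * s y) by apply: LM => //; exact: LV.
  have := dP _ LQ nd; apply: le_trans.
  have := mdist_prM clL hom Lh1 L1 LQ.
  have e1 : h1 * invmx h1 = 1 by rewrite -mulmxE mulmxV.
  by rewrite mulr1 mulrA e1 mul1r sE.
exists (pr h1); split; last first.
  by apply/metricType_numDomainType.cvgrPdist_le.
rewrite /=; apply/ler_addgt0Pl => e e0.
have [y [/= xy h1y]] : exists y, ([set y | mdist x y <= r] `&` [set y | mdist (pr h1) y <= e]) y.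
  by apply: (@filter_ex _ G PG); apply: filterI => //; exact: cv.
by rewrite (le_trans (metric_triangle _ y _))// addrC lerD// metric_sym.
Qed.

(** A path whose length exceeds the distance by at most e, followed at unit speed, is almost
    geodesic: arc length bounds distances from above, and the triangle inequality loses at most e
    from below. *)
Lemma symmetric_space_almost_geodesic : almost_geodesic_space X RealTime.
Proof.
have [surj _ ne distE] := hom.
move=> x y e e0.
have [h1 Lh1 <-] : exists2 h, L h & pr h = x.
  by have : [set: X] x by []; rewrite -surj => -[h Lh <-]; exists h.
have [h2 Lh2 <-] : exists2 h, L h & pr h = y.
  by have : [set: X] y by []; rewrite -surj => -[h Lh <-]; exists h.
have hinf : has_inf [set path_length q c | c in
   [set c | C1_path L c /\ pr (c 0) = pr h1 /\ pr (c 1) = pr h2]].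
  split; first by have [c Pc] := ne _ _ Lh1 Lh2; exists (path_length q c), c.
  by exists 0 => _ [c _ <-]; apply: Rintegral_ge0 => t _; exact: sqrtr_ge0.
have [_ [c [Cc [c0 c1]] <-] lc] := inf_adherent e0 hinf.
rewrite -distE// in lc; have [Lc _ _] := Cc.
have [F [dF FE dist]] := path_potential clL qlin qsym hom Cc.
set D := mdist (pr h1) (pr h2) in lc *.
have DF : D <= F 1 - F 0.
  by rewrite /D -c0 -c1; apply: dist; rewrite ?ler01.
have cF : {within `[0, 1], continuous F}.
  apply: derivable_within_continuous => t; rewrite in_itv /= => t01.
  by case: (dF t t01).
(* The speed may vanish, so the arc length is not inverted but solved for by the intermediate value
   theorem. The value 0 is a dummy outside [0, D]. *)
have tau s : exists t : R, 0 <= s <= D -> 0 <= t <= 1 /\ F t = F 0 + s.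
  have [sD|sD] := boolP (0 <= s <= D); last by exists 0.
  have /andP[s0 s1] := sD.
  have F01 : F 0 <= F 1 by have := mdist_ge0 (pr h1) (pr h2); rewrite -/D; lra.
  have [|t] := @IVT R F 0 1 (F 0 + s) ler01 cF.
    by rewrite (min_idPl F01) (max_idPr F01); apply/andP; split; lra.
  by rewrite in_itv /= => t01 Ft; exists t.
have [f fP] := choice tau.
have mono s t : 0 <= s <= 1 -> 0 <= t <= 1 ->
    mdist (pr (c s)) (pr (c t)) <= `|F s - F t|.
  move=> /andP[s0 s1] /andP[t0 t1]; have [st|/ltW ts] := leP s t.
    by rewrite (le_trans (dist _ _ s0 st t1))// distrC ler_norm.
  by rewrite metric_sym (le_trans (dist _ _ t0 ts s1))// ler_norm.
have up a b : 0 <= a <= D -> 0 <= b <= D ->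
    mdist (pr (c (f a))) (pr (c (f b))) <= `|a - b|.
  move=> aD bD; have [fa Fa] := fP a aD; have [fb Fb] := fP b bD.
  by rewrite (le_trans (mono _ _ fa fb))// Fa Fb opprD addrACA subrr add0r.
have start a : 0 <= a <= D -> mdist (pr h1) (pr (c (f a))) <= a.
  move=> aD; have [fa Fa] := fP a aD; have /andP[fa0 fa1] := fa.
  by rewrite -c0 (le_trans (dist _ _ (lexx _) fa0 fa1))// Fa addrAC subrr add0r.
have fin a : 0 <= a <= D -> mdist (pr (c (f a))) (pr h2) <= D - a + e.
  move=> aD; have [fa Fa] := fP a aD; have /andP[fa0 fa1] := fa.
  by rewrite -c1 (le_trans (dist _ _ fa0 fa1 (lexx _)))// Fa; lra.
exists (fun s => pr (c (f s))) => s _ sD; have sD' := sD; have /andP[s0 s1] := sD'.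
have S1 := start s sD; have S2 := fin s sD.
have T1 := metric_triangle (pr h1) (pr (c (f s))) (pr h2); rewrite -/D in T1.
split.
- by rewrite ler_norml; apply/andP; split; lra.
- by rewrite ler_norml; apply/andP; split; lra.
- move=> t _ tD; have tD' := tD; have /andP[t0 t1] := tD'.
  have U1 := up s t sD tD; have S3 := start t tD; have S4 := fin t tD.
  have T2 := metric_triangle (pr h1) (pr (c (f s))) (pr (c (f t))).
  have T3 := metric_triangle (pr h1) (pr (c (f t))) (pr h2).
  have T4 := metric_triangle (pr h1) (pr (c (f t))) (pr (c (f s))).
  have T5 := metric_triangle (pr (c (f s))) (pr (c (f t))) (pr h2).
  have T6 := metric_triangle (pr (c (f t))) (pr (c (f s))) (pr h2).
  rewrite (metric_sym (pr (c (f t))) (pr (c (f s)))) in T4 T6.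
  rewrite -/D in T3; rewrite ler_norml; apply/andP; split; last by lra.
  by have [?|?] := ger0P (s - t); lra.
Qed.

End SymmetricSpace.

Lemma rank_one_lattice_proper (R : realType) (X : pmetricType R)
    (Gamma : groupType) (rho : isom_action Gamma X) :
  class_rank_one_lattice rho -> proper_space X /\ almost_geodesic_space X RealTime.
Proof.
move=> [N [G [Ad [L [K [g [k [p [q [pr [iota []]]]]]]]]]]].
move=> [[_ clL _ _ _] _ Lg _] [[lgK cK KL _] Kk _ _] [[qlin qsym qpos qnull _] hom] _ _.
split; first exact: (symmetric_space_proper clL Lg lgK cK KL Kk qlin qsym qpos qnull hom).
exact: (symmetric_space_almost_geodesic clL qlin qsym hom).
Qed.

Lemma class_C_hull_line (R : realType) (X : pmetricType R) (Gamma : groupType)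
    (rho : isom_action Gamma X) (T : time) :
  hyperbolic_space X -> discrete_action rho -> nonelementary rho -> class_C rho T ->
  exists2 c : R -> X, geodesic_line T c
    & forall t, times T t -> geodesic_hull rho T (c t).
Proof.
move=> hypX disc ne.
case: T => [[[propX [geoX _] _ _]|/rank_one_lattice_proper[propX ageo]]|cX].
- exact: (geodesic_hull_line hypX propX (geodesic_almost_geodesic geoX) ne).
- exact: (geodesic_hull_line hypX propX ageo ne).
- exact: (geodesic_hull_line hypX (hyperbolic_group_proper disc cX)
    (hyperbolic_group_almost_geodesic cX) ne).
Qed.

(** * The counting argument *)

Section FamilyOfFunctions.
Context (d : measure_display) (Y : measurableType d) (R : realType).
Variables (mu : {finite_measure set Y -> \bar R}) (D : set Y).
Hypothesis mD : measurable D.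
Context {I : eqType}.

Lemma ae_imply (P Q : Y -> Prop) : (forall v, P v -> Q v) ->
  {ae mu, forall v, P v} -> {ae mu, forall v, Q v}.
Proof. by move=> PQ; apply: filterS. Qed.

Lemma ae_imply2 (P Q S : Y -> Prop) : (forall v, P v -> Q v -> S v) ->
  {ae mu, forall v, P v} -> {ae mu, forall v, Q v} -> {ae mu, forall v, S v}.
Proof. by move=> PQS; apply: filterS2. Qed.

Lemma ae_le_integral_real (f g : Y -> R) : measurable_fun D f -> measurable_fun D g ->
  (forall v, 0 <= f v) -> {ae mu, forall v, D v -> f v <= g v} -> (forall v, 0 <= g v) ->
  (\int[mu]_(v in D) (f v)%:E <= \int[mu]_(v in D) (g v)%:E)%E.
Proof.
move=> mf mg f0 fg g0; apply: ae_ge0_le_integral => //.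
- by move=> v _; rewrite lee_fin.
- exact/measurable_EFinP.
- by move=> v _; rewrite lee_fin.
- exact/measurable_EFinP.
Qed.

Lemma ae_all_seq (s : seq I) (P : I -> Y -> Prop) :
  (forall i, i \in s -> {ae mu, forall v, P i v}) ->
  {ae mu, forall v, forall i, i \in s -> P i v}.
Proof.
elim: s => [|i s IH] sP; first by apply: aeW.
have h1 := sP i (mem_head _ _).
have h2 : {ae mu, forall v, forall j, j \in s -> P j v}.
  by apply: IH => j js; apply: sP; rewrite inE js orbT.
by apply: filterS2 h1 h2 => v Pi Ps j; rewrite inE => /predU1P[->//|]; exact: Ps.
Qed.

(** Cauchy-Schwarz for the weight [h i] bounds the square of the integral of [h i * f] by B times
    the integral of [h i * f ^+ 2]. In the sum over i the weights add up to at most F. The functions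
    f and g will be the real part and the opposite of the imaginary part of a unit vector. *)
Lemma schur_bound (s : seq I) (h : I -> Y -> R) (f g : Y -> R) (B F : R) :
  (forall i, measurable_fun D (h i)) -> (forall i v, 0 <= h i v) ->
  measurable_fun D f -> measurable_fun D g -> 0 < B -> 0 <= F ->
  {ae mu, forall v, D v -> \sum_(i <- s) h i v <= F} ->
  (forall i, i \in s -> (\int[mu]_(v in D) (h i v)%:E <= B%:E)%E) ->
  (\int[mu]_(v in D) (f v ^+ 2 + g v ^+ 2)%:E = 1)%E ->
  \sum_(i <- s) ((\int[mu]_(v in D) (h i v * f v)) ^+ 2
    + (\int[mu]_(v in D) (h i v * g v)) ^+ 2) <= B * F.
Proof.
move=> mh h0 mf mg B0 F0 sF hB fg1.
pose W i := (\int[mu]_(v in D) (h i v * (f v ^+ 2 + g v ^+ 2))%:E)%E.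
have mfg : measurable_fun D (fun v => f v ^+ 2 + g v ^+ 2).
  by apply: measurable_funD; exact: measurable_funX.
have W0 i : (0 <= W i)%E.
  by apply: integral_ge0 => v _; rewrite lee_fin mulr_ge0// addr_ge0 ?sqr_ge0.
have sumW : (\sum_(i <- s) W i <= F%:E)%E.
  rewrite /W -ge0_integral_sum//; last 2 first.
  - by move=> i; apply/measurable_EFinP; apply: measurable_funM.
  - by move=> i v _; rewrite lee_fin mulr_ge0// addr_ge0 ?sqr_ge0.
  rewrite -[leRHS]mule1 -fg1 -ge0_integralZl_EFin//; last 2 first.
  - by move=> v _; rewrite lee_fin addr_ge0 ?sqr_ge0.
  - exact/measurable_EFinP.
  apply: ae_ge0_le_integral => //.
  - by move=> v _; apply: sume_ge0 => i _; rewrite lee_fin mulr_ge0// addr_ge0 ?sqr_ge0.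
  - under eq_fun do rewrite sumEFin.
    by apply/measurable_EFinP; apply: measurable_sum => i; exact: measurable_funM.
  - by move=> v _; rewrite -EFinM lee_fin mulr_ge0// addr_ge0 ?sqr_ge0.
  - apply/measurable_EFinP; apply: measurable_funM => //; exact: measurable_cst.
  - apply: filterS sF => v hv Dv; rewrite sumEFin -EFinM lee_fin -mulr_suml.
    by rewrite ler_wpM2r ?hv// addr_ge0 ?sqr_ge0.
have Wfin i : i \in s -> (W i < +oo)%E.
  move=> si; apply: le_lt_trans (ltry F); apply: le_trans sumW.
  rewrite (big_rem i)//=; apply: leeDl; exact: sume_ge0.
have one i (e : Y -> R) : i \in s -> measurable_fun D e ->
    (forall v, e v ^+ 2 <= f v ^+ 2 + g v ^+ 2) ->
    (\int[mu]_(v in D) (h i v * e v)) ^+ 2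
       <= B * \int[mu]_(v in D) (h i v * e v ^+ 2).
  move=> si me efg.
  have ih : mu.-integrable D (EFin \o h i).
    apply/integrableP; split; first exact/measurable_EFinP.
    rewrite (eq_integral (fun v => (h i v)%:E)); last first.
      by move=> v _ /=; rewrite ger0_norm.
    by apply: le_lt_trans (hB i si) (ltry _).
  have ihe2 : mu.-integrable D (EFin \o (fun v => h i v * e v ^+ 2)).
    apply/integrableP; split.
      by apply/measurable_EFinP; apply: measurable_funM => //; exact: measurable_funX.
    apply: le_lt_trans (Wfin i si); apply: ge0_le_integral => //.
    - apply: measurableT_comp => //; apply/measurable_EFinP.
      by apply: measurable_funM => //; exact: measurable_funX.
    - by apply/measurable_EFinP; apply: measurable_funM.
    - move=> v _ /=; rewrite lee_fin ger0_norm; last by rewrite mulr_ge0 ?sqr_ge0.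
      by rewrite ler_wpM2l.
  have isum (l : R) : mu.-integrable D (EFin \o (fun v => l ^+ 2 * h i v + h i v * e v ^+ 2)).
    have -> : EFin \o (fun v => l ^+ 2 * h i v + h i v * e v ^+ 2) =
        (fun v => (l ^+ 2)%:E * (EFin \o h i) v)%E \+ (EFin \o (fun v => h i v * e v ^+ 2)).
      by apply/funext => v /=; rewrite -EFinM -EFinD.
    by apply: integrableD => //; exact: integrableZl.
  have ihe : mu.-integrable D (EFin \o (fun v => h i v * e v)).
    apply: (le_integrable mD _ _ (isum 1)).
      by apply/measurable_EFinP; exact: measurable_funM.
    move=> v _ /=; rewrite lee_fin expr1n mul1r normrM (ger0_norm (h0 _ _)).
    apply: le_trans (ler_norm _).
    rewrite -[X in _ <= X + _]mulr1 -mulrDr; apply: ler_wpM2l => //.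
    by rewrite -(real_normK (num_real (e v))); have := normr_ge0 (e v); nra.
  set a := (X in X ^+ _); set E := (X in _ <= _ * X).
  (* Cauchy-Schwarz comes from integrating h (l - e)^2 >= 0 and taking l = a / B. *)
  have key l : 2 * l * a <= l ^+ 2 * B + E.
    have h1 : 2 * l * a <= \int[mu]_(v in D) (l ^+ 2 * h i v + h i v * e v ^+ 2).
      rewrite /a -RintegralZl//; apply: le_Rintegral => //.
        have -> : EFin \o (fun v => 2 * l * (h i v * e v)) =
           (fun v => (2 * l)%:E * (EFin \o (fun v => (h i v * e v)%R)) v)%E.
          by apply/funext => v /=; rewrite -EFinM.
        exact: integrableZl.
      move=> v _; have -> : 2 * l * (h i v * e v) = h i v * (2 * l * e v) by ring.
      have -> : l ^+ 2 * h i v + h i v * e v ^+ 2 = h i v * (l ^+ 2 + e v ^+ 2) by ring.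
      by rewrite ler_wpM2l//; have := sqr_ge0 (l - e v); nra.
    apply: (le_trans h1); rewrite RintegralD//; last first.
      have -> : EFin \o (fun v => l ^+ 2 * h i v) =
           (fun v => (l ^+ 2)%:E * (EFin \o h i) v)%E.
        by apply/funext => v /=; rewrite -EFinM.
      exact: integrableZl.
    rewrite RintegralZl// lerD2r ler_wpM2l ?sqr_ge0//.
    rewrite -lee_fin /Rintegral fineK; first exact: hB.
    exact: (integrable_fin_num mD ih).
  have := key (a / B).
  have -> : 2 * (a / B) * a = 2 * (a ^+ 2 / B) by ring.
  have -> : (a / B) ^+ 2 * B = a ^+ 2 / B by field; rewrite gt_eqF.
  by move=> k; rewrite mulrC -ler_pdivrMr//; lra.
have both i : i \in s -> (((\int[mu]_(v in D) (h i v * f v)) ^+ 2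
    + (\int[mu]_(v in D) (h i v * g v)) ^+ 2)%:E <= B%:E * W i)%E.
  move=> si; have ile (e : Y -> R) : measurable_fun D e ->
      (forall v, e v ^+ 2 <= f v ^+ 2 + g v ^+ 2) ->
      mu.-integrable D (EFin \o (fun v => h i v * e v ^+ 2)).
    move=> me efg; apply/integrableP; split.
      by apply/measurable_EFinP; apply: measurable_funM => //; exact: measurable_funX.
    apply: le_lt_trans (Wfin i si); apply: ge0_le_integral => //.
    - apply: measurableT_comp => //; apply/measurable_EFinP.
      by apply: measurable_funM => //; exact: measurable_funX.
    - by apply/measurable_EFinP; apply: measurable_funM.
    - move=> v _ /=; rewrite lee_fin ger0_norm; last by rewrite mulr_ge0 ?sqr_ge0.
      by rewrite ler_wpM2l.
  have fle v : f v ^+ 2 <= f v ^+ 2 + g v ^+ 2 by rewrite lerDl sqr_ge0.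
  have gle v : g v ^+ 2 <= f v ^+ 2 + g v ^+ 2 by rewrite lerDr sqr_ge0.
  have -> : W i = (\int[mu]_(v in D) (h i v * f v ^+ 2)
      + \int[mu]_(v in D) (h i v * g v ^+ 2))%:E.
    rewrite -RintegralD//; [|exact: ile|exact: ile].
    rewrite /Rintegral fineK; last first.
      by apply: integrable_fin_num => //; have := integrableD mD (ile _ mf fle) (ile _ mg gle).
    by apply: eq_integral => v _; rewrite /= mulrDr.
  by rewrite -EFinM lee_fin mulrDr; apply: lerD; exact: one.
rewrite -lee_fin -sumEFin EFinM.
apply: (@le_trans _ _ (\sum_(i <- s) B%:E * W i)%E).
  by rewrite big_seq [leRHS]big_seq; apply: lee_sum => i; exact: both.
rewrite -ge0_sume_distrr; last by move=> i _; exact: W0.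
by rewrite lee_wpmul2l// lee_fin ltW.
Qed.

(** Integration of the pointwise bound: each [S i] contributes at least b times its weight to the
    left side. *)
Lemma weighted_packing_bound (s : seq I) (w : I -> R) (S : I -> set Y) (g : Y -> R) (K E b : R) :
  (forall i, 0 <= w i) -> (forall i, measurable (S i)) -> (forall i, S i `<=` D) ->
  (forall i, i \in s -> (b%:E <= mu (S i))%E) -> 0 < b -> 0 <= K ->
  measurable_fun D g -> (forall v, 0 <= g v) ->
  (\int[mu]_(v in D) (g v)%:E <= E%:E)%E ->
  {ae mu, forall v, D v -> \sum_(i <- s) w i * \1_(S i) v <= K * g v} ->
  \sum_(i <- s) w i <= K * E / b.
Proof.
move=> w0 mS SD bS b0 K0 mg g0 gE ae.
rewrite ler_pdivlMr// -lee_fin mulr_suml -sumEFin EFinM.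
have m1 i : measurable_fun D (fun v => (w i * \1_(S i) v)%:E).
  apply/measurable_EFinP; apply: measurable_funM; first exact: measurable_cst.
  exact: measurable_indic.
apply: (@le_trans _ _ (\int[mu]_(v in D) \sum_(i <- s) (w i * \1_(S i) v)%:E)%E).
  rewrite ge0_integral_sum//; last by move=> i v _; rewrite lee_fin mulr_ge0.
  rewrite big_seq [leRHS]big_seq; apply: lee_sum => i si.
  under eq_integral do rewrite EFinM.
  rewrite ge0_integralZl_EFin//; last first.
  - exact/measurable_EFinP/measurable_indic.
  rewrite integral_indic // (setIidl (SD i)) EFinM.
  by rewrite lee_wpmul2l ?lee_fin//; exact: bS.
apply: le_trans (_ : (_ <= K%:E * \int[mu]_(v in D) (g v)%:E)%E) _; last first.
  by rewrite lee_wpmul2l// lee_fin.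
rewrite -ge0_integralZl_EFin//; last 2 first.
- by move=> v _; rewrite lee_fin.
- exact/measurable_EFinP.
apply: ae_ge0_le_integral => //.
- by move=> v _; apply: sume_ge0 => i _; rewrite lee_fin mulr_ge0.
- by apply: emeasurable_sum.
- by move=> v _; rewrite -EFinM lee_fin mulr_ge0.
- apply/measurable_EFinP; apply: measurable_funM => //; exact: measurable_cst.
- by apply: filterS ae => v hv Dv; rewrite sumEFin -EFinM lee_fin hv.
Qed.

End FamilyOfFunctions.

Lemma seq_argmax (R : realType) (I : eqType) (f : I -> R) (i : I) s : exists2 j, j \in i :: s &
  forall k, k \in i :: s -> f k <= f j.
Proof.
elim: s i => [|k s IH] i.
  by exists i => [|k]; rewrite inE// => /eqP->.
have [j js jmax] := IH k; have [ij|ji] := leP (f i) (f j).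
  exists j => [|l]; first by rewrite inE js orbT.
  by rewrite inE => /predU1P[->//|]; exact: jmax.
exists i => [|l]; first exact: mem_head.
by rewrite inE => /predU1P[->//|/jmax h]; exact: le_trans h (ltW ji).
Qed.

Lemma positive_degree_one_horner (R : realType) (Q : {poly R}) : positive_degree_one Q ->
  exists q0 q1 : R, [/\ 0 < q0, 0 < q1 & forall t, Q.[t] = q0 + q1 * t].
Proof.
move=> [sQ Q0]; exists Q`_0, Q`_1; split; [exact: Q0|exact: Q0|move=> t].
by rewrite horner_coef sQ !big_ord_recl big_ord0 /= addr0 expr0 mulr1 expr1.
Qed.

(** * Spherical functions and shadows *)

Section Density.
Context {R : realType} {X : pmetricType R} {Gamma : groupType}.
Variables (rho : isom_action Gamma X) (mu : @density R X) (a C kappa : R).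
Hypotheses (a0 : 0 <= a) (C1 : 1 <= C) (kappa0 : 0 <= kappa).
Hypothesis mu_ac : forall x y, mu y `<< mu x.
Hypothesis rnP : forall x y, {ae mu x, forall v,
  C^-1 * expR (a * busemann v x y) <= rn_derivative mu x y v
    <= C * expR (a * busemann v x y)}.
Hypothesis mu_act : forall (g : Gamma) x (A : set (borel_bordification X)),
  measurable A -> pushforward (mu x) (bact rho g) A = mu (rho g x) A.

Hypothesis bgp_bounds : forall (v : borel_bordification X) x y, bdry v -> - kappa <= bgp x v y <= mdist x y + kappa.
Hypothesis bgp_hyp : forall (v : borel_bordification X) x y z, bdry v ->
  Num.min (bgp x v y) (bgp x v z) - kappa <= gromov_product x y z.
Hypothesis bgp_hyp_mix : forall (v : borel_bordification X) x y z, bdry v ->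
  Num.min (gromov_product x y z) (bgp x v y) - kappa <= bgp x v z.
Hypothesis bgp_lip : forall (v : borel_bordification X) x y z, bdry v ->
  bgp x v y <= bgp x v z + mdist y z + kappa.
Hypothesis bgp_swap : forall (v : borel_bordification X) g x y, bdry v ->
  mdist x (rho g y) - kappa <=
    bgp x v (rho g y) + bgp y (bact rho g^-1%g v) (rho g^-1%g x).

Definition root_density (x y : X) (v : borel_bordification X) : R :=
  Num.sqrt (rn_derivative mu x y v).

Let C0 : 0 < C. Proof. exact: lt_le_trans C1. Qed.

(** X is open in the bordification, as the condition at boundary points is void for a set of inner
    points. *)
Lemma bdry_measurable : measurable (bdry : set (borel_bordification X)).
Proof.
have -> : (bdry : set (borel_bordification X)) = ~` [set Inner y | y in [set: X]].
  apply/seteqP; split => [_ [w _ <-] [y _]//|[y []|w _]].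
    by exists y.
  by exists w.
apply: measurableC; apply: sub_sigma_algebra; split.
  rewrite (_ : [set y | _] = setT); first exact: openT.
  by apply/seteqP; split => // y _; exists y.
by move=> w [y].
Qed.

Lemma bact_measurable g : measurable_fun setT (bact rho g).
Proof.
apply: (@measurability _ _ (borel_bordification X) (borel_bordification X) setT
  (bact rho g) (@open (bordification X))) => //.
move=> _ [U oU <-]; rewrite setTI; apply: sub_sigma_algebra; exact: bact_open.
Qed.

Lemma bdry_bact g : bact rho g @^-1` bdry = bdry.
Proof.
apply/seteqP; split => -[y|w] h.
- by case: h.
- by exists w.
- by case: h.
- by exists (exist _ _ (boundary_class_act rho g (svalP w))).
Qed.

Lemma rn_derivativeE x y v : (rn_derivative mu x y v)%:E =
  Radon_Nikodym (charge_of_finite_measure (mu y)) (mu x) v.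
Proof. by rewrite /rn_derivative fineK//; apply: Radon_Nikodym_fin_num; exact: mu_ac. Qed.

Lemma rn_derivative_measurable x y (D : set (borel_bordification X)) :
  measurable_fun D (rn_derivative mu x y).
Proof.
apply/measurable_EFinP; rewrite (_ : EFin \o _ =
   Radon_Nikodym (charge_of_finite_measure (mu y)) (mu x)).
  apply: measurable_funTS; apply: (@measurable_int _ _ _ (mu x)).
  by apply: Radon_Nikodym_integrable; exact: mu_ac.
by apply/funext => v /=; rewrite rn_derivativeE.
Qed.

Lemma rn_derivative_integral x y A : measurable A ->
  mu y A = (\int[mu x]_(v in A) (rn_derivative mu x y v)%:E)%E.
Proof.
move=> mA; rewrite -[LHS]/(charge_of_finite_measure (mu y) A).
rewrite (@Radon_Nikodym_integral _ _ _ _ (mu x))//; last exact: mu_ac.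
by apply: eq_integral => v _; rewrite rn_derivativeE.
Qed.

Lemma root_density_measurable x y (D : set (borel_bordification X)) :
  measurable_fun D (root_density x y).
Proof.
have ms : measurable_fun setT (@Num.sqrt R).
  by apply: continuous_measurable_fun; exact: sqrt_continuous.
exact: (measurableT_comp ms (@rn_derivative_measurable x y D)).
Qed.

Lemma root_density_ge0 x y v : 0 <= root_density x y v.
Proof. exact: sqrtr_ge0. Qed.

(** The constant should be the square root of C, which is at most C because C >= 1. *)
Lemma root_density_bounds x y : {ae mu x, forall v,
  C^-1 * expR (a * (bgp x v y - mdist x y / 2)) <= root_density x y v
    <= C * expR (a * (bgp x v y - mdist x y / 2))}.
Proof.
apply: ae_imply (rnP x y) => v; rewrite /root_density /busemann -/(bgp x v y).
set r := rn_derivative _ _ _ _; set e := expR (a * (_ - _ / 2)).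
have -> : expR (a * (2 * bgp x v y - mdist x y)) = e ^+ 2.
  by rewrite /e -expRM_natl; congr expR; field.
have e0 : 0 < e := expR_gt0 _.
have i1 : C^-1 <= 1 by rewrite invf_le1.
have i0 : 0 < C^-1 by rewrite invr_gt0.
move=> /andP[h1 h2]; apply/andP; split.
  have -> : C^-1 * e = Num.sqrt ((C^-1 * e) ^+ 2) by rewrite sqrtr_sqr ger0_norm// mulr_ge0// ltW.
  rewrite ler_wsqrtr//; apply: le_trans h1; rewrite exprMn.
  by apply: ler_wpM2r; [exact: sqr_ge0|rewrite expr2 ger_pMr].
have -> : C * e = Num.sqrt ((C * e) ^+ 2) by rewrite sqrtr_sqr ger0_norm// mulr_ge0// ltW.
rewrite ler_wsqrtr//; apply: (le_trans h2); rewrite exprMn.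
by apply: ler_wpM2r; [exact: sqr_ge0|rewrite expr2 ler_pMr].
Qed.

(** The image of mu_x by g is mu_(g x), which is absolutely continuous with respect to mu_x, so
    preimages of null sets are null. *)
Lemma ae_bact g x (P : borel_bordification X -> Prop) :
  {ae mu x, forall v, P v} -> {ae mu x, forall v, P (bact rho g v)}.
Proof.
move=> [N [mN N0 PN]]; exists (bact rho g @^-1` N); split.
- by rewrite -[X in measurable X]setTI; exact: bact_measurable.
- rewrite -[LHS]/(pushforward (mu x) (bact rho g) N) mu_act//.
  by have /null_content_dominatesP := @mu_ac x (rho g x); apply.
- by move=> v /= h; exact: PN.
Qed.


Let ae_bounds x y := root_density_bounds x y.

(** [spherical_function] is the [fine] part of this integral; the point is that the integral is
    finite. *)
Lemma integral_root_density x y :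
  (\int[mu x]_(v in bdry) (root_density x y v)%:E = (spherical_function mu x y)%:E)%E.
Proof.
rewrite fineK// ge0_fin_numE; last first.
  by apply: integral_ge0 => v _; rewrite lee_fin root_density_ge0.
pose c := C * expR (a * (mdist x y + kappa - mdist x y / 2)).
have c0 : 0 <= c by rewrite /c mulr_ge0 ?expR_ge0 ?(ltW C0).
apply: (@le_lt_trans _ _ (\int[mu x]_(v in bdry) c%:E)%E); last first.
  rewrite integral_cst; last exact: bdry_measurable.
  by rewrite ltey_eq fin_numM//; apply: fin_num_measure; exact: bdry_measurable.
apply: (ae_le_integral_real bdry_measurable) => //.
- exact: root_density_measurable.
apply: ae_imply (ae_bounds x y) => v /andP[_ h] bv; apply: (le_trans h).
by rewrite ler_pM2l// ler_expR ler_wpM2l// lerD2r; have /andP[] := bgp_bounds x y bv.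
Qed.


Lemma spherical_function_le x y c : 0 <= c ->
  {ae mu x, forall v, bdry v -> root_density x y v <= c} ->
  spherical_function mu x y <= c * fine (mu x bdry).
Proof.
move=> c0 hc; rewrite -lee_fin -integral_root_density EFinM fineK; last first.
  by apply: fin_num_measure; exact: bdry_measurable.
rewrite -integral_cst; last exact: bdry_measurable.
apply: (ae_le_integral_real bdry_measurable) => //.
  exact: root_density_measurable.
by move=> v; exact: root_density_ge0.
Qed.

Lemma spherical_function_trivial_upper x y :
  spherical_function mu x y <= C * expR (a * (mdist x y / 2 + kappa)) * fine (mu x bdry).
Proof.
apply: spherical_function_le; first by rewrite mulr_ge0 ?expR_ge0 ?(ltW C0).
apply: ae_imply (ae_bounds x y) => v /andP[_ h] bv; apply: (le_trans h).
rewrite ler_pM2l// ler_expR ler_wpM2l//.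
by have /andP[_] := bgp_bounds x y bv; lra.
Qed.

(** Replacing y by z changes the product with v by at most d(y, z) + kappa and half the distance to
    x by at most d(y, z) / 2, whence the factor 3 / 2. *)
Lemma spherical_function_lip x y z : spherical_function mu x y <=
  C ^+ 2 * expR (a * (3 / 2 * mdist y z + kappa)) * spherical_function mu x z.
Proof.
set K := _ * expR _.
have K0 : 0 <= K by rewrite mulr_ge0 ?expR_ge0 ?sqr_ge0.
rewrite -lee_fin EFinM -!integral_root_density.
rewrite -(ge0_integralZl_EFin _ bdry_measurable)//; last 2 first.
- by move=> v _; rewrite lee_fin root_density_ge0.
- apply/measurable_EFinP; exact: root_density_measurable.
apply: (ae_le_integral_real bdry_measurable) => //.
- exact: root_density_measurable.
- by apply: measurable_funM => //; exact: root_density_measurable.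
- by move=> v; exact: root_density_ge0.
- apply: ae_imply2 (ae_bounds x y) (ae_bounds x z) => v /andP[_ hy] /andP[hz _] bv.
  apply: (le_trans hy); apply: le_trans (ler_wpM2l K0 hz).
  have -> : K * (C^-1 * expR (a * (bgp x v z - mdist x z / 2))) =
     C * (expR (a * (3 / 2 * mdist y z + kappa)) * expR (a * (bgp x v z - mdist x z / 2))).
    by rewrite /K; field; rewrite gt_eqF.
  rewrite -expRD ler_pM2l// ler_expR -mulrDr ler_wpM2l//.
  have := bgp_lip x y z bv; have := metric_triangle x y z; have := metric_triangle x z y.
  by lra.
- by move=> v; rewrite mulr_ge0// root_density_ge0.
Qed.


(** The estimate is known along the orbit of a point z0 of the hull and far from x. It is carried to
    the orbit of x, at distance d(x, z0), and extended to the elements close to x. *)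
Lemma spherical_orbit_upper x z0 r q : 0 <= q ->
  (forall g, r <= mdist x (rho g z0) -> spherical_function mu x (rho g z0) <=
     q * (1 + mdist x (rho g z0)) * expR (- (a / 2) * mdist x (rho g z0))) ->
  exists2 A, 0 < A & forall g, spherical_function mu x (rho g x) <=
     A * (1 + mdist x (rho g x)) * expR (- (a / 2) * mdist x (rho g x)).
Proof.
move=> q0 hq; pose e := mdist x z0; have e0 : 0 <= e by exact: mdist_ge0.
pose M := fine (mu x bdry); have M0 : 0 <= M by exact: fine_ge0.
(* [A1] serves the g with d(x, g z0) >= r. For the others d(x, g x) <= |r| + e, and the trivial
   bound gives [A2]. *)
pose A1 := C ^+ 2 * expR (a * (3 / 2 * e + kappa)) * q * (1 + e) * expR (a / 2 * e).
pose A2 := C * expR (a * (kappa + `|r| + e)) * M.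
have A10 : 0 <= A1 by rewrite /A1 !mulr_ge0 ?expR_ge0 ?sqr_ge0 ?addr_ge0 ?(ltW C0).
have A20 : 0 <= A2 by rewrite /A2 !mulr_ge0 ?expR_ge0 ?(ltW C0).
exists (A1 + A2 + 1) => [|g]; first by rewrite ltr_wpDl// addr_ge0.
set d := mdist x (rho g x); have d0 : 0 <= d by exact: mdist_ge0.
have dz : mdist (rho g x) (rho g z0) = e by rewrite act_isom.
set f := mdist x (rho g z0); have f0 : 0 <= f by exact: mdist_ge0.
have fd : f <= d + e by rewrite -dz; exact: metric_triangle.
have df : d <= f + e by rewrite -dz (metric_sym (rho g x)); exact: metric_triangle.
rewrite -mulrA; set W := _ * expR _.
have W0 : 0 <= W by rewrite mulr_ge0 ?expR_ge0// addr_ge0.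
case: (leP r f) => [rf|fr].
  apply: (@le_trans _ _ (A1 * W)); last by rewrite ler_wpM2r//; lra.
  apply: le_trans (spherical_function_lip x (rho g x) (rho g z0)) _; rewrite dz.
  rewrite /A1; set K := _ * expR (a * _).
  have K0 : 0 <= K by rewrite mulr_ge0 ?expR_ge0 ?sqr_ge0.
  have h1 : 1 + f <= (1 + e) * (1 + d).
    by have := mulr_ge0 e0 d0; lra.
  have h2 : expR (- (a / 2) * f) <= expR (a / 2 * e) * expR (- (a / 2) * d).
    have fed : 0 <= f + e - d by lra.
    by rewrite -expRD ler_expR; have := mulr_ge0 a0 fed; lra.
  have h3 := ler_pM (addr_ge0 ler01 f0) (expR_ge0 _) h1 h2.
  have -> : K * q * (1 + e) * expR (a / 2 * e) * W =
    K * (q * ((1 + e) * (1 + d) * (expR (a / 2 * e) * expR (- (a / 2) * d)))).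
    by rewrite /W; ring.
  apply: ler_wpM2l => //; apply: le_trans (hq g rf) _.
  by rewrite -/f -mulrA; apply: ler_wpM2l.
apply: (@le_trans _ _ (A2 * W)); last by rewrite ler_wpM2r//; lra.
apply: le_trans (spherical_function_trivial_upper x (rho g x)) _; rewrite -/d -/M /A2.
have -> : C * expR (a * (kappa + `|r| + e)) * M * W = C * (expR (a * (kappa + `|r| + e)) * W) * M by ring.
rewrite ler_wpM2r// ler_wpM2l ?(ltW C0)//.
apply: (@le_trans _ _ (expR (a * (kappa + `|r| + e)) * expR (- (a / 2) * d))).
  have h4 : 0 <= `|r| + e - d by have := ler_norm r; lra.
  by rewrite -expRD ler_expR; have := mulr_ge0 a0 h4; lra.
by rewrite ler_wpM2l ?expR_ge0// /W ler_peMl ?expR_ge0//; lra.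
Qed.

(* the boundary points whose product with y is bounded; it is expressed by the
   density because the Gromov product need not be measurable *)
Definition shadow_core x L y : set (borel_bordification X) :=
  bdry `&` [set v | root_density x y v <= C * expR (a * (L - mdist x y / 2))].

Lemma shadow_core_measurable x L y : measurable (shadow_core x L y).
Proof.
have := @root_density_measurable x y _ bdry_measurable _
  (measurable_itv `]-oo, C * expR (a * (L - mdist x y / 2))]).
by congr (measurable (bdry `&` _)); apply/seteqP; split => v /=; rewrite in_itv.
Qed.

Lemma spherical_function_split x y k1 k2 (A : set (borel_bordification X)) :
  measurable A -> A `<=` bdry -> 0 <= k1 -> 0 <= k2 ->
  {ae mu x, forall v, bdry v -> root_density x y v <= k1 * \1_A v + k2} ->
  spherical_function mu x y <= k1 * fine (mu x A) + k2 * fine (mu x bdry).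
Proof.
move=> mA AD k10 k20 h.
rewrite -lee_fin -integral_root_density EFinD !EFinM !fineK; last 2 first.
- by apply: fin_num_measure; exact: bdry_measurable.
- exact: fin_num_measure.
have mi : measurable_fun bdry (\1_A : borel_bordification X -> R).
  exact: measurable_indic.
apply: (@le_trans _ _ (\int[mu x]_(v in bdry) (k1 * \1_A v + k2)%:E)%E).
  apply: (ae_le_integral_real bdry_measurable) => //.
  - exact: root_density_measurable.
  - by apply: measurable_funD => //; exact: measurable_funM.
  - by move=> v; exact: root_density_ge0.
  - by move=> v; rewrite addr_ge0// mulr_ge0.
under eq_integral do rewrite EFinD.
rewrite ge0_integralD//; last 3 first.
- exact: bdry_measurable.
- by move=> v _; rewrite lee_fin mulr_ge0.
- by apply/measurable_EFinP; exact: measurable_funM.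
rewrite integral_cst; last exact: bdry_measurable.
under eq_integral do rewrite EFinM.
rewrite ge0_integralZl_EFin//; last 2 first.
- exact: bdry_measurable.
- exact/measurable_EFinP.
by rewrite integral_indic ?(setIidl AD)//; exact: bdry_measurable.
Qed.

(* The points z true n and z false n diverge from each other, so that one of
   them has a bounded product with y. Off the core, the root density at that
   point is O(exp (- a n / 2)), which is less than what the linear factor of
   the lower Harish-Chandra estimate requires for n large. *)
Lemma shadow_core_mass x (z : bool -> nat -> X) e r q : hyperbolic_space X -> 0 < q ->
  (forall b n, n%:R - e <= mdist x (z b n) <= n%:R + e) ->
  (forall n, gromov_product x (z true n) (z false n) <= e) ->
  (forall b n, r <= mdist x (z b n) ->
    q * mdist x (z b n) * expR (- (a / 2) * mdist x (z b n)) <= spherical_function mu x (z b n)) ->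
  exists L c, 0 < c /\ forall y, (c%:E <= mu x (shadow_core x L y))%E.
Proof.
move=> [delta delta0 hyp] q0 zd ze zl.
(* If the products of v with y and with [z b n] both exceeded L, that of y and [z b n] would exceed
   e + delta. *)
pose L := e + delta + kappa + 1; pose M := fine (mu x bdry).
have M0 : 0 <= M by exact: fine_ge0.
(* n is fixed before y, which makes the lower bound on the mass uniform in y. *)
have [n nP] : exists n : nat, Num.max r ((C * expR (a * L) * M + 1) / q) + e <= n%:R.
  by exists (Num.truncn (Num.max r ((C * expR (a * L) * M + 1) / q) + e)).+1; exact/ltW/truncnS_gt.
exists L, (C^-1 * expR (- (a * (n%:R + e + kappa)))); split.
  by rewrite mulr_gt0 ?invr_gt0 ?expR_gt0.
move=> y; set A := shadow_core x L y.
have mA : measurable A := shadow_core_measurable x L y.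
have [b yb] : exists b, gromov_product x y (z b n) <= e + delta.
  have := hyp x (z true n) y (z false n).
  rewrite (gromov_productC x _ y) => h; case: (leP (gromov_product x y (z true n)) (e + delta)) => h1.
    by exists true.
  exists false; rewrite leNgt; apply/negP => h2; have := ze n.
  suff : e + delta < Num.min (gromov_product x y (z true n)) (gromov_product x y (z false n)) by lra.
  by rewrite lt_min h1.
set d := mdist x (z b n); have d0 : 0 <= d by exact: mdist_ge0.
have /andP[d1 d2] := zd b n; rewrite -/d in d1 d2.
have [rd qd] : r <= d /\ C * expR (a * L) * M + 1 <= q * d.
  move: nP; rewrite -lerBrDr ge_max => /andP[h1 h2].
  by split; [exact: le_trans h1 d1|rewrite [q * d]mulrC -ler_pdivrMr//; exact: le_trans h2 d1].
have := zl b n rd; rewrite -/d => lb.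
have ub : spherical_function mu x (z b n) <=
   C * expR (a * (d / 2 + kappa)) * fine (mu x A) + C * expR (a * (L - d / 2)) * M.
  apply: spherical_function_split => //; first by move=> v [].
  - by rewrite mulr_ge0 ?expR_ge0 ?(ltW C0).
  - by rewrite mulr_ge0 ?expR_ge0 ?(ltW C0).
  apply: ae_imply2 (ae_bounds x y) (ae_bounds x (z b n)) => v /andP[_ hy] /andP[_ hz] bv.
  apply: (le_trans hz); rewrite -/d; have k0 := ltW C0.
  have [vA|vA] := pselect (A v).
    rewrite indicE mem_set//= mulr1; apply: ler_wpDr; first by rewrite mulr_ge0 ?expR_ge0.
    rewrite ler_pM2l// ler_expR ler_wpM2l//.
    by have /andP[_] := bgp_bounds x (z b n) bv; rewrite -/d; lra.
  rewrite indicE memNset//= mulr0 add0r ler_pM2l// ler_expR ler_wpM2l// lerD2r.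
  have yL : L < bgp x v y.
    rewrite ltNge; apply/negP => h; apply: vA; split => //=; apply: (le_trans hy).
    by rewrite ler_pM2l// ler_expR ler_wpM2l// lerD2r.
  rewrite leNgt; apply/negP => h; have := bgp_hyp x y (z b n) bv.
  suff : L < Num.min (bgp x v y) (bgp x v (z b n)) by have EL : L = e + delta + kappa + 1 by []; move=> h1 h2; have h3 := le_trans h2 yb; lra.
  by rewrite lt_min yL.
rewrite -[X in (_ <= X)%E]fineK; last exact: fin_num_measure.
rewrite lee_fin; set m := fine (mu x A) in ub *.
have m0 : 0 <= m by exact: fine_ge0.
set E := expR (- (a / 2) * d) in lb; have E0 : 0 < E := expR_gt0 _.
have e1 : expR (a * (d / 2 + kappa)) = expR (a * (d + kappa)) * E.
  by rewrite -expRD; congr expR; field.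
have e2 : expR (a * (L - d / 2)) = expR (a * L) * E.
  by rewrite -expRD; congr expR; field.
rewrite e1 e2 in ub.
have h : q * d <= C * expR (a * (d + kappa)) * m + C * expR (a * L) * M.
  rewrite -(ler_pM2r E0); apply: (le_trans lb); apply: (le_trans ub).
  by rewrite le_eqVlt; apply/orP; left; apply/eqP; ring.
have {}h : 1 <= C * expR (a * (d + kappa)) * m by lra.
set c := C^-1 * _; have c0 : 0 <= c by rewrite mulr_ge0 ?expR_ge0 ?invr_ge0 ?(ltW C0).
rewrite -[leLHS]mulr1; apply: le_trans (ler_wpM2l c0 h) _.
have -> : c * (C * expR (a * (d + kappa)) * m) =
   expR (- (a * (n%:R + e + kappa))) * expR (a * (d + kappa)) * m.
  by rewrite /c; field; rewrite gt_eqF.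
rewrite -expRD ler_piMl// -[leRHS]expR0 ler_expR.
have ned : 0 <= n%:R + e - d by lra.
by have := mulr_ge0 a0 ned; lra.
Qed.

(** The translate by g of the core for g^-1 x. A bounded product of g^-1 v with g^-1 x means, by the
    swap inequality, that the product of v with g x is d(x, g x) up to a constant: v lies in the
    shadow of g x seen from x. *)
Definition shadow x L g : set (borel_bordification X) :=
  bact rho g^-1%g @^-1` shadow_core x L (rho g^-1%g x).

Lemma shadow_measurable x L g : measurable (shadow x L g).
Proof.
rewrite -[X in measurable X]setTI; apply: bact_measurable => //.
exact: shadow_core_measurable.
Qed.

Lemma shadow_bdry x L g : shadow x L g `<=` bdry.
Proof. by move=> v [bv _]; rewrite -(bdry_bact g^-1%g). Qed.

Lemma mdist_invg x g : mdist x (rho g^-1%g x) = mdist x (rho g x).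
Proof. by rewrite -(act_isom rho g x) -actM mulgV act1 metric_sym. Qed.

(** By equivariance this is the mass of the core for mu_(g^-1 x), whose density with respect to mu_x
    is at least C^-1 e^(-a (d(x, g x) + 2 kappa)) on the boundary. *)
Lemma shadow_mass x L c g : (forall y, (c%:E <= mu x (shadow_core x L y))%E) ->
  ((C^-1 * expR (- (a * (mdist x (rho g x) + 2 * kappa))) * c)%:E <= mu x (shadow x L g))%E.
Proof.
move=> hc; have mA := shadow_core_measurable x L (rho g^-1%g x).
rewrite /shadow -[leRHS]/(pushforward (mu x) (bact rho g^-1%g) _) mu_act//.
rewrite (rn_derivative_integral x)//; set A := shadow_core _ _ _ in mA *.
set k := C^-1 * _; have k0 : 0 <= k by rewrite mulr_ge0 ?expR_ge0 ?invr_ge0 ?(ltW C0).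
apply: (@le_trans _ _ (\int[mu x]_(v in A) k%:E)%E).
  by rewrite integral_cst// EFinM lee_wpmul2l//; exact: hc.
(* Truncation at 0 makes the integrand nonnegative everywhere, as [ae_le_integral_real] requires. *)
pose rn v := Num.max 0 (rn_derivative mu x (rho g^-1%g x) v).
have h : {ae mu x, forall v, k <= rn_derivative mu x (rho g^-1%g x) v \/ ~ bdry v}.
  apply: ae_imply (rnP x (rho g^-1%g x)) => v /andP[h _].
  have [bv|] := pselect (bdry v); [left|by right].
  apply: le_trans h; rewrite ler_pM2l ?invr_gt0// ler_expR -mulrN ler_wpM2l//.
  have /andP[+ _] := bgp_bounds x (rho g^-1%g x) bv.
  by rewrite /busemann -/(bgp x v _) mdist_invg; lra.
have -> : (\int[mu x]_(v in A) (rn_derivative mu x (rho g^-1%g x) v)%:E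
   = \int[mu x]_(v in A) (rn v)%:E)%E.
  apply: ae_eq_integral => //.
  - by apply/measurable_EFinP; exact: rn_derivative_measurable.
  - apply/measurable_EFinP; apply: measurable_maxr => //; exact: rn_derivative_measurable.
  - apply: ae_imply h => v [h|h] Av; last by case: h; case: Av.
    by rewrite /rn /Num.max; case: ltP => // h1; congr EFin; apply/eqP; rewrite eq_le h1 (le_trans k0 h).
apply: (ae_le_integral_real mA) => //.
- apply: measurable_maxr => //; exact: rn_derivative_measurable.
- apply: ae_imply h => v [h|h] Av; last by case: h; case: Av.
  by rewrite /rn le_max h orbT.
- by move=> v; rewrite /rn le_max lexx.
Qed.

(** The core bounds a density; its lower estimate converts this into a bound on the Gromov product,
    at the cost of 2 ln C / a. The swap inequality then concludes. *)
Lemma shadow_bgp x L g : 0 < a -> {ae mu x, forall v, shadow x L g v ->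
  mdist x (rho g x) - (kappa + L + 2 * ln C / a) <= bgp x v (rho g x)}.
Proof.
move=> a_gt0; apply: ae_imply (ae_bact g^-1%g (ae_bounds x (rho g^-1%g x))) => v.
move=> /andP[h1 _] [bv /= h2]; have := le_trans h1 h2; set t := bgp _ _ _.
have -> : C^-1 = expR (- ln C) by rewrite expRN lnK.
rewrite -[X in _ <= X * _](@lnK _ C)// -!expRD ler_expR => h3.
have {}h3 : t <= L + 2 * ln C / a.
  by rewrite -lerBlDl ler_pdivlMr//; lra.
have bv' : bdry v by rewrite -(bdry_bact g^-1%g).
have := bgp_swap g x x bv'; rewrite -/t; lra.
Qed.

(** Multiplication on the left by the inverse of a member of s sends s into the finite set of the h
    with d(x, h x) <= r, wherever s is. *)
Lemma orbit_packing x r : discrete_action rho -> exists P : nat, forall s : seq Gamma, uniq s ->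
  (forall g h, g \in s -> h \in s -> mdist (rho g x) (rho h x) <= r) -> (size s <= P)%N.
Proof.
move=> disc; have [t tE] := (finite_seqP _).1 (disc x r); exists (size t).
case=> [//|g s] us hs; rewrite -(size_map (fun h => (g^-1 * h)%g)).
apply: uniq_leq_size.
  by rewrite map_inj_uniq// => h h' /mulgI.
move=> _ /mapP[h hin ->]; suff : [set` t] (g^-1 * h)%g by [].
rewrite -tE /= -(act_isom rho g) -actM mulVKg; apply: hs => //; exact: mem_head.
Qed.

Definition in_annulus x (m : nat) (s : seq Gamma) :=
  forall g, g \in s -> m%:R <= mdist x (rho g x) <= m%:R + 1.

(* The shadows of the annulus have mass at least of order exp (- a m) and
   bounded multiplicity; on the shadow of g, the summand is at most of order
   exp (a m / 2) times the root density at g0 x. *)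
Lemma annulus_gromov_sum x A L c : 0 < a -> discrete_action rho -> 0 <= A ->
  (forall g, spherical_function mu x (rho g x) <=
     A * (1 + mdist x (rho g x)) * expR (- (a / 2) * mdist x (rho g x))) ->
  0 < c -> (forall y, (c%:E <= mu x (shadow_core x L y))%E) ->
  exists2 K, 0 <= K & forall m s g0, uniq s -> in_annulus x m s -> g0 \in s ->
    \sum_(g <- s) expR (a * gromov_product x (rho g x) (rho g0 x))
      <= K * (m%:R + 2) * expR (a * m%:R).
Proof.
move=> a_gt0 disc A0 hA c0 hc; pose L' := kappa + `|L| + 2 * ln C / a.
have L'0 : 0 <= L' by rewrite !addr_ge0// divr_ge0 ?mulr_ge0 ?ln_ge0.
(* If the shadows of g and h share v, the product of g x and h x is at least m - L' - kappa; their
   distances to x being at most m + 1, they are this close. *)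
have [P hP] := orbit_packing x (2 + 2 * kappa + 2 * L') disc.
(* P bounds the multiplicity. On the shadow of g, the product of g x and g0 x exceeds that of v and
   g0 x by at most kappa + L', and 1 / 2 comes from d(x, g0 x) / 2 <= (m + 1) / 2. *)
pose K1 := P%:R * C * expR (a * (kappa + L' + 2^-1)).
have K10 : 0 <= K1 by rewrite !mulr_ge0 ?expR_ge0 ?(ltW C0).
pose b0 := C^-1 * expR (- (a * (1 + 2 * kappa))) * c.
have b00 : 0 < b0 by rewrite !mulr_gt0 ?invr_gt0 ?expR_gt0.
exists (K1 * A / b0) => [|m s g0 us sm g0s]; first by apply: divr_ge0; [exact: mulr_ge0|exact: ltW].
pose w g := expR (a * gromov_product x (rho g x) (rho g0 x)).
pose b := b0 * expR (- (a * m%:R)); have b_gt0 : 0 < b by rewrite mulr_gt0 ?expR_gt0.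
pose E := A * (m%:R + 2) * expR (- (a / 2) * m%:R).
pose K := K1 * expR (a / 2 * m%:R).
have -> : K1 * A / b0 * (m%:R + 2) * expR (a * m%:R) = K * E / b.
  have bV : b^-1 = b0^-1 * expR (a * m%:R).
    by rewrite /b [LHS]invfM -expRN opprK.
  rewrite bV /K /E.
  have : expR (a / 2 * m%:R) * expR (- (a / 2) * m%:R) = 1.
    by rewrite -expRD mulNr subrr expR0.
  set e1 := expR _; set e2 := expR (- _ * _) => e12; move: b0^-1 => i.
  rewrite -[LHS]mulr1 -[X in _ * X]e12; move: (expR (a * m%:R)) => e3.
  by ring.
have annul g : g \in s -> m%:R <= mdist x (rho g x) /\ mdist x (rho g x) <= m%:R + 1.
  by move=> /sm /andP[].
have [d1 d2] := annul _ g0s.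
apply: (@weighted_packing_bound _ _ _ (mu x) _ bdry_measurable _ s w (shadow x L)
  (root_density x (rho g0 x))) => //.
- by move=> g; exact: expR_ge0.
- by move=> g; exact: shadow_measurable.
- by move=> g; exact: shadow_bdry.
- move=> g gs; apply: le_trans (shadow_mass g hc); rewrite lee_fin /b /b0.
  have [_ dg] := annul _ gs.
  rewrite mulrAC ler_pM2r// -mulrA ler_pM2l ?invr_gt0// -expRD ler_expR.
  have e0 : 0 <= m%:R + 1 - mdist x (rho g x) by lra.
  by have := mulr_ge0 a0 e0; lra.
- by rewrite mulr_ge0 ?expR_ge0.
- exact: root_density_measurable.
- by move=> v; exact: root_density_ge0.
- rewrite integral_root_density lee_fin; apply: (le_trans (hA g0)); rewrite /E.
  apply: ler_pM; rewrite ?expR_ge0 ?mulr_ge0 ?addr_ge0 ?mdist_ge0//.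
    by apply: ler_wpM2l => //; lra.
  have e0 : 0 <= mdist x (rho g0 x) - m%:R by lra.
  by rewrite ler_expR; have := mulr_ge0 a0 e0; lra.
have ae1 : {ae mu x, forall v, forall g, g \in s -> shadow x L g v ->
    mdist x (rho g x) - L' <= bgp x v (rho g x)}.
  apply: ae_all_seq => g _; apply: ae_imply (shadow_bgp x L g a_gt0) => v h /h.
  by apply: le_trans; rewrite lerD2l lerN2 lerD2r lerD2l ler_norm.
apply: ae_imply2 ae1 (ae_bounds x (rho g0 x)) => v h1 /andP[h2 _] bv.
pose s' := [seq g <- s | `[< shadow x L g v >]].
have s'P : (size s' <= P)%N.
  apply: hP; first exact: filter_uniq.
  move=> g h; rewrite !mem_filter => /andP[/asboolP vg gs] /andP[/asboolP vh hs].
  have := bgp_hyp x (rho g x) (rho h x) bv; have [g1 g2] := annul _ gs.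
  have [k1 k2] := annul _ hs; have := h1 _ gs vg; have := h1 _ hs vh.
  move=> n1 n2 n3.
  have n4 : m%:R - L' <= Num.min (bgp x v (rho g x)) (bgp x v (rho h x)).
    by rewrite le_min; apply/andP; split; lra.
  by move: n3; rewrite /gromov_product; lra.
have -> : \sum_(g <- s) w g * \1_(shadow x L g) v = \sum_(g <- s') w g.
  rewrite big_filter [RHS]big_mkcond; apply: eq_bigr => g _; rewrite indicE.
  case: asboolP => [h|h]; first by rewrite mem_set// mulr1.
  by rewrite memNset// mulr0.
apply: (@le_trans _ _ (\sum_(g <- s') C * expR (a * (kappa + L' + 2^-1 + m%:R / 2)) *
   root_density x (rho g0 x) v)).
  rewrite big_seq [leRHS]big_seq; apply: ler_sum => g.
  rewrite mem_filter => /andP[/asboolP vg gs].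
  have k0 : 0 <= C * expR (a * (kappa + L' + 2^-1 + m%:R / 2)).
    by rewrite mulr_ge0 ?expR_ge0 ?(ltW C0).
  apply: le_trans (ler_wpM2l k0 h2).
  rewrite mulrACA divff ?gt_eqF// mul1r -expRD ler_expR -mulrDr ler_pM2l//.
  have n1 := h1 _ gs vg; have [g1 g2] := annul _ gs.
  have n2 := bgp_hyp_mix x (rho g x) (rho g0 x) bv.
  have n3 := gromov_product_le x (rho g0 x) (rho g x).
  rewrite gromov_productC in n3.
  have n4 : gromov_product x (rho g x) (rho g0 x) - L' <=
     Num.min (gromov_product x (rho g x) (rho g0 x)) (bgp x v (rho g x)).
    by rewrite le_min; apply/andP; split; lra.
  lra.
rewrite big_const_seq count_predT iter_addr_0 -[leLHS]mulr_natl.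
have -> : K * root_density x (rho g0 x) v = P%:R *
    (C * expR (a * (kappa + L' + 2^-1 + m%:R / 2)) * root_density x (rho g0 x) v).
  have -> : expR (a * (kappa + L' + 2^-1 + m%:R / 2)) =
     expR (a * (kappa + L' + 2^-1)) * expR (a / 2 * m%:R).
    by rewrite -expRD; congr expR; field.
  by rewrite /K /K1; ring.
apply: ler_wpM2r; last by rewrite ler_nat.
by rewrite !mulr_ge0 ?expR_ge0 ?root_density_ge0 ?(ltW C0).
Qed.

(* At v, the sum is compared with the one of annulus_gromov_sum for the element
   g0 of s which maximizes the product of v and g0 x. *)
Lemma annulus_density_sum x K : 0 <= K ->
  (forall m s g0, uniq s -> in_annulus x m s -> g0 \in s ->
    \sum_(g <- s) expR (a * gromov_product x (rho g x) (rho g0 x))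
      <= K * (m%:R + 2) * expR (a * m%:R)) ->
  forall m s, uniq s -> in_annulus x m s -> {ae mu x, forall v, bdry v ->
    \sum_(g <- s) root_density x (rho g x) v
      <= C * expR (a * kappa) * K * (m%:R + 2) * expR (a / 2 * m%:R)}.
Proof.
move=> K0 hK m s us sm.
have ae1 : {ae mu x, forall v, forall g, g \in s ->
    root_density x (rho g x) v <= C * expR (a * (bgp x v (rho g x) - mdist x (rho g x) / 2))}.
  apply: ae_all_seq => g _.
  by apply: ae_imply (ae_bounds x (rho g x)) => v /andP[].
apply: ae_imply ae1 => v hv bv; case: s us sm hv => [|i s] us sm hv.
  by rewrite big_nil !mulr_ge0 ?expR_ge0 ?addr_ge0 ?(ltW C0).
have [g0 g0s g0max] := seq_argmax (fun g => bgp x v (rho g x)) i s.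
apply: (@le_trans _ _ (\sum_(g <- i :: s) C * expR (a * (kappa - m%:R / 2)) *
   expR (a * gromov_product x (rho g x) (rho g0 x)))).
  rewrite big_seq [leRHS]big_seq; apply: ler_sum => g gs; apply: (le_trans (hv g gs)).
  rewrite -mulrA ler_pM2l// -expRD ler_expR -mulrDr ler_wpM2l//.
  have /andP[d1 _] := sm _ gs; have := bgp_hyp x (rho g x) (rho g0 x) bv.
  by rewrite (min_idPl (g0max _ gs)); lra.
rewrite -mulr_sumr; apply: le_trans (ler_wpM2l _ (hK m (i :: s) g0 us sm g0s)) _.
  by rewrite mulr_ge0 ?expR_ge0 ?(ltW C0).
have -> : expR (a * (kappa - m%:R / 2)) = expR (a * kappa) * expR (- (a / 2 * m%:R)).
  by rewrite -expRD; congr expR; field.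
have -> : expR (a * m%:R) = expR (a / 2 * m%:R) * expR (a / 2 * m%:R).
  by rewrite -expRD; congr expR; field.
have : expR (- (a / 2 * m%:R)) * expR (a / 2 * m%:R) = 1 by rewrite -expRD addNr expR0.
move: (expR _) (expR (a / 2 * _)) => e1 e2 e12.
rewrite -[X in _ <= X]mulr1 -[X in _ <= _ * X]e12 le_eqVlt; apply/orP; left; apply/eqP; ring.
Qed.

(** In Schur's bound the factor e^(-a m/2) of the spherical function cancels the factor e^(a m/2) of
    the sum of densities; one linear factor is left from each. *)
Lemma annulus_bound x A K : 0 < A -> 0 <= K ->
  (forall g, spherical_function mu x (rho g x) <=
     A * (1 + mdist x (rho g x)) * expR (- (a / 2) * mdist x (rho g x))) ->
  (forall m s g0, uniq s -> in_annulus x m s -> g0 \in s ->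
    \sum_(g <- s) expR (a * gromov_product x (rho g x) (rho g0 x))
      <= K * (m%:R + 2) * expR (a * m%:R)) ->
  forall f1 f2 : borel_bordification X -> R,
  measurable_fun bdry f1 -> measurable_fun bdry f2 ->
  (\int[mu x]_(v in bdry) (f1 v ^+ 2 + f2 v ^+ 2)%:E = 1)%E ->
  forall m s, uniq s -> in_annulus x m s ->
  \sum_(g <- s) ((\int[mu x]_(v in bdry) (root_density x (rho g x) v * f1 v)) ^+ 2
     + (\int[mu x]_(v in bdry) (root_density x (rho g x) v * f2 v)) ^+ 2)
   <= A * (C * expR (a * kappa) * K) * (m%:R + 2) ^+ 2.
Proof.
move=> A0 K0 hA hK f1 f2 mf1 mf2 f12 m s us sm.
have -> : A * (C * expR (a * kappa) * K) * (m%:R + 2) ^+ 2 =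
   (A * (m%:R + 2) * expR (- (a / 2) * m%:R)) *
   (C * expR (a * kappa) * K * (m%:R + 2) * expR (a / 2 * m%:R)).
  have : expR (- (a / 2) * m%:R) * expR (a / 2 * m%:R) = 1.
    by rewrite -expRD mulNr addNr expR0.
  move: (expR (- _ * _)) (expR (a / 2 * _)) => e1 e2 e12.
  rewrite -[LHS]mulr1 -[X in _ * X]e12; ring.
apply: (schur_bound bdry_measurable) => //.
- by move=> g; exact: root_density_measurable.
- by move=> g v; exact: root_density_ge0.
- by rewrite !mulr_gt0 ?expR_gt0// ltr_wpDl.
- by rewrite !mulr_ge0 ?expR_ge0 ?addr_ge0 ?(ltW C0).
- exact: annulus_density_sum.
- move=> g /sm /andP[d1 d2]; rewrite integral_root_density lee_fin.
  apply: (le_trans (hA g)); apply: ler_pM; rewrite ?expR_ge0 ?mulr_ge0 ?addr_ge0 ?mdist_ge0 ?(ltW A0)//.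
    by rewrite ler_pM2l//; lra.
  have e0 : 0 <= mdist x (rho g x) - m%:R by lra.
  by rewrite ler_expR; have := mulr_ge0 a0 e0; lra.
Qed.

(** In dimension 0 the spherical function would be bounded, against the linear growth of the lower
    estimate. *)
Lemma dimension_gt0 x (z : nat -> X) e r q : 0 < q ->
  (forall n, n%:R - e <= mdist x (z n)) ->
  (forall n, r <= mdist x (z n) ->
    q * mdist x (z n) * expR (- (a / 2) * mdist x (z n)) <= spherical_function mu x (z n)) ->
  0 < a.
Proof.
move=> q0 zd zl; rewrite lt_neqAle a0 andbT; apply/eqP => a_eq0.
pose M := fine (mu x bdry).
pose t := Num.max r ((C * M + 1) / q).
have dn : t <= mdist x (z (Num.truncn (t + e)).+1).
  by have := zd (Num.truncn (t + e)).+1; have := truncnS_gt (t + e); lra.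
move: dn; set y := z _; rewrite /t ge_max => /andP[rd qd].
have := le_trans (zl _ rd) (spherical_function_trivial_upper x y).
rewrite -a_eq0 !mul0r oppr0 mul0r expR0 !mulr1 -/M leNgt => /negP; apply.
by rewrite mulrC; move: qd; rewrite ler_pdivrMr//; lra.
Qed.

Lemma orbit_sum_bound T x : hyperbolic_space X -> discrete_action rho ->
  (exists2 c : R -> X, geodesic_line T c & forall t, times T t -> geodesic_hull rho T (c t)) ->
  harish_chandra rho T a mu ->
  exists2 K, 0 <= K & forall f1 f2 : borel_bordification X -> R,
  measurable_fun bdry f1 -> measurable_fun bdry f2 ->
  (\int[mu x]_(v in bdry) (f1 v ^+ 2 + f2 v ^+ 2)%:E = 1)%E ->
  forall (n : nat) s, uniq s -> (forall g, g \in s -> mdist x (rho g x) <= n%:R) ->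
  \sum_(g <- s) ((\int[mu x]_(v in bdry) (root_density x (rho g x) v * f1 v)) ^+ 2
     + (\int[mu x]_(v in bdry) (root_density x (rho g x) v * f2 v)) ^+ 2)
   <= K * (n%:R + 2) ^+ 3.
Proof.
move=> hypX disc [c lc hc] hc_est; have [r [Q1 [Q2 [_ Q1p Q2p Q12]]]] := hc_est x.
have [p0 [p1 [p00 p10 Q1E]]] := positive_degree_one_horner Q1p.
have [q0 [q1 [q00 q10 Q2E]]] := positive_degree_one_horner Q2p.
(* The points of the line at times n and -n. Their product at x is at most d(x, c 0), because they
   are 2 n apart. *)
pose z (b : bool) (n : nat) := c (if b then n%:R else - n%:R).
have tz b n : times T (if b then n%:R else - n%:R : R) by case: b; [exact: times_nat|exact: times_natN].
have t0 : times T (0 : R) := @times_nat R T 0.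
pose e := mdist x (c 0).
have zd b n : n%:R - e <= mdist x (z b n) <= n%:R + e.
  have : mdist (c 0) (z b n) = n%:R.
    by rewrite /z lc// sub0r normrN; case: b; rewrite ?normrN normr_nat.
  have := metric_triangle x (c 0) (z b n); have := metric_triangle (c 0) x (z b n).
  by rewrite (metric_sym (c 0) x) -/e => *; apply/andP; split; lra.
have ze n : gromov_product x (z true n) (z false n) <= e.
  have /andP[_ h1] := zd true n; have /andP[_ h2] := zd false n.
  have h3 : mdist (z true n) (z false n) = n%:R + n%:R.
    rewrite /z lc; [|exact: times_nat|exact: times_natN].
    by rewrite opprK ger0_norm// addr_ge0.
  by rewrite /gromov_product h3; lra.
have zl b n : r <= mdist x (z b n) ->
    p1 * mdist x (z b n) * expR (- (a / 2) * mdist x (z b n)) <= spherical_function mu x (z b n).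
  move=> rz; have /andP[+ _] := Q12 _ (hc _ (tz b n)) rz.
  apply: le_trans; rewrite ler_wpM2r ?expR_ge0// Q1E; lra.
have a_gt0 : 0 < a.
  by apply: (@dimension_gt0 x (z true) e r p1 p10) => n; [have /andP[] := zd true n|exact: zl].
have [L [m [m0 hm]]] := shadow_core_mass hypX p10 zd ze zl.
have [A A0 hA] : exists2 A, 0 < A & forall g, spherical_function mu x (rho g x) <=
     A * (1 + mdist x (rho g x)) * expR (- (a / 2) * mdist x (rho g x)).
  apply: (@spherical_orbit_upper x (c 0) r (q0 + q1)); first by rewrite addr_ge0 ?ltW.
  move=> g rg; have /andP[_] := Q12 _ (geodesic_hull_act g (hc _ t0)) rg.
  move=> h; apply: (le_trans h); rewrite ler_wpM2r ?expR_ge0// Q2E.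
  by have := mulr_ge0 (ltW q00) (mdist_ge0 x (rho g (c 0))); lra.
have [K K0 hK] := annulus_gromov_sum a_gt0 disc (ltW A0) hA m0 hm.
pose B := A * (C * expR (a * kappa) * K).
have B0 : 0 <= B by rewrite !mulr_ge0 ?expR_ge0 ?(ltW C0) ?(ltW A0).
exists B => // f1 f2 mf1 mf2 f12 n s us sn.
(* Closed annuli overlap at integer distances, so each element is assigned to the one given by its
   integer part. *)
pose p g : 'I_n.+1 := inord (Num.truncn (mdist x (rho g x))).
rewrite (partition_big p predT)//=.
apply: (@le_trans _ _ (\sum_(j < n.+1) B * (n%:R + 2) ^+ 2)); last first.
  have -> : B * (n%:R + 2) ^+ 3 = (n%:R + 2) * (B * (n%:R + 2) ^+ 2) by ring.
  rewrite sumr_const card_ord -[leLHS]mulr_natl; apply: ler_wpM2r.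
    by rewrite mulr_ge0 ?sqr_ge0.
  by rewrite -natr1; lra.
apply: ler_sum => j _; rewrite -big_filter.
apply: le_trans (annulus_bound A0 K0 hA hK mf1 mf2 f12 (m := j) _ _) _.
- exact: filter_uniq.
- move=> g; rewrite mem_filter => /andP[/eqP <- gs]; rewrite /p inordK.
    have d0 : 0 <= mdist x (rho g x) by exact: mdist_ge0.
    have /andP[-> h] := truncn_itv d0; rewrite natr1; exact: ltW.
  by rewrite ltnS truncn_le_nat; have := sn g gs; rewrite -natr1; lra.
rewrite -/B ler_wpM2l// lerXn2r ?nnegrE ?addr_ge0//.
by rewrite lerD2r ler_nat -ltnS ltn_ord.
Qed.

End Density.


Theorem proposition1p10 (R : realType) (X : pmetricType R) (Gamma : groupType)
    (rho : isom_action Gamma X) (T : time) (mu : @density R X) :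
  hyperbolic_space X -> discrete_action rho -> nonelementary rho ->
  (critical_exponent rho < +oo)%E -> class_C rho T ->
  quasi_conformal_density rho (fine (critical_exponent rho)) mu ->
  harish_chandra rho T (fine (critical_exponent rho)) mu ->
  forall x : X, exists Q : {poly R}, size Q = 4%N /\
    forall xi : borel_bordification X -> R[i], L2_unit_vector mu x xi ->
    forall n : nat,
      (\esum_(g in orbit_ball rho x n)
         (normc (L2_inner mu x (boundary_rep rho mu x g one_bdry) xi) ^+ 2)%:E
       <= Q.[n%:R]%:E)%E.
Proof.
move=> hypX disc ne _ cC [ac [C0 C00 rn] act_mu] hc x.
set a := fine _ in rn hc.
have a0 : 0 <= a.
  apply: fine_ge0; apply: le_ereal_inf_tmp => _ [s [s0 _] <-].
  by rewrite lee_fin ltW.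
have [kappa k0 kP] := bgp_hyperbolic rho hypX.
have line := class_C_hull_line hypX disc ne cC.
pose C := Num.max C0 1; have C1 : 1 <= C by rewrite le_max lexx orbT.
have CC : C0 <= C by rewrite le_max lexx.
have rnP y z : {ae mu y, forall v, C^-1 * expR (a * busemann v y z)
    <= rn_derivative mu y z v <= C * expR (a * busemann v y z)}.
  apply: ae_imply (rn y z) => v /andP[h1 h2]; apply/andP; split.
    apply: le_trans h1; rewrite ler_wpM2r ?expR_ge0// lef_pV2// posrE.
    exact: lt_le_trans C1.
  by apply: (le_trans h2); rewrite ler_wpM2r ?expR_ge0.
have [K K0 hK] : exists2 K, 0 <= K & forall f1 f2 : borel_bordification X -> R,
    measurable_fun bdry f1 -> measurable_fun bdry f2 ->
    (\int[mu x]_(v in bdry) (f1 v ^+ 2 + f2 v ^+ 2)%:E = 1)%E ->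
    forall (n : nat) s, uniq s -> (forall g, g \in s -> mdist x (rho g x) <= n%:R) ->
    \sum_(g <- s) ((\int[mu x]_(v in bdry) (root_density mu x (rho g x) v * f1 v)) ^+ 2
       + (\int[mu x]_(v in bdry) (root_density mu x (rho g x) v * f2 v)) ^+ 2)
     <= K * (n%:R + 2) ^+ 3.
  apply: (orbit_sum_bound (kappa := kappa) a0 C1 k0 ac rnP act_mu) line hc => //.
  - by move=> v y z /kP[].
  - by move=> v y z t /kP[].
  - by move=> v y z t /kP[].
  - by move=> v y z t /kP[].
  - by move=> v g y z /kP[].
(* K may be 0; K + 1 makes the degree exactly 3. *)
exists ((K + 1) *: ('X - (- 2)%:P) ^+ 3); split.
  by rewrite size_scale ?size_exp_XsubC// gt_eqF// ltr_wpDl.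
move=> xi [mRe mIm xi1] n.
have [s sE] := (finite_seqP _).1 (disc x n%:R).
rewrite -/(orbit_ball rho x n) in sE.
(* The translated characteristic function is 1 on the boundary and the root density is real, so
   conjugating xi only changes the sign of its imaginary part. *)
have innerE g : normc (L2_inner mu x (boundary_rep rho mu x g one_bdry) xi) ^+ 2 =
    (\int[mu x]_(v in bdry) (root_density mu x (rho g x) v * complex.Re (xi v))) ^+ 2
  + (\int[mu x]_(v in bdry) (root_density mu x (rho g x) v * - complex.Im (xi v))) ^+ 2.
  rewrite /L2_inner /normc sqr_sqrtr ?addr_ge0 ?sqr_ge0//.
  have one v : bdry v -> one_bdry (bact rho g^-1%g v) = 1.
    by rewrite -[in X in X -> _](bdry_bact rho g^-1%g) => bv; rewrite /one_bdry mem_set.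
  congr (_ ^+ 2 + _ ^+ 2); apply: eq_Rintegral => v /set_mem bv;
    rewrite /boundary_rep one// mulr1; case: (xi v) => p q /=;
    by rewrite mul0r ?subr0 ?addr0.
rewrite (_ : orbit_ball rho x n = [set` undup s]); last first.
  by rewrite sE; apply/seteqP; split => g /=; rewrite mem_undup.
rewrite esum_fset; last 2 first.
- exact: finite_seq.
- by move=> g _; rewrite lee_fin sqr_ge0.
rewrite -fsbig_seq ?undup_uniq// sumEFin lee_fin hornerZ horner_exp hornerXsubC opprK.
under eq_bigr do rewrite innerE.
apply: (@le_trans _ _ (K * (n%:R + 2) ^+ 3)); last first.
  by rewrite ler_wpM2r ?exprn_ge0 ?addr_ge0// lerDl.
apply: hK => //.
- exact: measurableT_comp.
- rewrite -xi1; apply: eq_integral => v _; congr EFin.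
  by rewrite sqrrN /normc; case: (xi v) => p q /=; rewrite sqr_sqrtr ?addr_ge0 ?sqr_ge0.
- exact: undup_uniq.
- move=> g; rewrite mem_undup => gs.
  by suff : orbit_ball rho x n g by []; rewrite sE.
Qed.
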